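(* For every constant $d\in\mathbb{N}_{\ge 1}$, the parameterized problem \textsc{Vertex Cover}[mod to $\mathrm{td}\le d$] admits a polynomial kernelization whose output graph has $\mathcal{O}(k^{2^{d-1}})$ vertices. That is, there is a polynomial-time algorithm that, given an instance $(G,\ell,X,k)$ where $G$ is a graph, $\ell\in\mathbb{N}$, $X\subseteq V(G)$ with $\mathrm{td}(G-X)\le d$ and $|X|\le k$, outputs an instance $(G',\ell',X',k')$ of the same kind (so $\mathrm{td}(G'-X')\le d$ and $|X'|\le k'$) with $|V(G')|\in\mathcal{O}(k^{2^{d-1}})$ and encoding size and $k'$ bounded by a polynomial in $k$, such that $G$ has a vertex cover of size at most $\ell$ if and only if $G'$ has a vertex cover of size at most $\ell'$.
   Context: A vertex cover of $G$ is a set $S\subseteq V(G)$ such that every edge has an endpoint in $S$. The treedepth $\mathrm{td}(G)$ of a graph $G$ is the minimum height of a rooted forest $F$ on vertex set $V(G)$ such that for every edge $\{u,v\}$ of $G$, $u$ is an ancestor of $v$ in $F$ or vice versa (height counted in number of vertices on a root-to-leaf path, so edgeless graphs have treedepth 1). The parameterized problem \textsc{Vertex Cover}[mod to $\mathrm{td}\le d$] has instances $(G,\ell,X,k)$ with $X\subseteq V(G)$, $\mathrm{td}(G-X)\le d$, $|X|\le k$; $k$ is the parameter, and the instance is a YES-instance iff $G$ has a vertex cover of size at most $\ell$. A kernelization is a polynomial-time algorithm mapping an instance to an equivalent instance whose size and parameter are bounded by a computable function of $k$; it is polynomial if this function is a polynomial. *)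

(* Defs.v *)
From mathcomp Require Import all_boot.
Set Implicit Arguments. Unset Strict Implicit. Unset Printing Implicit Defensive.

Definition simple_graph (n : nat) (E : {ffun 'I_n * 'I_n -> bool}) : Prop :=
  (forall u v, E (u, v) = E (v, u)) /\ (forall u, E (u, u) = false).

Definition is_vertex_cover (n : nat) (E : {ffun 'I_n * 'I_n -> bool})
    (C : {set 'I_n}) : Prop :=
  forall u v, E (u, v) -> (u \in C) \/ (v \in C).

Definition has_vc_le (n : nat) (E : {ffun 'I_n * 'I_n -> bool}) (l : nat) : Prop :=
  exists C : {set 'I_n}, #|C| <= l /\ is_vertex_cover E C.

(* A rooted forest on vertex set S is given by a parent map p
   (None = root).  u is an ancestor of v (reflexively) iff u lies on the
   parent path starting from v. *)
Definition ancestor (T : finType) (p : T -> option T) (u v : T) : Prop :=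
  exists i, iter i (fun o => obind p o) (Some v) = Some u.

(* td(G[S]) <= d : there is a rooted forest on S of height at most d
   (height = number of vertices on a root-to-leaf path), such that every
   edge of G[S] joins an ancestor-descendant pair.  The height bound says
   that the parent path from any v in S contains at most d vertices
   (which also forces the parent structure to be acyclic, i.e. a forest). *)
Definition td_le (n : nat) (E : {ffun 'I_n * 'I_n -> bool}) (S : {set 'I_n})
    (d : nat) : Prop :=
  exists p : 'I_n -> option 'I_n,
    [/\ forall v u, v \in S -> p v = Some u -> u \in S,
        forall v, v \in S -> iter d (fun o => obind p o) (Some v) = None &
        forall u v, u \in S -> v \in S -> E (u, v) ->
          ancestor p u v \/ ancestor p v u].

Record instance := Instance {
  inst_n : nat;
  inst_E : {ffun 'I_inst_n * 'I_inst_n -> bool};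
  inst_l : nat;
  inst_X : {set 'I_inst_n};
  inst_k : nat
}.

Definition valid_instance (d : nat) (I : instance) : Prop :=
  [/\ simple_graph (inst_E I),
      td_le (inst_E I) (~: inst_X I) d &
      #|inst_X I| <= inst_k I].

Definition yes_instance (I : instance) : Prop := has_vc_le (inst_E I) (inst_l I).

(* self-delimiting binary encoding of a natural number:
   each bit b (least significant first) is written as [true; b],
   the end is marked by false. *)
Fixpoint enc_bin_aux (fuel n : nat) : seq bool :=
  match fuel with
  | 0 => [:: false]
  | fuel'.+1 =>
      if n is 0 then [:: false]
      else [:: true; odd n] ++ enc_bin_aux fuel' n./2
  end.
Definition enc_nat (n : nat) : seq bool := enc_bin_aux n n.

Definition enc_instance (I : instance) : seq bool :=
  enc_nat (inst_n I)
  ++ [seq inst_E I (i, j) | i <- enum 'I_(inst_n I), j <- enum 'I_(inst_n I)]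
  ++ enc_nat (inst_l I)
  ++ [seq (i \in inst_X I) | i <- enum 'I_(inst_n I)]
  ++ enc_nat (inst_k I).

Inductive move := MoveL | MoveR | Stay.

(* states 'I_Q.+1, start state ord0; delta returning None = halt.
   Tape symbols: Some b (bit b) or None (blank). *)
Record TM := MkTM {
  tm_Q : nat;
  tm_delta : 'I_tm_Q.+1 -> option bool -> option ('I_tm_Q.+1 * option bool * move)
}.

(* configuration: state, cells left of head (nearest first), head cell,
   cells right of head. *)
Definition config (M : TM) : Type :=
  ('I_(tm_Q M).+1 * seq (option bool) * option bool * seq (option bool))%type.

Definition init_config (M : TM) (w : seq bool) : config M :=
  match w with
  | [::] => (ord0, [::], None, [::])
  | b :: w' => (ord0, [::], Some b, map Some w')
  end.

Definition step (M : TM) (c : config M) : option (config M) :=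
  let: (q, l, a, r) := c in
  match tm_delta q a with
  | None => None
  | Some (q', b, mv) =>
      Some match mv with
      | Stay => (q', l, b, r)
      | MoveL => match l with
                 | [::] => (q', [::], None, b :: r)
                 | x :: l' => (q', l', x, b :: r)
                 end
      | MoveR => match r with
                 | [::] => (q', b :: l, None, [::])
                 | x :: r' => (q', b :: l, x, r')
                 end
      end
  end.

Definition halted (M : TM) (c : config M) : bool := if step c is None then true else false.

Fixpoint run (M : TM) (t : nat) (c : config M) : config M :=
  match t with
  | 0 => c
  | t'.+1 => match step c with None => c | Some c' => run t' c' end
  end.

Fixpoint read_bits (s : seq (option bool)) : seq bool :=
  match s with
  | Some b :: s' => b :: read_bits s'
  | _ => [::]
  end.

Definition output (M : TM) (c : config M) : seq bool :=
  let: (_, _, a, r) := c in read_bits (a :: r).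

Definition computes_within (M : TM) (w : seq bool) (t : nat) (u : seq bool) : Prop :=
  halted (run t (init_config M w)) /\ output (run t (init_config M w)) = u.

(* Main.v *)
(** A set of modulator vertices conflicts with a component [C] of the rest if
    deleting its neighbours lowers the independence number of [C]. Minimal
    conflicting sets ("chunks") have at most [2 ^ (d - 2) + 1] vertices in treedepth
    [d]. Components are matched to conflicting chunks; those left over may be
    deleted: in a maximum independent set, give up one vertex of each chunk it
    contains and gain it back in the component matched to that chunk. Then the roots
    of the surviving components join the modulator and the treedepth has dropped by
    one. A chunk containing such roots lies on one root path, so up to a constant
    factor it is given by its deepest root and one vertex fewer of [X]; hence the
    exponents of the levels add up to [1 + sum_e (beta e - 1) = 2 ^ (d - 1)].

    Polynomial time comes from programs over four stacks that only touch the
    self-delimiting encoding of their argument on top of one stack: such programs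
    compose, pair and iterate, and they run on one tape. *)
Require Import Defs.
From Stdlib Require Import ZArith Lia FunctionalExtensionality.
From mathcomp Require Import all_boot.
From mathcomp Require Import zify.
Set Implicit Arguments. Unset Strict Implicit. Unset Printing Implicit Defensive.

(** * Turing machines over stacks *)

(** The matching is found by an auction because its final prices exhibit the crown: with more price
    levels than chunks some level is unoccupied, and components that were dropped or whose chunk
    costs more than that level conflict only with chunks above it. The chunk bound solves
    [b' = 2 * b - 1]: a new root creates two kinds of maximum independent sets to destroy, those
    through it and those off it, and one vertex is saved when both must be treated. The modulator
    grows only inside the analysis. Unless the budget turns negative, the output is the subgraph
    induced by [X] and all chosen roots, still with modulator [X], so it inherits the treedepth
    bound and its parameter is the size of [X]. Deleted components lower the independence number by
    a computed amount, and complements of covers are independent sets, so a shift of the budget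
    preserves the answer. Programs code numbers in unary while the budget arrives in binary; it is
    capped at the input length, which is at least the number of vertices, so the answer is
    unchanged. *)

Notation sym := (option bool).
Notation tape := (Z -> sym).

(** A halting machine returns a symbol ([inr]), by which a successor machine can be selected; there
    are only finitely many such symbols. The tape is a total function on the integers, which
    postpones all boundary cases to the final translation. *)
Record mach := Mach {
  mst : finType;
  mst0 : mst;
  mdelta : mst -> sym -> (mst * sym * move) + sym }.

Definition upd (T : tape) (z : Z) (b : sym) : tape :=
  fun y => if Z.eqb y z then b else T y.

Definition shiftz (m : move) (z : Z) : Z :=
  match m with MoveL => Z.sub z 1 | MoveR => Z.add z 1 | Stay => z end.

(** [n] is fuel and not an exact step count: a halted run ignores what is left, which is why time
    bounds can be relaxed freely. *)
Fixpoint runm (M : mach) (n : nat) (q : mst M) (T : tape) (z : Z) :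
    option (sym * tape * Z) :=
  match mdelta q (T z) with
  | inr x => Some (x, T, z)
  | inl (q', b, m) =>
      if n is n'.+1 then runm n' q' (upd T z b) (shiftz m z) else None
  end.

Definition exec (M : mach) (T : tape) (z : Z) (n : nat) (x : sym) (T' : tape)
    (z' : Z) : Prop :=
  runm n (mst0 M) T z = Some (x, T', z').

Lemma upd_id (T : tape) z : upd T z (T z) = T.
Proof.
apply: functional_extensionality => y; rewrite /upd.
by case: Z.eqb_spec => [->|].
Qed.

Lemma runm_mono (M : mach) n m (q : mst M) T z r :
  n <= m -> runm n q T z = Some r -> runm m q T z = Some r.
Proof.
elim: n m q T z => [|n IHn] [|m] q T z //= lenm; case: (mdelta q (T z)) => [[[q' b] mv]|x] //.
exact: IHn.
Qed.

Lemma exec_mono M T z n m x T' z' :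
  exec M T z n x T' z' -> n <= m -> exec M T z m x T' z'.
Proof. by move=> ex le; apply: runm_mono ex. Qed.

Definition ret (x : sym) : mach := @Mach unit tt (fun _ _ => inr x).
Definition rd : mach := @Mach unit tt (fun _ a => inr a).
Definition act (f : sym -> sym) (m : move) : mach :=
  @Mach bool false (fun q a => if q then inr None else inl (true, f a, m)).

(** Handing over control costs one step that rewrites the scanned symbol; this is the additional 1
    in [exec_bind] and the reason for [upd_id]. *)
Definition bind (M : mach) (N : sym -> mach) : mach :=
  @Mach (mst M + {x : sym & mst (N x)})%type (inl (mst0 M))
    (fun q a => match q with
       | inl q => match mdelta q a with
                  | inl (q', b, m) => inl (inl q', b, m)
                  | inr x => inl (inr (Tagged (fun x => mst (N x)) (mst0 (N x))), a, Stay)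
                  end
       | inr q => match mdelta (tagged q) a with
                  | inl (q', b, m) => inl (inr (Tagged (fun x => mst (N x)) q'), b, m)
                  | inr y => inr y
                  end
       end).

Definition loop (M : mach) : mach :=
  @Mach (mst M) (mst0 M)
    (fun q a => match mdelta q a with
       | inl r => inl r
       | inr (Some true) => inl (mst0 M, a, Stay)
       | inr y => inr y
       end).

Lemma exec_ret x T z : exec (ret x) T z 0 x T z. Proof. by []. Qed.
Lemma exec_rd T z : exec rd T z 0 (T z) T z. Proof. by []. Qed.
Lemma exec_act f m T z : exec (act f m) T z 1 None (upd T z (f (T z))) (shiftz m z).
Proof. by []. Qed.

Lemma runm_bindr M N x n (q : mst (N x)) T z :
  runm (M := bind M N) n (inr (Tagged (fun x => mst (N x)) q)) T z = runm n q T z.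
Proof.
elim: n q T z => [|n IHn] q T z /=; case: (mdelta q (T z)) => [[[q' b] m]|y] //=.
Qed.

Lemma exec_bind M N T z n x T1 z1 m y T2 z2 :
  exec M T z n x T1 z1 -> exec (N x) T1 z1 m y T2 z2 ->
  exec (bind M N) T z (n + m.+1) y T2 z2.
Proof.
rewrite /exec /= => ex1 ex2.
elim: n (mst0 M) T z ex1 => [|n IHn] q T z; rewrite (add0n, addSn) /=.
  case E: (mdelta q (T z)) => [[[q' b] mv]|x'] //= [Ex ET Ez].
  by rewrite upd_id Ex ET Ez runm_bindr.
case E: (mdelta q (T z)) => [[[q' b] mv]|x'] /=; first by move=> /IHn.
move=> [Ex ET Ez]; rewrite upd_id Ex ET Ez runm_bindr.
by apply: runm_mono ex2; rewrite addnS leqW // leq_addl.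
Qed.

Lemma exec_loop_done M T z n x T1 z1 :
  x != Some true -> exec M T z n x T1 z1 -> exec (loop M) T z n x T1 z1.
Proof.
rewrite /exec /= => xN; elim: n (mst0 M) T z => [|n IHn] q T0 z0 /=;
  case E: (mdelta q (T0 z0)) => [[[q' b] mv]|x'] //=.
- by move=> [Ex -> ->]; rewrite -Ex in xN *; case: x' xN {Ex E} => [[]|].
- exact: IHn.
- by move=> [Ex -> ->]; rewrite -Ex in xN *; case: x' xN {Ex E} => [[]|].
Qed.

Lemma exec_loop_step M T z n T1 z1 m y T2 z2 :
  exec M T z n (Some true) T1 z1 -> exec (loop M) T1 z1 m y T2 z2 ->
  exec (loop M) T z (n + m.+1) y T2 z2.
Proof.
rewrite /exec /= => ex1 ex2.
elim: n (mst0 M) T z ex1 => [|n IHn] q T z; rewrite (add0n, addSn) /=.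
  case E: (mdelta q (T z)) => [[[q' b] mv]|x'] //= [Ex ET Ez].
  by rewrite Ex upd_id ET Ez.
case E: (mdelta q (T z)) => [[[q' b] mv]|x'] /=; first by move=> /IHn.
move=> [Ex ET Ez]; rewrite Ex upd_id ET Ez.
by apply: runm_mono ex2; rewrite addnS leqW // leq_addl.
Qed.

Fixpoint mvs (m : move) (k : nat) : mach :=
  if k is k'.+1 then bind (act id m) (fun _ => mvs m k') else ret None.

Definition dirz (m : move) : Z :=
  match m with MoveL => Z.opp 1 | MoveR => Zpos xH | Stay => Z0 end.

Lemma exec_mvs m k T z :
  exec (mvs m k) T z (2 * k) None T (z + dirz m * Z.of_nat k)%Z.
Proof.
elim: k z => [|k IHk] z; first by rewrite Z.mul_0_r Z.add_0_r.
have -> : 2 * k.+1 = 1 + (2 * k).+1 by lia.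
apply: exec_bind; first exact: exec_act.
rewrite upd_id; have -> : (z + dirz m * Z.of_nat k.+1 = shiftz m z + dirz m * Z.of_nat k)%Z.
  by case: m {IHk}; cbn [shiftz dirz]; lia.
exact: IHk.
Qed.

(** Each round moves before it tests, so a scan may start on a blank sentinel. *)
Definition scan (m : move) (k : nat) : mach :=
  loop (bind (mvs m k) (fun _ => bind rd (fun a =>
    ret (if a is Some _ then Some true else None)))).

Lemma exec_scan m k n T z :
  (forall i, i < n -> T (z + dirz m * Z.of_nat k * Z.of_nat i.+1)%Z != None) ->
  T (z + dirz m * Z.of_nat k * Z.of_nat n.+1)%Z = None ->
  exec (scan m k) T z ((2 * k + 3) * n.+1) None T
    (z + dirz m * Z.of_nat k * Z.of_nat n.+1)%Z.
Proof.
elim: n z => [|n IHn] z nz z0.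
  rewrite Z.mul_1_r in z0 *; apply: exec_loop_done => //.
  apply: (exec_mono (n := 2 * k + (0 + 0.+1).+1)); last by lia.
  apply: exec_bind; first exact: exec_mvs.
  by apply: exec_bind; [exact: exec_rd | rewrite z0; exact: exec_ret].
have -> : (z + dirz m * Z.of_nat k * Z.of_nat n.+2 =
  (z + dirz m * Z.of_nat k) + dirz m * Z.of_nat k * Z.of_nat n.+1)%Z by lia.
apply: (exec_mono (n := (2 * k + (0 + 0.+1).+1) + ((2 * k + 3) * n.+1).+1)); last by lia.
apply: exec_loop_step.
  apply: exec_bind; first exact: exec_mvs.
  apply: exec_bind; first exact: exec_rd.
  have := nz 0 isT; rewrite Z.mul_1_r.
  by case: (T _) => // a _; exact: exec_ret.
apply: IHn => [i lt_in|].
  have := nz i.+1 lt_in; set y := (z + _)%Z; set y' := (_ + _ + _)%Z.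
  by have -> : y = y' by rewrite /y /y'; lia.
by rewrite -z0; congr T; lia.
Qed.

(** * Four stacks on one tape *)

Inductive stk := S0 | S1 | S2 | S3.
Record stacks := Stacks { s0 : seq bool; s1 : seq bool; s2 : seq bool; s3 : seq bool }.

Definition get (s : stacks) (j : stk) : seq bool :=
  match j with S0 => s0 s | S1 => s1 s | S2 => s2 s | S3 => s3 s end.
Definition put (s : stacks) (j : stk) (l : seq bool) : stacks :=
  let: Stacks c v a b := s in
  match j with
  | S0 => Stacks l v a b | S1 => Stacks c l a b
  | S2 => Stacks c v l b | S3 => Stacks c v a l
  end.
Definition ssize (s : stacks) : nat := size (s0 s) + size (s1 s) + size (s2 s) + size (s3 s).

(* S0 occupies the cells to the right of the origin, so that it can hold the
   contiguous input and output words; the other three stacks are interleaved to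
   the left. Every stack has its bottom next to a blank sentinel near the origin. *)
Definition outdir (j : stk) : move := if j is S0 then MoveR else MoveL.
Definition indir (j : stk) : move := if j is S0 then MoveL else MoveR.
Definition stride (j : stk) : nat := if j is S0 then 1 else 3.
Definition soff (j : stk) : nat :=
  match j with S0 => 0 | S1 => 0 | S2 => 1 | S3 => 2 end.
Definition sent (j : stk) : Z := Z.opp (Z.of_nat (soff j)).
(** The sentinels are the cells [0], [-1] and [-2]; cell [0] serves both [S0] and [S1]. Entries
    start one stride further out, so they never meet a sentinel. *)
Definition pos (j : stk) (i : nat) : Z :=
  (sent j + dirz (outdir j) * Z.of_nat (stride j) * Z.of_nat i.+1)%Z.

(** The default of [nth] forces blanks above the top, so that an outward scan stops there. *)
Definition rep (s : stacks) (T : tape) : Prop :=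
  (forall j i, T (pos j i) = nth None (map Some (rev (get s j))) i) /\
  (forall j, T (sent j) = None).

Lemma pos_inj j i j' i' : pos j i = pos j' i' -> j = j' /\ i = i'.
Proof.
rewrite /pos /sent; case: j; case: j'; cbn [outdir stride soff dirz]; move=> ?;
  (split; first by first [reflexivity | exfalso; lia]); lia.
Qed.

Lemma pos_sent j i j' : pos j i <> sent j'.
Proof. by rewrite /pos /sent; case: j; case: j'; cbn [outdir stride soff dirz]; lia. Qed.

Lemma get_put s j l : get (put s j l) j = l.
Proof. by case: s; case: j. Qed.

Lemma get_putN s j j' l : j <> j' -> get (put s j l) j' = get s j'.
Proof. by case: s; case: j; case: j'. Qed.

Lemma size_get s j : size (get s j) <= ssize s.
Proof. by case: s; case: j => *; rewrite /ssize /=; lia. Qed.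

Lemma ssize_put s j l : ssize (put s j l) + size (get s j) = ssize s + size l.
Proof. by case: s; case: j => *; rewrite /ssize /=; lia. Qed.

Lemma stkP (j j' : stk) : j = j' \/ j <> j'.
Proof. by case: j; case: j'; first [by left | by right]. Qed.

Definition goto_top (j : stk) : mach :=
  bind (mvs MoveL (soff j)) (fun _ => scan (outdir j) (stride j)).

Definition go_home (j : stk) (x : sym) : mach :=
  bind (scan (indir j) (stride j)) (fun _ =>
    bind (mvs MoveR (soff j)) (fun _ => ret x)).

Definition pushm (j : stk) (b : bool) : mach :=
  bind (goto_top j) (fun _ => bind (act (fun _ => Some b) Stay) (fun _ =>
    go_home j None)).

Definition popm (j : stk) : mach :=
  bind (goto_top j) (fun _ => bind (mvs (indir j) (stride j)) (fun _ =>
    bind rd (fun x =>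
      if x is Some _ then bind (act (fun _ => None) Stay) (fun _ => go_home j x)
      else bind (mvs MoveR (soff j)) (fun _ => ret None)))).

Lemma exec_goto_top s T j : rep s T ->
  exec (goto_top j) T 0 (20 * (size (get s j)).+1) None T (pos j (size (get s j))).
Proof.
move=> [rT rS]; set n := size _.
apply: (exec_mono (n := 2 * soff j + ((2 * stride j + 3) * n.+1).+1)); last first.
  by case: (j); cbn [soff stride]; lia.
apply: exec_bind; first exact: exec_mvs.
have -> : (0 + dirz MoveL * Z.of_nat (soff j) = sent j)%Z by rewrite /sent; cbn [dirz]; lia.
apply: exec_scan => [i lt_in|].
  have := rT j i; rewrite /pos => ->.
  by rewrite (nth_map false) ?size_rev.
by have := rT j n; rewrite /pos => ->; rewrite nth_default // size_map size_rev.
Qed.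

(** The start cell itself is never tested, so this covers the return both from a cell just written
    and from one just erased. *)
Lemma exec_go_home s T j n x : rep s T -> n <= size (get s j) ->
  exec (go_home j x) T (pos j n) (20 * n.+1) x T 0.
Proof.
move=> [rT rS] len.
apply: (exec_mono (n := ((2 * stride j + 3) * n.+1) + (2 * soff j + 0.+1).+1)); last first.
  by case: (j); cbn [soff stride]; lia.
have Ez i : (pos j n + dirz (indir j) * Z.of_nat (stride j) * Z.of_nat i.+1 =
   sent j + dirz (outdir j) * Z.of_nat (stride j) * (Z.of_nat n - Z.of_nat i))%Z.
  by rewrite /pos; case: (j); cbn [outdir indir dirz]; lia.
apply: exec_bind.
  apply: (@exec_scan _ _ n) => [i lt_in|]; last first.
    by rewrite Ez; have := rS j; congr (T _ = _); lia.
  rewrite Ez; have := rT j (n - i.+1); rewrite /pos.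
  have -> : Z.of_nat (n - i.+1).+1 = (Z.of_nat n - Z.of_nat i)%Z by lia.
  by move=> ->; rewrite (nth_map false) // size_rev; lia.
apply: exec_bind; first exact: exec_mvs.
rewrite Ez; set z := (_ + _)%Z; have -> : z = 0%Z.
  by rewrite /z /sent; cbn [dirz]; lia.
exact: exec_ret.
Qed.

Lemma rep_push s T j b : rep s T ->
  rep (put s j (b :: get s j)) (upd T (pos j (size (get s j))) (Some b)).
Proof.
move=> [rT rS]; split=> [j' i|j'].
  rewrite /upd; case: Z.eqb_spec => [/pos_inj [-> ->]|ne].
    by rewrite get_put rev_cons map_rcons nth_rcons size_map size_rev ltnn eqxx.
  rewrite rT; case: (stkP j j') => [ej|nj]; last by rewrite get_putN.
  subst j'; rewrite get_put rev_cons map_rcons nth_rcons size_map size_rev.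
  case: ltnP => // len; case: eqP => [ei|_]; first by case: ne; rewrite ei.
  by rewrite nth_default // size_map size_rev.
by rewrite /upd; case: Z.eqb_spec => [/esym/pos_sent|].
Qed.

Lemma rep_pop s T j b l : rep s T -> get s j = b :: l ->
  rep (put s j l) (upd T (pos j (size l)) None).
Proof.
move=> [rT rS] E; split=> [j' i|j'].
  rewrite /upd; case: Z.eqb_spec => [/pos_inj [-> ->]|ne].
    by rewrite get_put nth_default // size_map size_rev.
  rewrite rT; case: (stkP j j') => [ej|nj]; last by rewrite get_putN.
  subst j'; rewrite get_put E rev_cons map_rcons nth_rcons size_map size_rev.
  case: ltnP => // len; rewrite nth_default ?size_map ?size_rev //.
  by case: eqP => [ei|//]; case: ne; rewrite ei.
by rewrite /upd; case: Z.eqb_spec => [/esym/pos_sent|].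
Qed.

Lemma exec_pushm s T j b : rep s T ->
  exists2 T', rep (put s j (b :: get s j)) T' &
    exec (pushm j b) T 0 (50 * (size (get s j)).+1) None T' 0.
Proof.
move=> rT; exists (upd T (pos j (size (get s j))) (Some b)); first exact: rep_push.
set n := size _.
apply: (exec_mono (n := 20 * n.+1 + (1 + (20 * n.+1).+1).+1)); last by lia.
apply: exec_bind; first exact: exec_goto_top.
apply: exec_bind; first exact: exec_act.
by apply: exec_go_home (rep_push j b rT) _; rewrite get_put /= /n; lia.
Qed.

Lemma pos_in j i :
  (pos j i + dirz (indir j) * Z.of_nat (stride j) = if i is i'.+1 then pos j i' else sent j)%Z.
Proof. by case: i => [|i]; rewrite /pos; case: j; cbn [outdir indir dirz stride]; lia. Qed.

Lemma exec_popm_cons s T j b l : rep s T -> get s j = b :: l ->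
  exists2 T', rep (put s j l) T' &
    exec (popm j) T 0 (60 * (size (get s j)).+1) (Some b) T' 0.
Proof.
move=> rT E; exists (upd T (pos j (size l)) None); first exact: rep_pop E.
rewrite E /=; set n := size l.
apply: (exec_mono (n := 20 * n.+2 + ((2 * stride j) + (0 + (1 + (20 * n.+1).+1).+1).+1).+1)); last first.
  by case: (j); cbn [stride]; lia.
have ex := exec_goto_top j rT; rewrite E in ex; apply: exec_bind; first exact: ex.
apply: exec_bind; first exact: exec_mvs.
rewrite pos_in; apply: exec_bind; first exact: exec_rd.
rewrite (proj1 rT) E rev_cons map_rcons nth_rcons size_map size_rev ltnn eqxx.
apply: exec_bind; first exact: exec_act.
by apply: exec_go_home (rep_pop rT E) _; rewrite get_put.
Qed.

Lemma exec_popm_nil s T j : rep s T -> get s j = [::] ->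
  exec (popm j) T 0 60 None T 0.
Proof.
move=> rT E.
apply: (exec_mono (n := 20 * 1 + ((2 * stride j) + (0 + (2 * soff j + 0.+1).+1).+1).+1)); last first.
  by case: (j); cbn [stride soff]; lia.
have ex := exec_goto_top j rT; rewrite E in ex; apply: exec_bind; first exact: ex.
apply: exec_bind; first exact: exec_mvs.
rewrite pos_in; apply: exec_bind; first exact: exec_rd.
rewrite (proj2 rT).
apply: exec_bind; first exact: exec_mvs.
set z := (_ + _)%Z; have -> : z = 0%Z by rewrite /z /sent; cbn [dirz]; lia.
exact: exec_ret.
Qed.

(** * Stack programs, their cost, and their compilation *)

Inductive prog :=
  | Skip
  | Push of stk & bool
  | Seq of prog & prog
  | Pop of stk & prog & prog & prog
  | While of stk & prog.

Inductive ev : prog -> stacks -> stacks -> nat -> Prop :=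
  | EvSkip s : ev Skip s s 1
  | EvPush j b s : ev (Push j b) s (put s j (b :: get s j)) 1
  | EvSeq p q u v w m n : ev p u v m -> ev q v w n -> ev (Seq p q) u w (m + n).+1
  | EvPopT j p q r s l s' n : get s j = true :: l -> ev p (put s j l) s' n ->
      ev (Pop j p q r) s s' n.+1
  | EvPopF j p q r s l s' n : get s j = false :: l -> ev q (put s j l) s' n ->
      ev (Pop j p q r) s s' n.+1
  | EvPopE j p q r s s' n : get s j = [::] -> ev r s s' n ->
      ev (Pop j p q r) s s' n.+1
  | EvWhileT j p s l u v m n : get s j = true :: l -> ev p (put s j l) u m ->
      ev (While j p) u v n -> ev (While j p) s v (m + n).+1
  | EvWhileF j p s l : get s j = false :: l -> ev (While j p) s (put s j l) 1
  | EvWhileE j p s : get s j = [::] -> ev (While j p) s s 1.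

Fixpoint compile (p : prog) : mach :=
  match p with
  | Skip => ret None
  | Push j b => pushm j b
  | Seq p q => bind (compile p) (fun _ => compile q)
  | Pop j p q r => bind (popm j) (fun x =>
      match x with Some true => compile p | Some false => compile q | None => compile r end)
  | While j p => loop (bind (popm j) (fun x =>
      if x is Some true then bind (compile p) (fun _ => ret (Some true)) else ret None))
  end.

Lemma ev_size p s s' n : ev p s s' n -> ssize s' <= ssize s + n.
Proof.
elim=> {p s s' n}.
- by move=> s; lia.
- by move=> j b s; have := ssize_put s j (b :: get s j); rewrite /=; lia.
- by move=> *; lia.
- by move=> j p q r s l s' n E _; have := ssize_put s j l; rewrite E /=; lia.
- by move=> j p q r s l s' n E _; have := ssize_put s j l; rewrite E /=; lia.
- by move=> *; lia.
- by move=> j p s l u v m n E _; have := ssize_put s j l; rewrite E /=; lia.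
- by move=> j p s l E; have := ssize_put s j l; rewrite E /=; lia.
- by move=> *; lia.
Qed.

Lemma ev_pos p s s' n : ev p s s' n -> 0 < n.
Proof. by elim=> // *; lia. Qed.

(** [B] bounds the total stack height during the whole run: a step adds at most one bit, so
    [ssize s + n <= B] passes to every subprogram. Each push or pop then walks [O(B)] cells. *)
Lemma compile_correct p s s' n B T : ev p s s' n -> rep s T -> ssize s + n <= B ->
  exists2 T', rep s' T' & exists x, exec (compile p) T 0 (100 * n * B.+1) x T' 0.
Proof.
move=> evp; elim: evp T => {p s s' n}.
- by move=> s T rT _; exists T => //; exists None; apply: exec_mono (exec_ret _ _ _) _.
- move=> j b s T rT leB; have [T' rT' ex] := exec_pushm j b rT.
  exists T' => //; exists None; apply: exec_mono ex _.
  by have := size_get s j; nia.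
- move=> p q u v w m n ev1 IH1 ev2 IH2 T rT leB.
  have [T1 rT1 [x1 ex1]] := IH1 T rT ltac:(lia).
  have [T2 rT2 [x2 ex2]] := IH2 T1 rT1 ltac:(have := ev_size ev1; lia).
  exists T2 => //; exists x2; apply: exec_mono (exec_bind ex1 ex2) _.
  have := ev_pos ev1; have := ev_pos ev2; nia.
- move=> j p q r s l s' n E ev1 IH T rT leB.
  have [T1 rT1 ex1] := exec_popm_cons rT E.
  have Es := ssize_put s j l; rewrite E /= in Es.
  have [T2 rT2 [x2 ex2]] := IH T1 rT1 ltac:(lia).
  exists T2 => //; exists x2; apply: exec_mono (exec_bind ex1 ex2) _.
  have := size_get s j; nia.
- move=> j p q r s l s' n E ev1 IH T rT leB.
  have [T1 rT1 ex1] := exec_popm_cons rT E.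
  have Es := ssize_put s j l; rewrite E /= in Es.
  have [T2 rT2 [x2 ex2]] := IH T1 rT1 ltac:(lia).
  exists T2 => //; exists x2; apply: exec_mono (exec_bind ex1 ex2) _.
  have := size_get s j; nia.
- move=> j p q r s s' n E ev1 IH T rT leB.
  have ex1 := exec_popm_nil rT E.
  have [T2 rT2 [x2 ex2]] := IH T rT ltac:(lia).
  exists T2 => //; exists x2; apply: exec_mono (exec_bind ex1 ex2) _.
  nia.
- move=> j p s l u v m n E ev1 IH1 ev2 IH2 T rT leB.
  have [T1 rT1 ex1] := exec_popm_cons rT E.
  have Es := ssize_put s j l; rewrite E /= in Es.
  have [T2 rT2 [x2 ex2]] := IH1 T1 rT1 ltac:(lia).
  have [T3 rT3 [x3 ex3]] := IH2 T2 rT2 ltac:(have := ev_size ev1; lia).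
  exists T3 => //; exists x3.
  have ex4 := exec_bind (N := fun _ => ret (Some true)) ex2 (exec_ret _ _ _).
  apply: exec_mono (exec_loop_step (exec_bind (N := fun x => if x is Some true
    then bind (compile p) (fun _ => ret (Some true)) else ret None) ex1 ex4) ex3) _.
  have := size_get s j; have := ev_pos ev1; nia.
- move=> j p s l E T rT leB; have [T1 rT1 ex1] := exec_popm_cons rT E.
  exists T1 => //; exists None; apply: exec_loop_done => //.
  apply: exec_mono (exec_bind (N := fun x => if x is Some true
    then bind (compile p) (fun _ => ret (Some true)) else ret None) ex1 (exec_ret _ _ _)) _.
  have := size_get s j; nia.
- move=> j p s E T rT leB; have ex1 := exec_popm_nil rT E.
  exists T => //; exists None; apply: exec_loop_done => //.
  apply: exec_mono (exec_bind (N := fun x => if x is Some true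
    then bind (compile p) (fun _ => ret (Some true)) else ret None) ex1 (exec_ret _ _ _)) _.
  nia.
Qed.

(** * Translation into the concrete machine model *)

(** The prescribed start state [ord0] only enters [mst0 M]; the states of [M] are shifted past
    it. *)
Definition tm_of (M : mach) : TM :=
  @MkTM #|mst M| (fun q a =>
    if unlift ord0 q is Some i then
      match mdelta (enum_val i) a with
      | inl (q', b, m) => Some (lift ord0 (enum_rank q'), b, m)
      | inr _ => None
      end
    else Some (lift ord0 (enum_rank (mst0 M)), a, Stay)).

(** Past the end of either list the default of [nth] gives a blank, as [step] does when a list is
    exhausted. *)
Definition views (M : TM) (c : config M) (T : tape) (z : Z) : Prop :=
  let: (q, l, a, r) := c in
  [/\ forall i, nth None l i = T (z - Z.of_nat i.+1)%Z, a = T z &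
      forall i, nth None r i = T (z + Z.of_nat i.+1)%Z].

Lemma step_tm_of M q l a r T z :
  views (M := tm_of M) (lift ord0 (enum_rank q), l, a, r) T z ->
  match mdelta q (T z) with
  | inl (q', b, m) => exists l' a' r',
      step (M := tm_of M) (lift ord0 (enum_rank q), l, a, r) =
        Some (lift ord0 (enum_rank q'), l', a', r') /\
      views (M := tm_of M) (lift ord0 (enum_rank q'), l', a', r') (upd T z b) (shiftz m z)
  | inr _ => step (M := tm_of M) (lift ord0 (enum_rank q), l, a, r) = None
  end.
Proof.
move=> [vl va vr]; rewrite /step [tm_delta _ _]/= -va liftK enum_rankK.
case: (mdelta q a) => [[[q' b] m]|//].
have updN y : y <> z -> upd T z b y = T y by move=> ne; rewrite /upd; case: Z.eqb_spec.
have updE : upd T z b z = b by rewrite /upd Z.eqb_refl.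
case: m; cbn [shiftz].
- case: l vl => [|x l] vl; do 3!eexists; (split; first reflexivity); split=> /=.
  + by move=> i; rewrite updN; last lia; have := vl i.+1; rewrite !nth_nil => ->; congr T; lia.
  + by rewrite updN; last lia; have := vl 0.
  + by case=> [|i] /=; [rewrite -{1}updE; congr upd; lia | rewrite updN; last lia; rewrite vr; congr T; lia].
  + by move=> i; rewrite updN; last lia; have /= -> := vl i.+1; congr T; lia.
  + by rewrite updN; last lia; have := vl 0.
  + by case=> [|i] /=; [rewrite -{1}updE; congr upd; lia | rewrite updN; last lia; rewrite vr; congr T; lia].
- case: r vr => [|x r] vr; do 3!eexists; (split; first reflexivity); split=> /=.
  + by case=> [|i] /=; [rewrite -{1}updE; congr upd; lia | rewrite updN; last lia; rewrite vl; congr T; lia].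
  + by rewrite updN; last lia; have := vr 0.
  + by move=> i; rewrite updN; last lia; have := vr i.+1; rewrite !nth_nil => ->; congr T; lia.
  + by case=> [|i] /=; [rewrite -{1}updE; congr upd; lia | rewrite updN; last lia; rewrite vl; congr T; lia].
  + by rewrite updN; last lia; have := vr 0.
  + by move=> i; rewrite updN; last lia; have /= -> := vr i.+1; congr T; lia.
- do 3!eexists; (split; first reflexivity); split=> [i||i] /=.
  + by rewrite updN; [exact: vl | lia].
  + by rewrite updE.
  + by rewrite updN; [exact: vr | lia].
Qed.

#[local] Arguments step : simpl never.

Lemma run_tm_of M n q l a r T z x T' z' :
  views (M := tm_of M) (lift ord0 (enum_rank q), l, a, r) T z ->
  runm n q T z = Some (x, T', z') ->
  halted (run (M := tm_of M) n (lift ord0 (enum_rank q), l, a, r)) /\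
  views (run (M := tm_of M) n (lift ord0 (enum_rank q), l, a, r)) T' z'.
Proof.
elim: n q l a r T z => [|n IHn] q l a r T z v /=;
  have := step_tm_of v; case: (mdelta q (T z)) => [[[q' b] m]|y] //.
- by move=> E [Ex ET Ez]; rewrite -ET -Ez; split=> //; rewrite /halted E.
- by move=> [l' [a' [r' [-> v']]]]; exact: IHn.
- by move=> E [Ex ET Ez]; rewrite E -ET -Ez; split=> //; rewrite /halted E.
Qed.

Lemma read_bits_views s u :
  (forall i, nth None s i = nth None (map Some u) i) -> read_bits s = u.
Proof.
elim: u s => [|b u IHu] [|[b'|] s] //= eq_su; try by have := eq_su 0.
have /= [->] := eq_su 0; congr (_ :: _); apply: IHu => i; exact: (eq_su i.+1).
Qed.

(** The head starts on the first input bit, in cell [1], the bottom of [S0], whereas compiled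
    programs start and end in cell [0]; hence the two moves. As the bottom of [S0] is its leftmost
    cell, words lie on [S0] in reverse. *)
Definition prog_tm (p : prog) : TM :=
  tm_of (bind (act id MoveL) (fun _ => bind (compile p) (fun _ => act id MoveR))).

Lemma prog_tm_computes p w u v a b n :
  0 < size w ->
  ev p (Stacks (rev w) [::] [::] [::]) (Stacks (rev u) v a b) n ->
  computes_within (prog_tm p) w (200 * n * (size w + n).+1) u.
Proof.
case: w => // b0 w _ evp; set N := 200 * _ * _.
pose T z := if Z.ltb 0 z then nth None (map Some (b0 :: w)) (Z.to_nat (z - 1)) else None.
have rT : rep (Stacks (rev (b0 :: w)) [::] [::] [::]) T.
  split=> [j i|j].
    case: j => /=; rewrite /T /pos /sent; cbn [soff outdir stride dirz];
      case: Z.ltb_spec => ?; rewrite ?nth_nil //; try (exfalso; lia).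
    by rewrite revK; congr (nth None (map Some (b0 :: w)) _); lia.
  by rewrite /T; case: Z.ltb_spec => // lt; exfalso; case: j lt; rewrite /sent /=; lia.
have [|T' rT' [x ex]] := compile_correct (B := size (b0 :: w) + n) evp rT.
  by rewrite /ssize /= size_rev /=; lia.
set M := bind (act id MoveL) (fun _ => bind (compile p) (fun _ => act id MoveR)).
have [m [y [lem exM]]] : exists m y, m < N /\ exec M T 1 m y T' 1.
  eexists; exists None; split; last first.
    apply: exec_bind; first exact: exec_act.
    rewrite upd_id; apply: exec_bind; first exact: ex.
    by have := exec_act id MoveR T' 0; rewrite upd_id; apply.
  by have := ev_pos evp; rewrite /N /=; nia.
have exN := exec_mono exM (m := N.-1) ltac:(lia).
pose c0 : config (prog_tm p) := (lift ord0 (enum_rank (mst0 M)), [::], Some b0, map Some w).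
have v0 : views c0 T 1.
  split=> [i||i].
  - by rewrite nth_nil /T; case: Z.ltb_spec => // ?; exfalso; lia.
  - by [].
  - rewrite /T; case: Z.ltb_spec => [?|?]; last by exfalso; lia.
    by have -> : Z.to_nat (1 + Z.of_nat i.+1 - 1) = i.+1 by lia.
have [hN vN] := run_tm_of v0 exN.
have runE : run N (init_config (prog_tm p) (b0 :: w)) = run N.-1 c0.
  have st : step (init_config (prog_tm p) (b0 :: w)) = Some c0.
    by rewrite /step /= unlift_none.
  have EN : N = N.-1.+1 by lia.
  by rewrite [in LHS]EN /= st.
rewrite /computes_within runE; split=> //.
case: (run N.-1 c0) vN => [[[q l] a'] r] [_ va vr].
apply: read_bits_views => i; have := proj1 rT' S0 i; rewrite /= revK => <-.
case: i => [|i]; first by rewrite /= va.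
rewrite -[LHS]/(nth None r i) vr /pos /sent; cbn [outdir dirz stride soff]; congr T'; lia.
Qed.

(** * Polynomial-time functions on trees *)

Inductive tree := Lf | Nd of tree & tree.

(** Preorder code: the end of a subtree is determined by its own bits, without length fields or
    separators. *)
Fixpoint enc (t : tree) : seq bool :=
  if t is Nd a b then true :: enc a ++ enc b else [:: false].

Definition evle p s s' n := exists2 m, m <= n & ev p s s' m.

Lemma evle_mono p s s' m n : evle p s s' m -> m <= n -> evle p s s' n.
Proof. by move=> [k lek evk] lem; exists k => //; apply: leq_trans lek lem. Qed.

Lemma evle_seq p q u v w m n : evle p u v m -> evle q v w n -> evle (Seq p q) u w (m + n).+1.
Proof.
by move=> [k lek evk] [l lel evl]; exists (k + l).+1; [lia | apply: EvSeq evk evl].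
Qed.

Lemma evle_skip s : evle Skip s s 1. Proof. by exists 1 => //; constructor. Qed.

Lemma evle_push0 b c v a d : evle (Push S0 b) (Stacks c v a d) (Stacks (b :: c) v a d) 1.
Proof. by exists 1 => //; exact: (EvPush S0). Qed.
Lemma evle_push1 b c v a d : evle (Push S1 b) (Stacks c v a d) (Stacks c (b :: v) a d) 1.
Proof. by exists 1 => //; exact: (EvPush S1). Qed.
Lemma evle_push2 b c v a d : evle (Push S2 b) (Stacks c v a d) (Stacks c v (b :: a) d) 1.
Proof. by exists 1 => //; exact: (EvPush S2). Qed.
Lemma evle_push3 b c v a d : evle (Push S3 b) (Stacks c v a d) (Stacks c v a (b :: d)) 1.
Proof. by exists 1 => //; exact: (EvPush S3). Qed.

Lemma evle_popT j p q r s l s' n : get s j = true :: l ->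
  evle p (put s j l) s' n -> evle (Pop j p q r) s s' n.+1.
Proof. by move=> E [m lem evm]; exists m.+1 => //; apply: EvPopT E evm. Qed.
Lemma evle_popF j p q r s l s' n : get s j = false :: l ->
  evle q (put s j l) s' n -> evle (Pop j p q r) s s' n.+1.
Proof. by move=> E [m lem evm]; exists m.+1 => //; apply: EvPopF E evm. Qed.
Lemma evle_whileT j p s l u v m n : get s j = true :: l -> evle p (put s j l) u m ->
  evle (While j p) u v n -> evle (While j p) s v (m + n).+1.
Proof.
move=> E [k lek evk] [k' lek' evk']; exists (k + k').+1; first by lia.
exact: EvWhileT E evk evk'.
Qed.
Lemma evle_whileF j p s l : get s j = false :: l -> evle (While j p) s (put s j l) 1.
Proof. by move=> E; exists 1 => //; apply: EvWhileF E. Qed.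

Lemma evle_size p s s' n : evle p s s' n -> ssize s' <= ssize s + n.
Proof. by move=> [m lem /ev_size]; lia. Qed.

(* Bits parked on an auxiliary stack are each topped by the marker [true], above
   a final [false], so that they can be unloaded without counting. *)
Definition emit (d : bool) (bits a : seq bool) : seq bool :=
  if d then foldl (fun a x => true :: x :: a) a bits else a.

Lemma emit_cat d u v a : emit d (u ++ v) a = emit d v (emit d u a).
Proof. by case: d => //=; rewrite foldl_cat. Qed.

Definition write2 (d x : bool) := if d then Seq (Push S2 x) (Push S2 true) else Skip.
Definition write3 (d x : bool) := if d then Seq (Push S3 x) (Push S3 true) else Skip.

Lemma evle_write2 d x c v a b :
  evle (write2 d x) (Stacks c v a b) (Stacks c v (emit d [:: x] a) b) 3.
Proof.
case: d => /=; last by apply: evle_mono (evle_skip _) _.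
exact: evle_seq (evle_push2 _ _ _ _ _) (evle_push2 _ _ _ _ _).
Qed.
Lemma evle_write3 d x c v a b :
  evle (write3 d x) (Stacks c v a b) (Stacks c v a (emit d [:: x] b)) 3.
Proof.
case: d => /=; last by apply: evle_mono (evle_skip _) _.
exact: evle_seq (evle_push3 _ _ _ _ _) (evle_push3 _ _ _ _ _).
Qed.

(* The unary counter on S0 holds the number of subtrees still to be read. *)
Definition walk_loop (d e : bool) : prog :=
  While S0 (Pop S1
    (Seq (Seq (Push S0 true) (Push S0 true)) (Seq (write2 d true) (write3 e true)))
    (Seq (write2 d false) (write3 e false))
    Skip).

Definition walk (d e : bool) : prog :=
  Seq (Push S0 false) (Seq (Push S0 true) (walk_loop d e)).

(** The rest of the run is a parameter, in continuation style: for a node, the walk over the left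
    subtree continues with the walk over the right one, and the two induction hypotheses compose
    directly. *)
Lemma evle_walk_loop d e t c v a b s n :
  evle (walk_loop d e) (Stacks c v (emit d (enc t) a) (emit e (enc t) b)) s n ->
  evle (walk_loop d e) (Stacks (true :: c) (enc t ++ v) a b) s (20 * size (enc t) + n).
Proof.
elim: t c v a b n => [|t IHt u IHu] c v a b n ev0.
  apply: evle_mono; first apply: (@evle_whileT S0 _ (Stacks (true :: c) _ a b) c _ _ _ _ _ _ ev0) => //=.
    apply: (@evle_popF S1 _ _ _ (Stacks c _ a b) v) => //=.
    exact: evle_seq (evle_write2 _ _ _ _ _ _) (evle_write3 _ _ _ _ _ _).
  by rewrite /=; lia.
rewrite /= -catA; apply: evle_mono.
  apply: (@evle_whileT S0 _ (Stacks (true :: c) _ a b) c) => //=.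
    apply: (@evle_popT S1 _ _ _ (Stacks c _ a b)) => //=.
    apply: evle_seq; first exact: evle_seq (evle_push0 _ _ _ _ _) (evle_push0 _ _ _ _ _).
    exact: evle_seq (evle_write2 _ _ _ _ _ _) (evle_write3 _ _ _ _ _ _).
  apply: IHt; apply: IHu.
  have -> A : emit A (enc u) (emit A (enc t) (emit A [:: true] a)) = emit A (enc (Nd t u)) a.
    by rewrite -!emit_cat.
  have -> A : emit A (enc u) (emit A (enc t) (emit A [:: true] b)) = emit A (enc (Nd t u)) b.
    by rewrite -!emit_cat.
  exact: ev0.
by rewrite /= size_cat; lia.
Qed.

Lemma evle_walk d e t c v a b :
  evle (walk d e) (Stacks c (enc t ++ v) a b)
    (Stacks c v (emit d (enc t) a) (emit e (enc t) b)) (20 * size (enc t) + 5).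
Proof.
apply: evle_mono.
  apply: evle_seq; first exact: evle_push0.
  apply: evle_seq; first exact: evle_push0.
  by apply: evle_walk_loop; apply: evle_whileF.
by lia.
Qed.

Definition unload2 : prog := While S2 (Pop S2 (Push S1 true) (Push S1 false) Skip).
Definition unload3 : prog := While S3 (Pop S3 (Push S1 true) (Push S1 false) Skip).

Lemma evle_bit2 x c v a b :
  evle (Pop S2 (Push S1 true) (Push S1 false) Skip) (Stacks c v (x :: a) b)
    (Stacks c (x :: v) a b) 2.
Proof.
case: x; [apply: (@evle_popT S2) | apply: (@evle_popF S2)]; try reflexivity; exact: evle_push1.
Qed.

Lemma evle_unload2 bits c v a b :
  evle unload2 (Stacks c v (emit true bits (false :: a)) b)
    (Stacks c (bits ++ v) a b) (3 * size bits + 1).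
Proof.
elim/last_ind: bits v => [|bits x IH] v; first exact: (evle_whileF (j := S2)).
rewrite -cats1 emit_cat -catA /= size_cat; apply: evle_mono.
  apply: (@evle_whileT S2) => /=; [reflexivity | exact: evle_bit2 | exact: (IH (x :: v))].
by rewrite /=; lia.
Qed.

Lemma evle_bit3 x c v a b :
  evle (Pop S3 (Push S1 true) (Push S1 false) Skip) (Stacks c v a (x :: b))
    (Stacks c (x :: v) a b) 2.
Proof.
case: x; [apply: (@evle_popT S3) | apply: (@evle_popF S3)]; try reflexivity; exact: evle_push1.
Qed.

Lemma evle_unload3 bits c v a b :
  evle unload3 (Stacks c v a (emit true bits (false :: b)))
    (Stacks c (bits ++ v) a b) (3 * size bits + 1).
Proof.
elim/last_ind: bits v => [|bits x IH] v; first exact: (evle_whileF (j := S3)).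
rewrite -cats1 emit_cat -catA /= size_cat; apply: evle_mono.
  apply: (@evle_whileT S3) => /=; [reflexivity | exact: evle_bit3 | exact: (IH (x :: v))].
by rewrite /=; lia.
Qed.

Definition dup_prog : prog :=
  Seq (Push S2 false) (Seq (Push S3 false) (Seq (walk true true) (Seq unload2 unload3))).
Definition drop_prog : prog := walk false false.
(** Unloading [S2] before [S3] puts the second tree on top. *)
Definition swap_prog : prog :=
  Seq (Push S2 false) (Seq (walk true false) (Seq (Push S3 false)
    (Seq (walk false true) (Seq unload2 unload3)))).

Lemma evle_dup t c v a b :
  evle dup_prog (Stacks c (enc t ++ v) a b) (Stacks c (enc t ++ enc t ++ v) a b)
    (40 * (size (enc t)).+1).
Proof.
apply: evle_mono.
  apply: evle_seq; first exact: evle_push2.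
  apply: evle_seq; first exact: evle_push3.
  apply: evle_seq; first exact: evle_walk.
  apply: evle_seq; first exact: evle_unload2.
  exact: evle_unload3.
by lia.
Qed.

Lemma evle_drop t c v a b :
  evle drop_prog (Stacks c (enc t ++ v) a b) (Stacks c v a b) (40 * (size (enc t)).+1).
Proof. by apply: evle_mono; [exact: evle_walk | lia]. Qed.

Lemma evle_swap t u c v a b :
  evle swap_prog (Stacks c (enc t ++ enc u ++ v) a b) (Stacks c (enc u ++ enc t ++ v) a b)
    (40 * (size (enc t) + size (enc u)).+1).
Proof.
apply: evle_mono.
  apply: evle_seq; first exact: evle_push2.
  apply: evle_seq; first exact: evle_walk.
  apply: evle_seq; first exact: evle_push3.
  apply: evle_seq; first exact: evle_walk.
  apply: evle_seq; first exact: evle_unload2.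
  exact: evle_unload3.
by lia.
Qed.

(** * Coded data and the basic closure properties of polynomial time *)

Class coded (A : Type) := code : A -> tree.
#[export] Hint Mode coded ! : typeclass_instances.
#[export] Instance coded_unit : coded unit := fun _ => Lf.
#[export] Instance coded_bool : coded bool := fun b => if b then Nd Lf Lf else Lf.
(** Unary: a number may occur in a program only if its value, and not just its bit length, is
    polynomially bounded. *)
#[export] Instance coded_nat : coded nat := fix c n := if n is n'.+1 then Nd Lf (c n') else Lf.
#[export] Instance coded_pair A B `{coded A} `{coded B} : coded (A * B) :=
  fun x => Nd (code x.1) (code x.2).
#[export] Instance coded_seq A `{coded A} : coded (seq A) :=
  fix c l := if l is x :: l' then Nd (code x) (c l') else Lf.

Definition sz A `{coded A} (x : A) : nat := size (enc (code x)).

(* Frame property: whatever lies below the argument and on the other stacks is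
   left unchanged, which is what makes composition and pairing possible. *)
Definition PT A B `{coded A} `{coded B} (f : A -> B) : Prop :=
  exists p c, forall x cn v a b,
    evle p (Stacks cn (enc (code x) ++ v) a b)
      (Stacks cn (enc (code (f x)) ++ v) a b) (c * (sz x).+1 ^ c).

Definition polyb (f : nat -> nat) : Prop := exists c, forall n, f n <= c * n.+1 ^ c.

Lemma polyE c c' m n : c <= c' -> m <= n -> c * m.+1 ^ c <= c' * n.+1 ^ c'.
Proof.
move=> lec lem; apply: leq_mul => //; apply: (@leq_trans (n.+1 ^ c)); last by rewrite leq_pexp2l.
by case: c lec => // c _; rewrite leq_exp2r.
Qed.

Lemma polyb_le f g : (forall n, f n <= g n) -> polyb g -> polyb f.
Proof. by move=> le [c cP]; exists c => n; apply: leq_trans (le n) (cP n). Qed.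
Lemma polyb_const k : polyb (fun _ => k).
Proof. by exists k => n; rewrite leq_pmulr // expn_gt0. Qed.
Lemma polyb_id : polyb id.
Proof. by exists 1 => n; rewrite expn1; lia. Qed.
Lemma polyb_add f g : polyb f -> polyb g -> polyb (fun n => f n + g n).
Proof.
move=> [c cP] [d dP]; exists (c + d) => n; rewrite mulnDl; apply: leq_add.
  by apply: leq_trans (cP n) _; rewrite leq_mul2l leq_pexp2l ?leq_addr ?orbT.
by apply: leq_trans (dP n) _; rewrite leq_mul2l leq_pexp2l ?leq_addl ?orbT.
Qed.
Lemma polyb_mul f g : polyb f -> polyb g -> polyb (fun n => f n * g n).
Proof.
move=> [c cP] [d dP]; exists (c * d + (c + d)) => n.
apply: leq_trans (leq_mul (cP n) (dP n)) _.
rewrite mulnACA -expnD; apply: leq_mul; first by lia.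
by rewrite leq_pexp2l //; lia.
Qed.
Lemma polyb_exp f k : polyb f -> polyb (fun n => f n ^ k).
Proof.
move=> pf; elim: k => [|k IHk]; first exact: polyb_const.
by apply: polyb_le (polyb_mul pf IHk) => n; rewrite expnS.
Qed.
Lemma polyb_poly c f : polyb f -> polyb (fun n => c * (f n).+1 ^ c).
Proof.
move=> pf; apply: polyb_mul (polyb_const c) (polyb_exp _ _).
by apply: polyb_le (polyb_add pf (polyb_const 1)) => n; rewrite addn1.
Qed.
Lemma polyb_S f : polyb f -> polyb (fun n => (f n).+1).
Proof. by move=> pf; apply: polyb_le (polyb_add pf (polyb_const 1)) => n; rewrite addn1. Qed.

Lemma polyb_comp f g : {homo f : m n / m <= n} -> polyb f -> polyb g -> polyb (fun n => f (g n)).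
Proof.
move=> homo_f [c cP] pg; apply: polyb_le (polyb_poly c pg) => n; exact: cP.
Qed.

Lemma sz_pair A B `{coded A} `{coded B} (x : A) (y : B) : sz (x, y) = (sz x + sz y).+1.
Proof. by rewrite /sz /= size_cat. Qed.
Lemma sz_cons A `{coded A} (x : A) l : sz (x :: l) = (sz x + sz l).+1.
Proof. by rewrite /sz /= size_cat. Qed.
Lemma sz_nat (n : nat) : sz n = (2 * n).+1.
Proof. by elim: n => // n; rewrite /sz /= => ->; lia. Qed.
Lemma sz_bool (b : bool) : sz b <= 3.
Proof. by case: b. Qed.
Lemma sz_gt0 A `{coded A} (x : A) : 0 < sz x.
Proof. by rewrite /sz; case: (code x). Qed.
Lemma sz_seq A `{coded A} (l : seq A) : sz l = (\sum_(x <- l) (sz x).+1).+1.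
Proof.
elim: l => [|x l IHl]; first by rewrite big_nil.
by rewrite sz_cons big_cons IHl; lia.
Qed.

Section PT_core.
Context {G : Type} `{coded G}.

Lemma PT_intro A B `{coded A} `{coded B} (f : A -> B) p q :
  (forall x cn v a b, evle p (Stacks cn (enc (code x) ++ v) a b)
      (Stacks cn (enc (code (f x)) ++ v) a b) (q (sz x))) -> polyb q -> PT f.
Proof.
move=> evp [c cP]; exists p, c => x cn v a b; exact: evle_mono (evp _ _ _ _ _) (cP _).
Qed.

(** A monotone time bound in any upper estimate of the input size is the form that composition
    needs. *)
Lemma PT_elim A B `{coded A} `{coded B} (f : A -> B) : PT f -> exists p q,
  [/\ forall x cn v a b n, sz x <= n -> evle p (Stacks cn (enc (code x) ++ v) a b)
      (Stacks cn (enc (code (f x)) ++ v) a b) (q n), polyb q & {homo q : m n / m <= n}].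
Proof.
move=> [p [c evp]]; exists p, (fun n => c * n.+1 ^ c); split.
- move=> x cn v a b n lexn; apply: evle_mono (evp _ _ _ _ _) _; exact: polyE.
- by exists c.
- by move=> m n lemn; exact: polyE.
Qed.

(** A step pushes at most one bit, so running time bounds output size. *)
Lemma PT_size A B `{coded A} `{coded B} (f : A -> B) : PT f ->
  exists c, forall x, sz (f x) <= c * (sz x).+1 ^ c.
Proof.
move=> /PT_elim [p [q [evp pq _]]].
have [c cP] : polyb (fun n => n + q n) by exact: polyb_add polyb_id pq.
exists c => x; apply: leq_trans (cP _).
have := evle_size (evp x [::] [::] [::] [::] _ (leqnn _)).
by rewrite /ssize /= !cats0 /sz; lia.
Qed.

Lemma PT_ext A B `{coded A} `{coded B} (f g : A -> B) : f =1 g -> PT g -> PT f.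
Proof.
by move=> eq_fg [p [c evp]]; exists p, c => x cn v a b; rewrite eq_fg.
Qed.

(* Constructors are free: a list cell has the code of a pair, and a natural
   number that of a list of units. *)
Lemma PT_recode A B C `{coded A} `{coded B} `{coded C} (h : B -> C) (f : A -> B) :
  (forall x, code (h x) = code x) -> PT f -> PT (fun x => h (f x)).
Proof. by move=> eqh [p [c evp]]; exists p, c => x *; rewrite eqh. Qed.

Lemma PT_id : PT (fun x : G => x).
Proof.
apply: (@PT_intro _ _ _ _ _ Skip (fun _ => 1)) => [*|]; last exact: polyb_const.
exact: evle_skip.
Qed.

Lemma PT_comp A B `{coded A} `{coded B} (f : G -> A) (g : A -> B) :
  PT g -> PT f -> PT (fun x => g (f x)).
Proof.
move=> /PT_elim [q [qc [evq pq hq]]] /[dup] /PT_size [c fc] /PT_elim [p [pc [evp pp hp]]].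
apply: (@PT_intro _ _ _ _ _ (Seq p q) (fun n => (pc n + qc (c * n.+1 ^ c)).+1)).
  move=> x cn v a b; apply: evle_seq; first exact: evp.
  by apply: evq; exact: fc.
apply: polyb_S; apply: polyb_add => //; apply: polyb_comp => //.
exact: polyb_poly polyb_id.
Qed.

(** The input is duplicated, [g] runs on the top copy, its result is swapped below the other copy,
    and [f] runs on that one; the frame property protects what lies underneath. The last push
    supplies the node bit of the pair. *)
Lemma PT_pair A B `{coded A} `{coded B} (f : G -> A) (g : G -> B) :
  PT f -> PT g -> PT (fun x => (f x, g x)).
Proof.
move=> /[dup] /PT_size [c fc] /PT_elim [p [pc [evp pp hp]]].
move=> /[dup] /PT_size [d gc] /PT_elim [q [qc [evq pq hq]]].
apply: (@PT_intro _ _ _ _ _ (Seq dup_prog (Seq q (Seq swap_prog (Seq p (Push S1 true)))))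
  (fun n => 40 * n.+1 + qc n + 40 * (d * n.+1 ^ d + n).+1 + pc n + 5)).
  move=> x cn v a b; apply: evle_mono.
    apply: evle_seq; first exact: evle_dup.
    apply: evle_seq; first exact: evq (leqnn _).
    apply: evle_seq; first exact: evle_swap.
    apply: evle_seq; first exact: evp (leqnn _).
    by rewrite /= -catA; exact: evle_push1.
  by have := gc x; rewrite /sz; lia.
have P1 : polyb (fun n => 40 * n.+1) by apply: polyb_mul (polyb_const _) (polyb_S polyb_id).
apply: polyb_add (polyb_const _); apply: polyb_add pp.
apply: polyb_add; first exact: polyb_add.
apply: polyb_mul (polyb_const _) (polyb_S _); apply: polyb_add polyb_id.
exact: polyb_poly polyb_id.
Qed.

Lemma PT_snd A B `{coded A} `{coded B} : PT (fun x : A * B => x.2).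
Proof.
apply: (@PT_intro _ _ _ _ _ (Pop S1 drop_prog Skip Skip) (fun n => (40 * n.+1).+1)) => [[x y] cn v a b|].
  apply: (@evle_popT S1) => //=; rewrite -catA; apply: evle_mono; first exact: evle_drop.
  by rewrite /sz /= size_cat; lia.
by apply: polyb_S (polyb_mul (polyb_const _) (polyb_S polyb_id)).
Qed.

Lemma PT_fst A B `{coded A} `{coded B} : PT (fun x : A * B => x.1).
Proof.
apply: (@PT_intro _ _ _ _ _ (Pop S1 (Seq swap_prog drop_prog) Skip Skip)
  (fun n => (80 * n.+1).+3)) => [[x y] cn v a b|].
  apply: evle_mono.
    apply: (@evle_popT S1) => //=; rewrite -catA; apply: evle_seq; first exact: evle_swap.
    exact: evle_drop.
  by rewrite /sz /= size_cat; lia.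
by do 3!apply: polyb_S; apply: (polyb_mul (polyb_const _) (polyb_S polyb_id)).
Qed.

Fixpoint push_bits (s : seq bool) : prog :=
  if s is b :: s' then Seq (push_bits s') (Push S1 b) else Skip.

Lemma evle_push_bits s c v a b :
  evle (push_bits s) (Stacks c v a b) (Stacks c (s ++ v) a b) (2 * size s + 1).
Proof.
elim: s => [|x s IHs]; first exact: evle_skip.
by apply: evle_mono (evle_seq IHs (evle_push1 _ _ _ _ _)) _; rewrite /=; lia.
Qed.

Lemma PT_const A `{coded A} (x : A) : PT (fun _ : G => x).
Proof.
apply: (@PT_intro _ _ _ _ _ (Seq drop_prog (push_bits (enc (code x))))
  (fun n => (40 * n.+1 + (2 * size (enc (code x)) + 1)).+1)) => [y cn v a b|].
  by apply: evle_seq; [exact: evle_drop | exact: evle_push_bits].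
apply: polyb_S (polyb_add _ (polyb_const _)).
by apply: (polyb_mul (polyb_const _) (polyb_S polyb_id)).
Qed.

Lemma PT_if A `{coded A} (c : G -> bool) (f g : G -> A) :
  PT c -> PT f -> PT g -> PT (fun x => if c x then f x else g x).
Proof.
move=> /PT_elim [r [rc [evr pr hr]]].
move=> /PT_elim [p [pc [evp pp hp]]] /PT_elim [q [qc [evq pq hq]]].
apply: (@PT_intro _ _ _ _ _ (Seq dup_prog (Seq r (Pop S1 (Seq drop_prog (Seq drop_prog p)) q Skip)))
  (fun n => 40 * n.+1 + rc n + pc n + qc n + 200)).
  move=> x cn v a b; apply: evle_mono.
    apply: evle_seq; first exact: evle_dup.
    apply: evle_seq; first exact: evr (leqnn _).
    apply: (_ : evle _ _ _ (pc (sz x) + qc (sz x) + 190)).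
    (* [true] is coded as a node with two leaves: the pop consumes the node bit and the two drops
       remove the leaves. *)
    case: (c x) => /=.
      apply: evle_mono.
        apply: (@evle_popT S1) => //=; apply: evle_seq; first exact: (evle_drop Lf).
        apply: evle_seq; first exact: (evle_drop Lf); exact: evp (leqnn _).
      by rewrite /=; lia.
    apply: evle_mono; first by apply: (@evle_popF S1) => //=; exact: evq (leqnn _).
    by lia.
  by rewrite /sz; lia.
have P1 : polyb (fun n => 40 * n.+1) by apply: polyb_mul (polyb_const _) (polyb_S polyb_id).
by do ?[apply: polyb_add => //]; exact: polyb_const.
Qed.

Lemma PT_case A B `{coded A} `{coded B} (l : G -> seq A) (f : G -> B) (g : G * (A * seq A) -> B) :
  PT l -> PT f -> PT g ->
  PT (fun x => if l x is y :: l' then g (x, (y, l')) else f x).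
Proof.
move=> /[dup] /PT_size [c lc] /PT_elim [r [rc [evr pr hr]]].
move=> /PT_elim [p [pc [evp pp hp]]] /PT_elim [q [qc [evq pq hq]]].
apply: (@PT_intro _ _ _ _ _ (Seq dup_prog (Seq r
   (Pop S1 (Seq (Push S1 true) (Seq swap_prog (Seq (Push S1 true) q))) p Skip)))
  (fun n => 40 * n.+1 + rc n + pc n + (40 * (c * n.+1 ^ c + n).+1 + qc (1 + (c * n.+1 ^ c + n))) + 10)).
  move=> x cn v a b; apply: evle_mono.
    apply: evle_seq; first exact: evle_dup.
    apply: evle_seq; first exact: evr (leqnn _).
    apply: (_ : evle _ _ _ (pc (sz x) + (40 * (c * (sz x).+1 ^ c + sz x).+1 +
       qc (1 + (c * (sz x).+1 ^ c + sz x))) + 8)).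
    have := lc x; case: (l x) => [|y l'] le /=.
      apply: evle_mono; first by apply: (@evle_popF S1) => //=; exact: evp (leqnn _).
      by lia.
    apply: evle_mono.
      apply: (@evle_popT S1) => //=.
      apply: evle_seq; first exact: evle_push1.
      apply: evle_seq; first exact: (evle_swap (code (y :: l'))).
      apply: evle_seq; first exact: evle_push1.
      have E : enc (code (x, (y, l'))) ++ v = true :: enc (code x) ++ enc (code (y :: l')) ++ v.
        by rewrite /= -!catA /= -!catA.
      by have := evq (x, (y, l')) cn v a b _ (leqnn _); rewrite E; apply.
    have hl : qc (sz (x, (y, l'))) <= qc (1 + (c * (sz x).+1 ^ c + sz x)).
      by apply: hq; move: le; rewrite sz_cons !sz_pair; lia.
    move: le hl; rewrite -![size (enc (code _))]/(sz _) sz_cons; lia.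
  by rewrite /sz; lia.
have P1 : polyb (fun n => 40 * n.+1) by apply: polyb_mul (polyb_const _) (polyb_S polyb_id).
have P2 : polyb (fun n => c * n.+1 ^ c + n).
  by apply: polyb_add polyb_id; exact: polyb_poly polyb_id.
apply: polyb_add (polyb_const _); apply: polyb_add; first by do ?[apply: polyb_add => //].
apply: polyb_add; first by apply: polyb_mul (polyb_const _) (polyb_S P2).
by apply: polyb_comp => //; apply: polyb_add (polyb_const _) P2.
Qed.
End PT_core.

Section PT_foldl.
Context {G A S : Type} `{coded G} `{coded A} `{coded S}.

(** Iterating a polynomial-time function can blow up its argument, so the accumulators after all
    prefixes of the list must be known to be polynomial in the original input. *)
Lemma PT_foldl (g : G * (S * A) -> S) (i : G -> S) (l : G -> seq A) :
  PT g -> PT i -> PT l ->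
  (exists c, forall x l1 l2, l x = l1 ++ l2 ->
     sz (foldl (fun s y => g (x, (s, y))) (i x) l1) <= c * (sz x).+1 ^ c) ->
  PT (fun x => foldl (fun s y => g (x, (s, y))) (i x) (l x)).
Proof.
move=> pg pi pl [d dP].
pose h (u : (A * seq A) * (G * S)) := (u.1.2, (u.2.1, g (u.2.1, (u.2.2, u.1.1)))).
have ph : PT h.
  apply: PT_pair; first by apply: PT_comp PT_snd PT_fst.
  have p21 : PT (fun u : (A * seq A) * (G * S) => u.2.1) by apply: PT_comp PT_fst PT_snd.
  apply: PT_pair => //; apply: PT_comp pg _; apply: PT_pair => //.
  by apply: PT_pair; [apply: PT_comp PT_snd PT_snd | apply: PT_comp PT_fst PT_fst].
have p0 : PT (fun x => (l x, (x, i x))) by apply: PT_pair => //; apply: PT_pair => //; exact: PT_id.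
have [c lc] := PT_size pl.
have [r [rc [evr pr hr]]] := PT_elim p0.
have [q [qc [evq pq hq]]] := PT_elim ph.
have [w [wc [evw pw hw]]] := PT_elim (PT_snd (A := G) (B := S)).
pose bd n := 10 + c * n.+1 ^ c + n + d * n.+1 ^ d.
(* The loop test has consumed the cons bit of the list. Two pushed bits complete the code of
   [((y, l2), (x, s))], the argument of [h]; after [q], one pop removes the outer pair bit and
   exposes the remaining list to the next test. *)
pose body := Seq (Push S1 true) (Seq (Push S1 true) (Seq q (Pop S1 Skip Skip Skip))).
apply: (@PT_intro _ _ _ _ _ (Seq r (Seq (Pop S1 Skip Skip Skip) (Seq (While S1 body) w)))
  (fun n => rc n + (c * n.+1 ^ c).+1 * (qc (bd n) + 20) + wc (bd n) + 10)).
  move=> x cn v a b; have := lc x; have := dP x.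
  have loopP : forall l2 l1, l x = l1 ++ l2 -> evle (While S1 body)
     (Stacks cn (enc (code l2) ++ enc (code (x, foldl (fun s y => g (x, (s, y))) (i x) l1)) ++ v) a b)
     (Stacks cn (enc (code (x, foldl (fun s y => g (x, (s, y))) (i x) (l x))) ++ v) a b)
     ((size l2).+1 * (qc (bd (sz x)) + 20)).
    elim=> [|y l2 IHl] l1 El.
      rewrite El cats0; apply: evle_mono; first exact: (@evle_whileF S1).
      by lia.
    have El' : l x = rcons l1 y ++ l2 by rewrite cat_rcons.
    set s := foldl _ _ l1.
    apply: evle_mono.
      apply: (@evle_whileT S1) => //=; last first.
        have := IHl _ El'; rewrite foldl_rcons -/s /= -!catA; apply.
      rewrite /body /=; apply: evle_seq; first exact: evle_push1.
      apply: evle_seq; first exact: evle_push1.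
      apply: evle_seq.
        have := evq ((y, l2), (x, s)) cn v a b (bd (sz x)); rewrite /= -!catA /= -!catA; apply.
        have := dP x l1 (y :: l2) El; rewrite -/s => sle.
        have := lc x; rewrite El !sz_pair /bd => lle.
        have : sz y + sz l2 <= sz (l1 ++ y :: l2).
          by rewrite !sz_seq big_cat big_cons /=; lia.
        lia.
      apply: (@evle_popT S1) => //=; exact: evle_skip.
    by rewrite /=; lia.
  move=> dx lx; apply: evle_mono.
    apply: evle_seq; first exact: evr (leqnn _).
    apply: evle_seq; first by apply: (@evle_popT S1) => //=; exact: evle_skip.
    rewrite -catA; apply: evle_seq.
      by have := loopP (l x) [::] erefl; rewrite /=; apply.
    have := evw (x, foldl (fun s y => g (x, (s, y))) (i x) (l x)) cn v a b (bd (sz x)).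
    apply; rewrite sz_pair /bd; have := dx (l x) [::]; rewrite cats0 => /(_ erefl); lia.
  have : (size (l x)).+1 <= (c * (sz x).+1 ^ c).+1.
    rewrite ltnS; apply: leq_trans lx; rewrite sz_seq.
    apply: leqW; rewrite -sum1_size; apply: leq_sum => y _; lia.
  by move=> /leq_mul -/(_ (qc (bd (sz x)) + 20) _ (leqnn _)); lia.
have pbd : polyb bd.
  apply: polyb_add; last exact: polyb_poly polyb_id.
  apply: polyb_add polyb_id; apply: polyb_add (polyb_const _) _; exact: polyb_poly polyb_id.
apply: polyb_add (polyb_const _); apply: polyb_add; last exact: polyb_comp.
apply: polyb_add => //; apply: polyb_mul; first by apply: polyb_S; exact: polyb_poly polyb_id.
by apply: polyb_add (polyb_const _); exact: polyb_comp.
Qed.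
End PT_foldl.

(** * Polynomial-time list operations and arithmetic *)

Lemma sz_catl A `{coded A} (u v : seq A) : sz u <= sz (u ++ v).
Proof. by rewrite !sz_seq big_cat /=; lia. Qed.
Lemma sz_cat A `{coded A} (u v : seq A) : (sz (u ++ v)).+1 = sz u + sz v.
Proof. by rewrite !sz_seq big_cat /=; lia. Qed.
Lemma sz_rev A `{coded A} (l : seq A) : sz (rev l) = sz l.
Proof. by rewrite !sz_seq big_rev. Qed.
Lemma size_sz A `{coded A} (l : seq A) : size l <= sz l.
Proof. by rewrite sz_seq -sum1_size leqW // leq_sum. Qed.

Lemma foldl_consE A B (f : A -> B) l s :
  foldl (fun s y => f y :: s) s l = rev (map f l) ++ s.
Proof. by elim: l s => //= y l IHl s; rewrite IHl rev_cons cat_rcons. Qed.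

Lemma PTfst G `{coded G} A B `{coded A} `{coded B} (f : G -> A * B) : PT f -> PT (fun x => (f x).1).
Proof. exact: PT_comp (PT_fst (A := A) (B := B)). Qed.
Lemma PTsnd G `{coded G} A B `{coded A} `{coded B} (f : G -> A * B) : PT f -> PT (fun x => (f x).2).
Proof. exact: PT_comp (PT_snd (A := A) (B := B)). Qed.

Lemma PTcons G `{coded G} A `{coded A} (f : G -> A) (l : G -> seq A) :
  PT f -> PT l -> PT (fun x => f x :: l x).
Proof.
by move=> pf pl; apply: (PT_recode (h := fun p => p.1 :: p.2)) (PT_pair pf pl).
Qed.

Lemma PTfoldl G `{coded G} A S `{coded A} `{coded S} (g : G -> S -> A -> S) (i : G -> S) (l : G -> seq A) :
  PT (fun p : G * (S * A) => g p.1 p.2.1 p.2.2) -> PT i -> PT l ->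
  (exists2 q, polyb q & forall x l1 l2, l x = l1 ++ l2 ->
     sz (foldl (g x) (i x) l1) <= q (sz x)) ->
  PT (fun x => foldl (g x) (i x) (l x)).
Proof.
move=> pg pi pl [q [c cP] bd].
apply: (@PT_foldl _ _ _ _ _ _ (fun p => g p.1 p.2.1 p.2.2)) => //.
by exists c => x l1 l2 El; apply: leq_trans (bd _ _ _ El) (cP _).
Qed.

Lemma PTcase G `{coded G} A B `{coded A} `{coded B} (l : G -> seq A) (f : G -> B) (g : G -> A -> seq A -> B) :
  PT l -> PT f -> PT (fun p : G * (A * seq A) => g p.1 p.2.1 p.2.2) ->
  PT (fun x => if l x is y :: l' then g x y l' else f x).
Proof. exact: PT_case. Qed.

Lemma PT_sizeb G `{coded G} A `{coded A} (f : G -> A) : PT f ->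
  exists2 q, polyb q & forall x, sz (f x) <= q (sz x).
Proof. by move=> /PT_size [c cP]; exists (fun n => c * n.+1 ^ c) => //; exists c. Qed.

Lemma PT_elemb G `{coded G} A B `{coded A} `{coded B} (f : G -> A -> B) (l : G -> seq A) :
  PT (fun p : G * A => f p.1 p.2) -> PT l ->
  exists2 q, polyb q & forall x y, sz y <= sz (l x) -> sz (f x y) <= q (sz x).
Proof.
move=> /PT_size [c cP] /PT_sizeb [r pr rP].
exists (fun n => c * (n + r n).+2 ^ c).
  by apply: (polyb_poly c (polyb_S (polyb_add polyb_id pr))).
move=> x y le; apply: leq_trans (cP (x, y)) _; apply: polyE => //.
by rewrite sz_pair; have := rP x; lia.
Qed.

Lemma PTrev G `{coded G} A `{coded A} (l : G -> seq A) : PT l -> PT (fun x => rev (l x)).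
Proof.
move=> pl; apply: (PT_ext (g := fun x => foldl (fun s y => y :: s) [::] (l x))).
  by move=> x; rewrite (foldl_consE id) map_id cats0.
apply: (PTfoldl (g := fun x s y => y :: s) (i := fun=> [::])) => //.
- by apply: PTcons; [apply: PTsnd PT_snd | apply: PTfst PT_snd].
- exact: PT_const.
- have [q pq qP] := PT_sizeb pl; exists q => // x l1 l2 El.
  apply: leq_trans (qP x); rewrite El (foldl_consE id) map_id cats0.
  by apply: leq_trans (sz_catl _ _); rewrite !sz_seq big_rev.
Qed.

Lemma sz_map_le A B `{coded A} `{coded B} (f : A -> B) M N (l : seq A) :
  sz l <= N -> (forall y, sz y <= N -> sz (f y) <= M) -> sz (map f l) <= (N * M.+1).+1.
Proof.
move=> lN fM; rewrite sz_seq big_map ltnS.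
have : size l <= N := leq_trans (size_sz _) lN.
elim: l N lN {fM}(fM) => [|y l IHl] N; first by rewrite big_nil.
rewrite big_cons sz_cons => lN fM; case: N lN fM => // N lN fM /= leN.
rewrite mulSn; apply: leq_add; first by rewrite ltnS; apply: fM; lia.
by apply: IHl => [|y' le|//]; [lia | apply: fM; lia].
Qed.

Lemma PTmap G `{coded G} A B `{coded A} `{coded B} (f : G -> A -> B) (l : G -> seq A) :
  PT (fun p : G * A => f p.1 p.2) -> PT l -> PT (fun x => [seq f x y | y <- l x]).
Proof.
move=> pf pl.
apply: (PT_ext (g := fun x => rev (foldl (fun s y => f x y :: s) [::] (l x)))).
  by move=> x; rewrite foldl_consE cats0 revK.
apply: PTrev; apply: (PTfoldl (g := fun x s y => f x y :: s) (i := fun=> [::])) => //.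
- apply: PTcons; last by apply: PTfst PT_snd.
  apply: (PT_comp (f := fun p : G * (seq B * A) => (p.1, p.2.2))) pf _.
  by apply: PT_pair; [exact: PT_fst | apply: PTsnd PT_snd].
- exact: PT_const.
- have [q pq qP] := PT_sizeb pl; have [r pr rP] := PT_elemb pf pl.
  exists (fun n => (q n * (r n).+1).+1); first by apply: polyb_S; apply: polyb_mul pq (polyb_S pr).
  move=> x l1 l2 El; rewrite foldl_consE cats0.
  have -> : sz (rev (map (f x) l1)) = sz (map (f x) l1) by rewrite !sz_seq big_rev.
  apply: leq_trans (_ : (sz (l x) * (r (sz x)).+1).+1 <= _); last by rewrite ltnS leq_mul.
  by apply: sz_map_le; [rewrite El sz_catl | move=> y; exact: rP].
Qed.

Lemma PTfilter G `{coded G} A `{coded A} (p : G -> A -> bool) (l : G -> seq A) :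
  PT (fun q : G * A => p q.1 q.2) -> PT l -> PT (fun x => [seq y <- l x | p x y]).
Proof.
move=> pp pl.
have E x l0 s : foldl (fun s y => if p x y then y :: s else s) s l0 = rev [seq y <- l0 | p x y] ++ s.
  by elim: l0 s => //= y l0 IHl s; rewrite IHl; case: (p x y); rewrite // rev_cons cat_rcons.
apply: (PT_ext (g := fun x => rev (foldl (fun s y => if p x y then y :: s else s) [::] (l x)))).
  by move=> x; rewrite E cats0 revK.
apply: PTrev; apply: (PTfoldl (g := fun x s y => if p x y then y :: s else s) (i := fun=> [::])) => //.
- apply: PT_if; last by apply: PTfst PT_snd.
    apply: (PT_comp (f := fun p : G * (seq A * A) => (p.1, p.2.2))) pp _.
    by apply: PT_pair; [exact: PT_fst | apply: PTsnd PT_snd].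
  by apply: PTcons; [apply: PTsnd PT_snd | apply: PTfst PT_snd].
- exact: PT_const.
- have [q pq qP] := PT_sizeb pl; exists q => // x l1 l2 El.
  apply: leq_trans (qP x); rewrite El E cats0; apply: leq_trans (sz_catl _ _).
  by rewrite !sz_seq big_rev ltnS big_filter [leqRHS](bigID (p x)) /= leq_addr.
Qed.

Lemma PTcat G `{coded G} A `{coded A} (l1 l2 : G -> seq A) : PT l1 -> PT l2 -> PT (fun x => l1 x ++ l2 x).
Proof.
move=> p1 p2.
apply: (PT_ext (g := fun x => foldl (fun s y => y :: s) (l2 x) (rev (l1 x)))).
  by move=> x; rewrite (foldl_consE id) map_id revK.
apply: (PTfoldl (g := fun x s y => y :: s)) => //.
- by apply: PTcons; [apply: PTsnd PT_snd | apply: PTfst PT_snd].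
- exact: PTrev.
- have [q pq qP] := PT_sizeb p1; have [r pr rP] := PT_sizeb p2.
  exists (fun n => q n + r n); first exact: polyb_add.
  move=> x u v E; rewrite (foldl_consE id) map_id.
  have := @sz_cat _ H0 (rev u) (l2 x); have := qP x; have := rP x.
  have := @sz_catl _ H0 u v; rewrite -E !sz_rev; lia.
Qed.

Lemma PTflatten G `{coded G} A `{coded A} (l : G -> seq (seq A)) : PT l -> PT (fun x => flatten (l x)).
Proof.
move=> pl.
have E ll (s : seq A) : foldl cat s ll = s ++ flatten ll.
  by elim: ll s => [|y ll IHl] s /=; rewrite ?cats0 // IHl catA.
apply: (PT_ext (g := fun x => foldl cat [::] (l x))); first by move=> x; rewrite E.
apply: (PTfoldl (g := fun x => @cat A) (i := fun=> [::])) => //.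
- by apply: PTcat; [apply: PTfst PT_snd | apply: PTsnd PT_snd].
- exact: PT_const.
- have [q pq qP] := PT_sizeb pl; exists q => // x l1 l2 El; apply: leq_trans (qP x).
  rewrite El E /=; apply: leq_trans (sz_catl _ _).
  elim: l1 {l2 El} => [|u l1 IHl] //=.
  by rewrite sz_cons; have := @sz_cat _ H0 u (flatten l1); lia.
Qed.

Lemma PThas G `{coded G} A `{coded A} (p : G -> A -> bool) (l : G -> seq A) :
  PT (fun q : G * A => p q.1 q.2) -> PT l -> PT (fun x => has (p x) (l x)).
Proof.
move=> pp pl.
apply: (PT_ext (g := fun x => if [seq y <- l x | p x y] is _ :: _ then true else false)).
  by move=> x; elim: (l x) => //= y l0 ->; case: (p x y).
apply: (PTcase (f := fun=> false) (g := fun _ _ _ => true)); [exact: PTfilter | |]; exact: PT_const.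
Qed.

Lemma PTneg G `{coded G} (b : G -> bool) : PT b -> PT (fun x => ~~ b x).
Proof.
move=> pb; apply: (PT_ext (g := fun x => if b x then false else true)) => [x|].
  by case: (b x).
by apply: PT_if => //; exact: PT_const.
Qed.
Lemma PTand G `{coded G} (b c : G -> bool) : PT b -> PT c -> PT (fun x => b x && c x).
Proof.
move=> pb pc; apply: (PT_ext (g := fun x => if b x then c x else false)) => [x|].
  by case: (b x).
by apply: PT_if => //; exact: PT_const.
Qed.

Lemma PTall G `{coded G} A `{coded A} (p : G -> A -> bool) (l : G -> seq A) :
  PT (fun q : G * A => p q.1 q.2) -> PT l -> PT (fun x => all (p x) (l x)).
Proof.
move=> pp pl.
apply: (PT_ext (g := fun x => ~~ has (fun y => ~~ p x y) (l x))) => [x|].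
  by rewrite has_predC negbK.
by apply: PTneg; apply: PThas pl; exact: PTneg.
Qed.

Lemma PTnseq G `{coded G} (n : G -> nat) : PT n -> PT (fun x => nseq (n x) tt).
Proof. by apply: (PT_recode (h := fun n => nseq n tt)) => k; elim: k => // k IHk; exact: (congr1 (Nd Lf) IHk). Qed.
Lemma PTsize_unit G `{coded G} (l : G -> seq unit) : PT l -> PT (fun x => size (l x)).
Proof. by apply: (PT_recode (h := size)) => k; elim: k => // -[] k IHk; exact: (congr1 (Nd Lf) IHk). Qed.

Lemma PTsize G `{coded G} A `{coded A} (l : G -> seq A) : PT l -> PT (fun x => size (l x)).
Proof.
move=> pl; apply: (PT_ext (g := fun x => size [seq tt | _ <- l x])) => [x|].
  by rewrite size_map.
by apply: PTsize_unit; apply: PTmap pl; exact: PT_const.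
Qed.

Lemma PTbehead G `{coded G} A `{coded A} (l : G -> seq A) : PT l -> PT (fun x => behead (l x)).
Proof.
move=> pl; apply: (PTcase (f := fun=> [::]) (g := fun _ _ s => s)) => //.
  exact: PT_const.
by apply: PTsnd PT_snd.
Qed.
Lemma PThead G `{coded G} A `{coded A} (d : A) (l : G -> seq A) : PT l -> PT (fun x => head d (l x)).
Proof.
move=> pl; apply: (PTcase (f := fun=> d) (g := fun _ y _ => y)) => //.
  exact: PT_const.
by apply: PTfst PT_snd.
Qed.

Lemma PTiter G `{coded G} A `{coded A} (n : G -> nat) (f : G -> A -> A) (i : G -> A) :
  PT n -> PT (fun p : G * A => f p.1 p.2) -> PT i ->
  (exists2 q, polyb q & forall x k, k <= n x -> sz (iter k (f x) (i x)) <= q (sz x)) ->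
  PT (fun x => iter (n x) (f x) (i x)).
Proof.
move=> pn pf pi [q pq qP].
have E x l : foldl (fun s (_ : unit) => f x s) (i x) l = iter (size l) (f x) (i x).
  by elim/last_ind: l => // l [] IHl; rewrite foldl_rcons size_rcons IHl iterS.
apply: (PT_ext (g := fun x => foldl (fun s (_ : unit) => f x s) (i x) (nseq (n x) tt))) => [x|].
  by rewrite E size_nseq.
apply: (PTfoldl (g := fun x s (_ : unit) => f x s)) => //; last 1 first.
- exists q => // x l1 l2 El; rewrite E; apply: qP.
  by have := size_nseq (n x) tt; rewrite El size_cat => <-; rewrite leq_addr.
- apply: (PT_comp (f := fun p : G * (A * unit) => (p.1, p.2.1))) pf _.
  by apply: PT_pair; [exact: PT_fst | apply: PTfst PT_snd].
- exact: PTnseq.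
Qed.

Lemma PTdrop G `{coded G} A `{coded A} (n : G -> nat) (l : G -> seq A) :
  PT n -> PT l -> PT (fun x => drop (n x) (l x)).
Proof.
move=> pn pl.
have E k (s : seq A) : iter k behead s = drop k s.
  by elim: k s => [|k IHk] s; rewrite ?drop0 // iterS IHk -drop1 drop_drop add1n.
apply: (PT_ext (g := fun x => iter (n x) behead (l x))) => [x|]; first by rewrite E.
apply: (PTiter (f := fun _ => behead)) => //; first by apply: PTbehead PT_snd.
have [q pq qP] := PT_sizeb pl; exists q => // x k _; apply: leq_trans (qP x).
by have := @sz_cat _ H0 (take k (l x)) (drop k (l x)); rewrite E cat_take_drop; have := @sz_gt0 _ (@coded_seq _ H0) (take k (l x)); lia.
Qed.

Lemma PTtake G `{coded G} A `{coded A} (n : G -> nat) (l : G -> seq A) :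
  PT (fun x => size (l x) - n x) -> PT l -> PT (fun x => take (n x) (l x)).
Proof.
move=> pn pl; apply: (PT_ext (g := fun x => rev (drop (size (l x) - n x) (rev (l x))))) => [x|].
  by rewrite drop_rev revK; case: (leqP (n x) (size (l x))) => le; [rewrite subKn | rewrite !take_oversize //; lia].
by apply: PTrev; apply: PTdrop => //; exact: PTrev.
Qed.

Lemma PTnth G `{coded G} A `{coded A} (d : A) (n : G -> nat) (l : G -> seq A) :
  PT n -> PT l -> PT (fun x => nth d (l x) (n x)).
Proof.
move=> pn pl; apply: (PT_ext (g := fun x => head d (drop (n x) (l x)))) => [x|].
  by rewrite -nth0 nth_drop addn0.
by apply: PThead; exact: PTdrop.
Qed.

Lemma PTS G `{coded G} (n : G -> nat) : PT n -> PT (fun x => (n x).+1).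
Proof.
move=> /PTnseq pn; apply: (PT_ext (g := fun x => size (tt :: nseq (n x) tt))) => [x|].
  by rewrite /= size_nseq.
by apply: PTsize_unit; apply: PTcons pn; exact: PT_const.
Qed.
Lemma PTadd G `{coded G} (m n : G -> nat) : PT m -> PT n -> PT (fun x => m x + n x).
Proof.
move=> /PTnseq pm /PTnseq pn; apply: (PT_ext (g := fun x => size (nseq (m x) tt ++ nseq (n x) tt))) => [x|].
  by rewrite size_cat !size_nseq.
by apply: PTsize_unit; exact: PTcat.
Qed.
Lemma PTsub G `{coded G} (m n : G -> nat) : PT m -> PT n -> PT (fun x => m x - n x).
Proof.
move=> pm pn; apply: (PT_ext (g := fun x => size (drop (n x) (nseq (m x) tt)))) => [x|].
  by rewrite size_drop size_nseq.
by apply: PTsize_unit; apply: PTdrop => //; exact: PTnseq.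
Qed.
Lemma PTmul G `{coded G} (m n : G -> nat) : PT m -> PT n -> PT (fun x => m x * n x).
Proof.
move=> /PTnseq pm /PTnseq pn.
apply: (PT_ext (g := fun x => size (flatten [seq nseq (n x) tt | _ <- nseq (m x) tt]))) => [x|].
  by elim: (m x) => //= k IHk; rewrite size_cat size_nseq -IHk.
apply: PTsize_unit; apply: PTflatten; apply: PTmap => //.
by apply: (PT_comp (f := fst)) pn PT_fst.
Qed.
Lemma PTsumn G `{coded G} (l : G -> seq nat) : PT l -> PT (fun x => sumn (l x)).
Proof.
move=> pl; apply: (PT_ext (g := fun x => size (flatten [seq nseq k tt | k <- l x]))) => [x|].
  by rewrite size_flatten /shape -map_comp; congr sumn; rewrite -[LHS]map_id; apply: eq_map => k /=; rewrite size_nseq.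
apply: PTsize_unit; apply: PTflatten; apply: PTmap => //.
by apply: PTnseq PT_snd.
Qed.

Lemma PTleq G `{coded G} (m n : G -> nat) : PT m -> PT n -> PT (fun x => m x <= n x).
Proof.
move=> pm pn.
apply: (PT_ext (g := fun x => if nseq (m x - n x) tt is _ :: _ then false else true)) => [x|].
  by rewrite /leq; case: (m x - n x).
by apply: (PTcase (f := fun=> true) (g := fun _ _ _ => false));
  [apply: PTnseq; exact: PTsub | |]; exact: PT_const.
Qed.
Lemma PTeqn G `{coded G} (m n : G -> nat) : PT m -> PT n -> PT (fun x => m x == n x).
Proof.
move=> pm pn; apply: (PT_ext (g := fun x => (m x <= n x) && (n x <= m x))) => [x|].
  exact: eqn_leq.
by apply: PTand; exact: PTleq.
Qed.
Lemma PTminn G `{coded G} (m n : G -> nat) : PT m -> PT n -> PT (fun x => minn (m x) (n x)).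
Proof. by move=> pm pn; apply: PT_if => //; apply: PTleq => //; exact: PTS. Qed.
Lemma PTmaxn G `{coded G} (m n : G -> nat) : PT m -> PT n -> PT (fun x => maxn (m x) (n x)).
Proof. by move=> pm pn; apply: PT_if => //; apply: PTleq => //; exact: PTS. Qed.

Lemma PTiota G `{coded G} (m n : G -> nat) : PT m -> PT n -> PT (fun x => iota (m x) (n x)).
Proof.
move=> pm pn.
have E m0 k : iter k (fun s => (m0 + size s) :: s) [::] = rev (iota m0 k).
  by elim: k => // k IHk; rewrite iterS IHk size_rev size_iota -addn1 iotaD rev_cat.
apply: (PT_ext (g := fun x => rev (iter (n x) (fun s => (m x + size s) :: s) [::]))) => [x|].
  by rewrite E revK.
apply: PTrev; apply: (PTiter (f := fun x s => (m x + size s) :: s) (i := fun=> [::])) => //.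
- apply: PTcons; last exact: PT_snd.
  by apply: PTadd; [apply: (PT_comp (f := fst)) pm PT_fst | apply: PTsize PT_snd].
- exact: PT_const.
have [q pq qP] := PT_sizeb pm; have [r pr rP] := PT_sizeb pn.
exists (fun t => (r t * (2 * (q t + r t) + 2)).+1).
  apply: polyb_S; apply: polyb_mul => //; apply: polyb_add (polyb_const _).
  by apply: polyb_mul (polyb_const _) (polyb_add pq pr).
move=> x k lek; rewrite E sz_seq big_rev ltnS /=.
have k_r : k <= r (sz x) by have := rP x; rewrite sz_nat; lia.
have m_q : m x <= q (sz x) by have := qP x; rewrite sz_nat; lia.
apply: (@leq_trans (\sum_(i <- iota (m x) k) (2 * (q (sz x) + r (sz x)) + 2))).
  rewrite big_seq [leqRHS]big_seq; apply: leq_sum => i; rewrite mem_iota sz_nat; lia.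
by rewrite big_const_seq count_predT size_iota iter_addn_0 mulnC leq_mul2r k_r orbT.
Qed.

Lemma PTmem G `{coded G} (u : G -> nat) (l : G -> seq nat) : PT u -> PT l -> PT (fun x => u x \in l x).
Proof.
move=> pu pl; apply: (PT_ext (g := fun x => has (fun y => u x == y) (l x))) => [x|].
  by rewrite -has_pred1; apply: eq_has => y; rewrite /= eq_sym.
by apply: PThas pl; apply: PTeqn PT_snd; apply: (PT_comp (f := fst)) pu PT_fst.
Qed.

Lemma PTfind G `{coded G} A `{coded A} (p : G -> A -> bool) (l : G -> seq A) :
  PT (fun q : G * A => p q.1 q.2) -> PT l -> PT (fun x => find (p x) (l x)).
Proof.
move=> pp pl.
have E x s : foldl (fun k y => if p x y then 0 else k.+1) 0 (rev s) = find (p x) s.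
  by elim: s => //= y s IHs; rewrite rev_cons foldl_rcons IHs.
apply: (PT_ext (g := fun x => foldl (fun k y => if p x y then 0 else k.+1) 0 (rev (l x)))) => [x|].
  by rewrite E.
apply: (PTfoldl (g := fun x k y => if p x y then 0 else k.+1) (i := fun=> 0)).
- apply: PT_if; [|exact: PT_const|by apply: PTS; apply: PTfst PT_snd].
  apply: (PT_comp (f := fun p : G * (nat * A) => (p.1, p.2.2))) pp _.
  by apply: PT_pair; [exact: PT_fst | apply: PTsnd PT_snd].
- exact: PT_const.
- exact: PTrev.
have [q pq qP] := PT_sizeb pl; exists (fun n => 2 * q n + 1).
  by apply: polyb_add (polyb_const _); apply: polyb_mul (polyb_const _) pq.
move=> x l1 l2 El; rewrite -[l1]revK E sz_nat -addn1 leq_add2r leq_mul2l /=.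
apply: leq_trans (find_size _ _) _; rewrite size_rev.
apply: leq_trans (qP x); apply: leq_trans (size_sz _).
by rewrite -[size (l x)]size_rev El size_cat leq_addr.
Qed.

Lemma PTfoldr_minn G `{coded G} (b : G -> nat) (l : G -> seq nat) :
  PT b -> PT l -> PT (fun x => foldr minn (b x) (l x)).
Proof.
move=> pb pl.
apply: (PT_ext (g := fun x => foldl minn (b x) (rev (l x)))) => [x|].
  by rewrite foldl_rev; elim: (l x) => //= y s ->; rewrite minnC.
apply: (PTfoldl (g := fun _ => minn)) => //; [|exact: PTrev|].
  by apply: PTminn; [apply: PTfst PT_snd | apply: PTsnd PT_snd].
have [q pq qP] := PT_sizeb pb; exists q => // x l1 l2 _; apply: leq_trans (qP x).
rewrite !sz_nat ltnS leq_mul2l /=; elim: l1 (b x) => //= y s IH b0.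
exact: leq_trans (IH _) (geq_minl _ _).
Qed.

Lemma PTfoldr_maxn G `{coded G} (l : G -> seq nat) : PT l -> PT (fun x => foldr maxn 0 (l x)).
Proof.
move=> pl.
apply: (PT_ext (g := fun x => foldl maxn 0 (rev (l x)))) => [x|].
  by rewrite foldl_rev; elim: (l x) => //= y s ->; rewrite maxnC.
apply: (PTfoldl (g := fun _ => maxn) (i := fun=> 0)); [|exact: PT_const|exact: PTrev|].
  by apply: PTmaxn; [apply: PTfst PT_snd | apply: PTsnd PT_snd].
have [q pq qP] := PT_sizeb (PTrev pl); exists q => // x l1 l2 El; apply: leq_trans (qP x).
apply: leq_trans (_ : sz l1 <= _); last by rewrite El sz_catl.
have /(_ 0) : forall b0, foldl maxn b0 l1 <= b0 + \sum_(y <- l1) y.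
  elim: l1 {l2 El} => [|y s IH] b0 /=; first by rewrite big_nil addn0.
  by rewrite big_cons; apply: leq_trans (IH _) _; rewrite addnA leq_add2r geq_max leq_addr leq_addl.
rewrite sz_nat sz_seq ltnS add0n => le; apply: (@leq_trans (2 * \sum_(y <- l1) y)).
  by rewrite leq_mul2l.
by rewrite big_distrr /=; apply: leq_sum => y _; rewrite sz_nat; lia.
Qed.

Ltac pt1 := lazymatch goal with
  | |- PT (fun x => x) => exact: PT_id
  | |- PT fst => exact: PT_fst
  | |- PT snd => exact: PT_snd
  | |- PT size => apply: (PTsize (l := fun x => x))
  | |- PT (fun _ => ?c) => exact: PT_const
  | |- PT (fun x => fst (@?f x)) => apply: PTfst
  | |- PT (fun x => snd (@?f x)) => apply: PTsnd
  | |- PT (fun x => pair (@?f x) (@?g x)) => apply: PT_pair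
  | |- PT (fun x => cons (@?f x) (@?g x)) => apply: PTcons
  | |- PT (fun x => cat (@?f x) (@?g x)) => apply: PTcat
  | |- PT (fun x => negb (@?f x)) => apply: PTneg
  | |- PT (fun x => andb (@?f x) (@?g x)) => apply: PTand
  | |- PT (fun x => leq (@?f x) (@?g x)) => apply: PTleq
  | |- PT (fun x => @eq_op _ (@?f x) (@?g x)) => apply: PTeqn
  | |- PT (fun x => S (@?f x)) => apply: PTS
  | |- PT (fun x => addn (@?f x) (@?g x)) => apply: PTadd
  | |- PT (fun x => subn (@?f x) (@?g x)) => apply: PTsub
  | |- PT (fun x => muln (@?f x) (@?g x)) => apply: PTmul
  | |- PT (fun x => minn (@?f x) (@?g x)) => apply: PTminn
  | |- PT (fun x => maxn (@?f x) (@?g x)) => apply: PTmaxn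
  | |- PT (fun x => map (@?f x) (@?g x)) => apply: PTmap
  | |- PT (fun x => filter (@?f x) (@?g x)) => apply: PTfilter
  | |- PT (fun x => flatten (@?f x)) => apply: PTflatten
  | |- PT (fun x => has (@?f x) (@?g x)) => apply: PThas
  | |- PT (fun x => all (@?f x) (@?g x)) => apply: PTall
  | |- PT (fun x => size (@?f x)) => apply: PTsize
  | |- PT (fun x => rev (@?f x)) => apply: PTrev
  | |- PT (fun x => behead (@?f x)) => apply: PTbehead
  | |- PT (fun x => head _ (@?f x)) => apply: PThead
  | |- PT (fun x => drop (@?f x) (@?g x)) => apply: PTdrop
  | |- PT (fun x => take (@?f x) (@?g x)) => apply: PTtake
  | |- PT (fun x => nth _ (@?f x) (@?g x)) => apply: PTnth
  | |- PT (fun x => find (@?f x) (@?g x)) => apply: PTfind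
  | |- PT (fun x => sumn (@?f x)) => apply: PTsumn
  | |- PT (fun x => iota (@?f x) (@?g x)) => apply: PTiota
  | |- PT (fun x => foldr minn (@?f x) (@?g x)) => apply: PTfoldr_minn
  | |- PT (fun x => foldr maxn 0 (@?g x)) => apply: PTfoldr_maxn
  | |- PT (fun x => match _ with true => _ | false => _ end) => apply: PT_if
  end.
Ltac pt := repeat first [assumption | pt1].

(** * The kernelization algorithm *)

(** An item is a component preceded by the path of chosen roots above it, deepest first. A slot is a
    chunk with its price and a list of at most one owner. *)
Notation item := (seq nat * seq nat)%type.
Notation slot := (seq nat * (nat * seq item))%type.

(* Bound on minimal blocking sets in treedepth [e]: [2 ^ (e - 2) + 1] if [e >= 2],
   and [1] if [e = 1]. *)
Definition beta (e : nat) : nat := ((2 ^ e.-1)./2).+1.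

Section Algorithm.
Variable e : rel nat.

(** Incremental components: a new vertex fuses all components that it touches, which makes a graph
    search unnecessary. *)
Definition add_vertex (v : nat) (cs : seq (seq nat)) : seq (seq nat) :=
  (v :: flatten [seq c <- cs | has (e v) c]) :: [seq c <- cs | ~~ has (e v) c].

Definition comps (s : seq nat) : seq (seq nat) := foldr add_vertex [::] s.

Definition del (v : nat) (s : seq nat) : seq nat := [seq u <- s | u != v].
Definition del_nbrs (y s : seq nat) : seq nat := [seq u <- s | ~~ has (e u) y].

(* For depth [d] this is only a lower bound of the independence number in
   general; it is exact when the treedepth is at most [d], since one of the
   tried vertices [v] is then a good root. *)
Fixpoint alpha_alg (d : nat) (s : seq nat) : nat :=
  if d is d'.+1 then
    sumn [seq foldr maxn 0 [seq maxn (alpha_alg d' (del v c))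
                                     (alpha_alg d' (del_nbrs [:: v] (del v c))).+1 | v <- c]
         | c <- comps s]
  else 0.

Fixpoint td_alg (d : nat) (s : seq nat) : bool :=
  if d is d'.+1 then all (fun c => has (fun v => td_alg d' (del v c)) c) (comps s)
  else size s <= 0.

(** The default [0] does not arise for a non-empty connected component of treedepth at most
    [d + 1]. *)
Definition root_alg (d : nat) (c : seq nat) : nat :=
  head 0 [seq v <- c | td_alg d (del v c)].

(** Lists of length at most [b] stand in for subsets; repetitions and reorderings are harmless,
    since only membership and a crude count matter. *)
Fixpoint words (b : nat) (X : seq nat) : seq (seq nat) :=
  if b is b'.+1 then [::] :: flatten [seq [seq x :: y | y <- words b' X] | x <- X]
  else [:: [::]].

(* Each [w] in [W] is the path from a chosen root up to the top; a chunk either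
   lies in [X], or consists of its deepest root, of vertices above it on the path
   and of at most [b - 1] vertices of [X]. *)
Definition chunks (d b : nat) (X : seq nat) (W : seq (seq nat)) : seq (seq nat) :=
  words b X ++
  flatten [seq flatten [seq [seq head 0 w :: a ++ y | y <- words b.-1 X]
                       | a <- words d (behead w)] | w <- W].

Definition conflict (d : nat) (y c : seq nat) : bool :=
  (alpha_alg d (del_nbrs y c)).+1 <= alpha_alg d c.

(* Auction: an item bids for a cheapest conflicting chunk, raises its price by
   one and evicts the previous owner; it gives up once all prices reach [B]. *)
Definition low_price (d B : nat) (i : item) (ss : seq slot) : nat :=
  foldr minn B [seq s.2.1 | s <- ss & conflict d s.1 i.2].

Definition auction_step (d B : nat) (st : seq item * (seq slot * seq item)) :
    seq item * (seq slot * seq item) :=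
  if st.1 is i :: q then
    if B <= low_price d B i st.2.1 then (q, (st.2.1, i :: st.2.2))
    else
      let k := find (fun s => conflict d s.1 i.2 && (s.2.1 == low_price d B i st.2.1)) st.2.1 in
      let s := nth ([::], (0, [::])) st.2.1 k in
      (s.2.2 ++ q,
       (take k st.2.1 ++ (s.1, ((low_price d B i st.2.1).+1, [:: i])) :: drop k.+1 st.2.1,
        st.2.2))
  else st.

(** The number of rounds is the initial value of the decreasing measure, and the price limit exceeds
    the number of chunks so that some price level stays unoccupied. *)
Definition auction (d : nat) (its : seq item) (ys : seq (seq nat)) : seq slot * seq item :=
  (iter (size its + size ys * (size ys).+2) (auction_step d (size ys).+2)
     (its, ([seq (y, (0, [::])) | y <- ys], [::]))).2.

Definition owners (ss : seq slot) : seq item := flatten [seq s.2.2 | s <- ss].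

Definition split_item (d : nat) (i : item) : seq item :=
  [seq (root_alg d i.2 :: i.1, c) | c <- comps (del (root_alg d i.2) i.2)].

(** A state holds the paths ending in the roots chosen so far, the current items, and the total
    independence number of the items dropped so far. *)
Definition level_with (lv : nat) (st : seq (seq nat) * (seq item * nat))
    (r : seq slot * seq item) : seq (seq nat) * (seq item * nat) :=
  (st.1 ++ [seq root_alg lv i.2 :: i.1 | i <- owners r.1],
   (flatten [seq split_item lv i | i <- owners r.1],
    st.2.2 + sumn [seq alpha_alg lv.+1 i.2 | i <- r.2])).

Definition level (d lv : nat) (X : seq nat) (st : seq (seq nat) * (seq item * nat)) :=
  level_with lv st (auction lv.+1 st.2.1 (chunks d (beta lv.+1) X st.1)).

Fixpoint levels (d lv : nat) (X : seq nat) (st : seq (seq nat) * (seq item * nat)) :=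
  if lv is l.+1 then levels d l X (level d l X st) else st.

Definition init_state (n : nat) (X : seq nat) : seq (seq nat) * (seq item * nat) :=
  ([::], ([seq ([::], c) | c <- comps [seq v <- iota 0 n | v \notin X]], 0)).

Definition kept_vertices (X : seq nat) (W : seq (seq nat)) : seq nat :=
  X ++ [seq head 0 w | w <- W].

Definition nat_bits (n : nat) : seq bool :=
  (iter n (fun p => if p.1 is _.+1 then (p.1./2, p.2 ++ [:: true; odd p.1]) else p)
     (n, [::])).2 ++ [:: false].

Definition instance_bits (V X : seq nat) (l : nat) : seq bool :=
  nat_bits (size V) ++ flatten [seq [seq e u v | v <- V] | u <- V]
  ++ nat_bits l ++ [seq u \in X | u <- V] ++ nat_bits (size X).

(* A single edge with budget [0]. *)
Definition no_bits : seq bool :=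
  nat_bits 2 ++ [:: false; true; true; false] ++ nat_bits 0 ++ [:: true; false] ++ nat_bits 1.

(** The deleted part has [n - size V] vertices and contributes [st.2.2] to the independence number,
    so it uses up [n - size V - st.2.2] of the budget; a negative remainder means NO. The cap
    [size V] keeps the encoding of the new budget small. *)
Definition output_bits (n l : nat) (X : seq nat) (st : seq (seq nat) * (seq item * nat)) :=
  let V := kept_vertices X st.1 in
  if n - size V <= l + st.2.2
  then instance_bits V X (minn (size V) (l + st.2.2 - (n - size V)))
  else no_bits.

Definition kernel (d n l : nat) (X : seq nat) : seq bool :=
  output_bits n l X (levels d d X (init_state n X)).
End Algorithm.

(** * Parsing the input word *)

Definition adj (n : nat) (m : seq bool) : rel nat := fun u v => nth false m (u * n + v).

Definition read_step (p : bool * (seq bool * seq bool)) : bool * (seq bool * seq bool) :=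
  if p.1 then p else
  if p.2.2 is b :: r then
    if b then (if r is b' :: r' then (false, (b' :: p.2.1, r')) else (true, (p.2.1, r)))
    else (true, (p.2.1, r))
  else (true, (p.2.1, [::])).

Definition read_digits (w : seq bool) : seq bool * seq bool :=
  (iter (size w).+1 read_step (false, ([::], w))).2.

(** A binary number may be exponential in the input length. Truncation at [cap] commutes with
    doubling, so reading from the most significant bit yields the truncated value. *)
Definition bits_value (cap : nat) (bs : seq bool) : nat :=
  foldl (fun v b => minn cap (v + v + (if b then 1 else 0))) 0 bs.

Definition parsed_kernel (d : nat) (w : seq bool) (n : nat) (w1 : seq bool)
    (p : seq bool * seq bool) : seq bool :=
  kernel (adj n w1) d n (bits_value (size w) p.1) [seq v <- iota 0 n | nth false p.2 v].

Definition kernel_bits (d : nat) (w : seq bool) : seq bool :=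
  let p := read_digits w in
  let n := bits_value (size w) p.1 in
  parsed_kernel d w n p.2 (read_digits (drop (n * n) p.2)).

(** * The kernelization runs in polynomial time *)

Notation PTrel ee := (PT (fun p => ee p.1 p.2.1 p.2.2)).

Lemma PTrel_comp G G' `{coded G} `{coded G'} (e : G -> rel nat) (h : G' -> G) (u v : G' -> nat) :
  PTrel e -> PT h -> PT u -> PT v -> PT (fun x => e (h x) (u x) (v x)).
Proof.
move=> pe ph pu pv; apply: (PT_comp (f := fun x => (h x, (u x, v x)))) pe _.
by do 2!apply: PT_pair => //.
Qed.

Lemma PTfoldr A B G `{coded A} `{coded B} `{coded G} (g : G -> A -> B -> B) (z : G -> B) (l : G -> seq A) :
  PT (fun p : G * (A * B) => g p.1 p.2.1 p.2.2) -> PT z -> PT l ->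
  (exists2 q, polyb q & forall x l1 l2, l x = l1 ++ l2 ->
     sz (foldr (g x) (z x) l2) <= q (sz x)) ->
  PT (fun x => foldr (g x) (z x) (l x)).
Proof.
move=> pg pz pl [q pq qP].
apply: (PT_ext (g := fun x => foldl (fun s y => g x y s) (z x) (rev (l x)))) => [x|].
  by rewrite foldl_rev.
apply: (PTfoldl (g := fun x s y => g x y s)) => //; [|exact: PTrev|].
  apply: (PT_comp (f := fun p : G * (B * A) => (p.1, (p.2.2, p.2.1)))) pg _.
  by pt.
exists q => // x l1 l2 El; rewrite -[l1]revK foldl_rev; apply: qP (rev l2) _ _.
by rewrite -[l x]revK El rev_cat.
Qed.

Lemma size_comps e s : size (comps e s) <= size s.
Proof.
elim: s => //= v s; rewrite /add_vertex /= ltnS; apply: leq_trans.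
by rewrite size_filter count_size.
Qed.

Lemma perm_flatten_part (T : eqType) (p : pred (seq T)) cs :
  perm_eq (flatten [seq c <- cs | p c] ++ flatten [seq c <- cs | ~~ p c]) (flatten cs).
Proof.
elim: cs => //= c cs IH; case: (p c) => /=; first by rewrite -catA perm_cat2l.
by rewrite perm_catCA perm_cat2l.
Qed.

Lemma perm_comps e s : perm_eq (flatten (comps e s)) s.
Proof.
elim: s => //= v s IH; rewrite /add_vertex /= perm_cons.
exact: perm_trans (perm_flatten_part _ _) IH.
Qed.

Lemma sz_flatten A `{coded A} (cs : seq (seq A)) : sz cs = (2 * size cs + sz (flatten cs)).
Proof.
elim: cs => // c cs IH; rewrite sz_cons IH.
by have /= := @sz_cat _ H c (flatten cs); lia.
Qed.

Lemma sz_perm (A : eqType) `{coded A} (s t : seq A) : perm_eq s t -> sz s = sz t.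
Proof. by move=> st; rewrite !sz_seq (perm_big _ st). Qed.

Lemma sz_comps e s : sz (comps e s) <= 3 * sz s.
Proof.
have E : sz (flatten (comps e s)) = sz s by apply: sz_perm (perm_comps e s).
rewrite sz_flatten E.
by have := size_comps e s; have := @size_sz _ coded_nat s; lia.
Qed.

(** [comps] only regroups its argument, so all accumulators stay linear in it. *)
Lemma PTcomps G `{coded G} (e : G -> rel nat) (s : G -> seq nat) :
  PTrel e -> PT s -> PT (fun x => comps (e x) (s x)).
Proof.
move=> pe ps; apply: (PTfoldr (g := fun x => add_vertex (e x)) (z := fun=> [::])) => //.
- rewrite /add_vertex; pt.
  + by apply: PTrel_comp => //; pt.
  + by apply: PTrel_comp => //; pt.
- exact: PT_const.
- have [q pq qP] := PT_sizeb ps; exists (fun n => 3 * q n).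
    exact: polyb_mul (polyb_const _) pq.
  move=> x l1 l2 El; apply: leq_trans (sz_comps _ _) _; rewrite leq_mul2l /=.
  by apply: leq_trans (qP x); rewrite El; have := @sz_cat _ coded_nat l1 l2; have := @sz_gt0 _ (@coded_seq _ coded_nat) l1; lia.
Qed.

Lemma PTdel G `{coded G} (v : G -> nat) (s : G -> seq nat) :
  PT v -> PT s -> PT (fun x => del (v x) (s x)).
Proof.
move=> pv ps; rewrite /del; pt.
by apply: (PT_comp (f := fst)) pv _; pt.
Qed.

Lemma PTdel_nbrs G `{coded G} (e : G -> rel nat) (y s : G -> seq nat) :
  PTrel e -> PT y -> PT s -> PT (fun x => del_nbrs (e x) (y x) (s x)).
Proof.
move=> pe py ps; rewrite /del_nbrs; pt; first by apply: PTrel_comp => //; pt.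
by apply: (PT_comp (f := fst)) py _; pt.
Qed.

(** The depth [d] is fixed, so the recursion is unfolded outside the calculus: each depth is a map
    over the previous one, and the degree of the time bound may grow with [d]. *)
Lemma PTalpha_alg d G `{coded G} (e : G -> rel nat) (s : G -> seq nat) :
  PTrel e -> PT s -> PT (fun x => alpha_alg (e x) d (s x)).
Proof.
elim: d G H e s => [|d IHd] G H e s pe ps; rewrite /=; first exact: PT_const.
apply: PTsumn; apply: PTmap; last exact: PTcomps.
apply: PTfoldr_maxn; apply: PTmap; last by pt.
have pe' : PTrel (fun p : (G * seq nat) * nat => e p.1.1) by apply: PTrel_comp => //; pt.
have pd : PT (fun p : (G * seq nat) * nat => del p.2 p.1.2) by apply: PTdel; pt.
by apply: PTmaxn; [exact: IHd | apply: PTS; apply: IHd => //; apply: PTdel_nbrs => //; pt].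
Qed.

Lemma PTtd_alg d G `{coded G} (e : G -> rel nat) (s : G -> seq nat) :
  PTrel e -> PT s -> PT (fun x => td_alg (e x) d (s x)).
Proof.
elim: d G H e s => [|d IHd] G H e s pe ps; rewrite /=; first by pt.
apply: PTall; last exact: PTcomps.
apply: PThas; last by pt.
by apply: (IHd _ _ (fun p : (G * seq nat) * nat => e p.1.1)); [apply: PTrel_comp => //; pt | apply: PTdel; pt].
Qed.

Lemma PTroot d G `{coded G} (e : G -> rel nat) (s : G -> seq nat) :
  PTrel e -> PT s -> PT (fun x => root_alg (e x) d (s x)).
Proof.
move=> pe ps; rewrite /root_alg; apply: PThead; apply: PTfilter => //.
apply: (@PTtd_alg d _ _ (fun p : G * nat => e p.1)); first by apply: PTrel_comp => //; pt.
by apply: PTdel; [pt | apply: (PT_comp (f := fst)) ps _; pt].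
Qed.

Lemma PTwords b G `{coded G} (X : G -> seq nat) : PT X -> PT (fun x => words b (X x)).
Proof.
elim: b G H X => [|b IHb] G H X pX; rewrite /=; first exact: PT_const.
apply: PTcons; first exact: PT_const.
apply: PTflatten; apply: PTmap => //; apply: PTmap; first by pt.
by apply: IHb; apply: (PT_comp (f := fst)) pX _; pt.
Qed.

Lemma PTchunks d b G `{coded G} (X : G -> seq nat) (W : G -> seq (seq nat)) :
  PT X -> PT W -> PT (fun x => chunks d b (X x) (W x)).
Proof.
move=> pX pW; rewrite /chunks; apply: PTcat; first exact: PTwords.
apply: PTflatten; apply: PTmap => //; apply: PTflatten; apply: PTmap.
  apply: PTmap; first by pt.
  by apply: PTwords; apply: (PT_comp (f := fun p => p.1.1)) pX _; pt.
by apply: PTwords; pt.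
Qed.

Lemma PTconflict d G `{coded G} (e : G -> rel nat) (y c : G -> seq nat) :
  PTrel e -> PT y -> PT c -> PT (fun x => conflict (e x) d (y x) (c x)).
Proof.
move=> pe py pc; rewrite /conflict; apply: PTleq; last exact: PTalpha_alg.
by apply: PTS; apply: PTalpha_alg => //; exact: PTdel_nbrs.
Qed.

Lemma PTlow_price d G `{coded G} (e : G -> rel nat) (B : G -> nat) (i : G -> item) (ss : G -> seq slot) :
  PTrel e -> PT B -> PT i -> PT ss -> PT (fun x => low_price (e x) d (B x) (i x) (ss x)).
Proof.
move=> pe pB pi ps; rewrite /low_price; apply: PTfoldr_minn => //.
apply: PTmap; first by pt.
apply: PTfilter => //; apply: (@PTconflict d _ _ (fun p : G * slot => e p.1)).
- by apply: PTrel_comp => //; pt.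
- by pt.
- by apply: PTsnd; apply: (PT_comp (f := fst)) pi _; pt.
Qed.

Lemma PTauction_step d G `{coded G} (e : G -> rel nat) (B : G -> nat)
    (st : G -> seq item * (seq slot * seq item)) :
  PTrel e -> PT B -> PT st -> PT (fun x => auction_step (e x) d (B x) (st x)).
Proof.
move=> pe pB pst; rewrite /auction_step; apply: PTcase; [by pt | by [] |].
set G' := (G * _)%type.
have pe' : PTrel (fun p : G' => e p.1) by apply: PTrel_comp => //; rewrite /G'; pt.
have pB' : PT (fun p : G' => B p.1) by apply: (PT_comp (f := fst)) pB _; exact: PT_fst.
have pst' : PT (fun p : G' => st p.1) by apply: (PT_comp (f := fst)) pst _; exact: PT_fst.
have pss : PT (fun p : G' => (st p.1).2.1) by pt.
have pi : PT (fun p : G' => p.2.1) by rewrite /G'; pt.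
have pq : PT (fun p : G' => p.2.2) by rewrite /G'; pt.
have plow : PT (fun p : G' => low_price (e p.1) d (B p.1) p.2.1 (st p.1).2.1) by exact: PTlow_price.
have pk : PT (fun p : G' => find (fun s => conflict (e p.1) d s.1 p.2.1.2 &&
    (s.2.1 == low_price (e p.1) d (B p.1) p.2.1 (st p.1).2.1)) (st p.1).2.1).
  apply: PTfind => //; apply: PTand.
    apply: (@PTconflict d _ _ (fun p : G' * slot => e p.1.1)); last 2 [by pt].
      by apply: PTrel_comp => //; rewrite /G'; pt.
    by apply: PTsnd; apply: (PT_comp (f := fst)) pi _; pt.
  by apply: PTeqn; [pt | apply: (PT_comp (f := fst)) plow _; pt].
by pt.
Qed.

(** * The auction *)

Section Auction.
Variables (e : rel nat) (d B : nat) (its : seq item) (ys : seq (seq nat)).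

(** [inv_cheap] is the equilibrium condition: a winning bid is one above the cheapest conflicting
    price of its time, and prices never fall. By [inv_owned] a chunk has an owner exactly from its
    first bid on. *)
Record auction_inv (st : seq item * (seq slot * seq item)) : Prop := AuctionInv {
  inv_perm : perm_eq (st.1 ++ owners st.2.1 ++ st.2.2) its;
  inv_ys : map fst st.2.1 = ys;
  inv_le : forall s : slot, s \in st.2.1 -> s.2.1 <= B;
  inv_owned : forall s : slot, s \in st.2.1 -> size s.2.2 = (0 < s.2.1);
  inv_conf : forall (s : slot) (i : item), s \in st.2.1 -> i \in s.2.2 -> conflict e d s.1 i.2;
  inv_cheap : forall (s s' : slot) (i : item), s \in st.2.1 -> i \in s.2.2 -> s' \in st.2.1 ->
    conflict e d s'.1 i.2 -> s.2.1 <= s'.2.1.+1;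
  inv_drop : forall (i : item) (s : slot), i \in st.2.2 -> s \in st.2.1 -> conflict e d s.1 i.2 -> B <= s.2.1 }.

(** A bid need not shorten the queue, because an evicted owner rejoins it, but it raises a price. *)
Definition auction_measure (st : seq item * (seq slot * seq item)) : nat :=
  size st.1 + sumn [seq B - s.2.1 | s <- st.2.1].

Lemma low_price_le i ss s : s \in ss -> conflict e d s.1 i.2 ->
  low_price e d B i ss <= s.2.1.
Proof.
rewrite /low_price => s_ss cf; have : s \in [seq s <- ss | conflict e d s.1 i.2].
  by rewrite mem_filter cf.
elim: [seq s <- ss | _] => //= s' l IH; rewrite inE => /orP [/eqP <-|/IH le].
  exact: geq_minl.
exact: leq_trans (geq_minr _ _) le.
Qed.

Lemma low_priceP i ss : low_price e d B i ss < B -> exists s1 s s2,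
  [/\ ss = s1 ++ s :: s2, conflict e d s.1 i.2, s.2.1 = low_price e d B i ss &
   find (fun s => conflict e d s.1 i.2 && (s.2.1 == low_price e d B i ss)) ss = size s1].
Proof.
set m := low_price _ _ _ _ _ => lt_mB.
set P := fun s : slot => _ && _.
have hasP : has P ss.
  apply/hasP; suff: exists2 s, s \in [seq s <- ss | conflict e d s.1 i.2] & s.2.1 == m.
    by case=> s; rewrite mem_filter => /andP [cf s_ss] Es; exists s; rewrite // /P cf.
  move: lt_mB; rewrite /m /low_price; elim: [seq s <- ss | _] => [|s l IH] /=.
    by rewrite ltnn.
  set r := foldr _ _ _; case: (ltnP s.2.1 r) => [lt_sr _|le_rs lt_rB].
    by exists s; rewrite ?mem_head ?eqxx.
  by have [s' s'_l E] := IH lt_rB; exists s' => //; rewrite inE s'_l orbT.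
have lt_k : find P ss < size ss by rewrite -has_find.
pose s0 : slot := nth ([::], (0, [::])) ss (find P ss).
have /andP [cf /eqP Es] : P s0 by exact: nth_find.
exists (take (find P ss) ss), s0, (drop (find P ss).+1 ss); split=> //.
- by rewrite -drop_nth // cat_take_drop.
- by rewrite size_takel // ltnW.
Qed.

Lemma auction_step_split i q ss D : low_price e d B i ss < B ->
  exists s1 s s2, [/\ ss = s1 ++ s :: s2, conflict e d s.1 i.2, s.2.1 = low_price e d B i ss &
    auction_step e d B (i :: q, (ss, D)) =
      (s.2.2 ++ q, (s1 ++ (s.1, (s.2.1.+1, [:: i])) :: s2, D))].
Proof.
move=> lt; have [s1 [s [s2 [Ess cf Es Ek]]]] := low_priceP lt.
exists s1, s, s2; split=> //; rewrite /auction_step /= leqNgt lt /= Ek -Es.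
by rewrite Ess nth_cat ltnn subnn take_size_cat // drop_cat ltnNge leqnSn subSnn /= drop0.
Qed.

Lemma auction_step_inv st : auction_inv st ->
  auction_inv (auction_step e d B st) /\
  (st.1 != [::] -> auction_measure (auction_step e d B st) < auction_measure st).
Proof.
case: st => [[|i q] [ss D]] inv; first by split.
have [le_B|lt_B] := leqP B (low_price e d B i ss).
  rewrite /auction_step /= le_B; split; last first.
    by move=> _; rewrite /auction_measure /= addSn.
  case: inv => /= pm Ey le ow cf ch dr; split=> //=.
  - apply: perm_trans pm; apply/permP => p; rewrite /= !count_cat /=; lia.
  - move=> j s; rewrite inE => /orP [/eqP -> s_ss c|]; last exact: dr.
    exact: leq_trans le_B (low_price_le s_ss c).
have [s1 [s [s2 [Ess cfs Es ->]]]] := auction_step_split q D lt_B.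
set s' := (s.1, _); have s_ss : s \in ss by rewrite Ess mem_cat mem_head orbT.
have ssP x : x \in s1 ++ s' :: s2 -> x = s' \/ x \in ss.
  rewrite Ess !mem_cat !inE => /or3P [x1|/eqP x1|x1];
      [right|left|right]; rewrite ?x1 ?orbT //.
split; last first.
  move=> _; rewrite /auction_measure /= Ess !map_cat !sumn_cat /= size_cat.
  have := inv_owned inv s_ss; have := Es; case: (s.2.1) lt_B => [|p] /=; lia.
case: inv => /= pm Ey le ow cf ch dr; split=> /=.
- apply: perm_trans pm; rewrite Ess /owners !map_cat !flatten_cat /=.
  apply/permP => p; rewrite !count_cat /= !count_cat /=; lia.
- by rewrite -Ey Ess !map_cat.
- by move=> x /ssP [->|/le //]; rewrite /= Es.
- by move=> x /ssP [->|/ow //].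
- move=> x j /ssP [->|x_ss]; last exact: cf.
  by rewrite inE => /eqP ->.
- move=> x x' j /ssP [->|x_ss] /=.
    rewrite inE => /eqP -> /ssP [->|x'_ss] /= c; first by lia.
    by rewrite ltnS Es; exact: low_price_le.
  move=> j_x /ssP [->|x'_ss] c; last exact: ch c.
  by apply: leq_trans (ch _ _ _ x_ss j_x s_ss c) _ => /=; rewrite ltnS ltnW.
(* The chunk that received the bid was priced below [B], so no dropped item conflicts with it. *)
- move=> j x j_D /ssP [->|x_ss] c; last exact: dr c.
  by have := dr j s j_D s_ss c; rewrite Es leqNgt lt_B.
Qed.

Lemma auction_init_inv : auction_inv (its, ([seq (y, (0, [::])) | y <- ys], [::])).
Proof.
have E (s : slot) : s \in [seq (y, (0, [::])) | y <- ys] -> s.2 = (0, [::]).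
  by case/mapP => y _ ->.
split=> //=.
- rewrite /owners -map_comp cats0 (_ : flatten _ = [::]) ?cats0 //.
  by elim: (ys).
- by rewrite -map_comp map_id.
- by move=> s /E ->.
- by move=> s /E ->.
- by move=> s i /E ->.
- by move=> s s' i /E ->.
Qed.

Lemma auction_iter_inv k :
  let st := iter k (auction_step e d B) (its, ([seq (y, (0, [::])) | y <- ys], [::])) in
  auction_inv st /\ (st.1 = [::] \/ auction_measure st + k <= size its + size ys * B).
Proof.
elim: k => [|k [IHi IHm]] /=.
  split; first exact: auction_init_inv.
  right; rewrite /auction_measure /= addn0 leq_add2l -map_comp.
  by elim: (ys) => //= y l IH; rewrite subn0 mulSn leq_add2l.
set st := iter k _ _ in IHi IHm *; have [inv' lt] := auction_step_inv IHi.
split=> //; case: IHm => [E|le]; first by left; rewrite /auction_step E.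
have [E|N] := eqVneq st.1 [::]; first by left; rewrite /auction_step E.
by right; have := lt N; lia.
Qed.
End Auction.

Lemma auctionP e d its ys :
  auction_inv e d (size ys).+2 its ys ([::], auction e d its ys).
Proof.
rewrite /auction; set st0 := (its, _); set k := size its + _.
have [inv] := auction_iter_inv e d (size ys).+2 its ys k.
set st := iter k _ _ in inv *; case=> [E|le].
  by case: st E inv => q r /= ->.
have E : st.1 = [::].
  by apply/size0nil; move: le; rewrite /auction_measure /k; lia.
by case: st E inv {le} => q r /= ->.
Qed.

Lemma sz_slots (ss : seq slot) B : (forall s : slot, s \in ss -> s.2.1 <= B) ->
  sz ss <= sz (map fst ss) + size ss * (2 * B + 5) + sz (owners ss).
Proof.
rewrite /owners; elim: ss => [|s ss IH] leB /=; first by rewrite !sz_seq !big_nil.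
rewrite !sz_cons; have := IH (fun x xs => leB x (mem_behead (s := s :: ss) xs)).
have E : sz s = (sz s.1 + (sz s.2.1 + sz s.2.2).+1).+1 by rewrite -!sz_pair; case: (s) => y [].
have := leB s (mem_head _ _); have := sz_nat s.2.1.
pose proof (sz_cat s.2.2 (flatten [seq x.2.2 | x <- ss])).
by rewrite E [(size ss).+1 * _]mulSn; lia.
Qed.

Lemma sz_auction_inv e d B its ys st : auction_inv e d B its ys st ->
  sz st <= 2 * sz its + sz ys + size ys * (2 * B + 5) + 4.
Proof.
case: st => q [ss D] [/= pm Ey le _ _ _ _].
rewrite !sz_pair; have := sz_slots le; rewrite Ey.
have -> : size ss = size ys by rewrite -Ey size_map.
have E : sz (q ++ owners ss ++ D) = sz its by apply: sz_perm pm.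
pose proof (sz_cat q (owners ss ++ D)); pose proof (sz_cat (owners ss) D).
by lia.
Qed.

(** The invariant bounds all intermediate states: items are only moved around and prices never
    exceed the limit. *)
Lemma PTauction d G `{coded G} (e : G -> rel nat) (its : G -> seq item) (ys : G -> seq (seq nat)) :
  PTrel e -> PT its -> PT ys -> PT (fun x => auction (e x) d (its x) (ys x)).
Proof.
move=> pe pi py; rewrite /auction; apply: PTsnd.
apply: (PTiter (f := fun x => auction_step (e x) d (size (ys x)).+2)).
- by pt.
- apply: (@PTauction_step d _ _ (fun p : G * _ => e p.1)).
  + by apply: PTrel_comp => //; pt.
  + by do 2!apply: PTS; apply: PTsize; apply: (PT_comp (f := fst)) py _; pt.
  + by pt.
- by pt.
- have [q pq qP] := PT_sizeb pi; have [r pr rP] := PT_sizeb py.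
  exists (fun n => 2 * q n + r n + r n * (2 * (r n).+2 + 5) + 4).
    apply: polyb_add (polyb_const _); apply: polyb_add.
      by apply: polyb_add => //; apply: polyb_mul (polyb_const _) pq.
    apply: polyb_mul => //; apply: polyb_add (polyb_const _).
    by apply: polyb_mul (polyb_const _) _; do 2!apply: polyb_S.
  move=> x k _; have [inv _] := auction_iter_inv (e x) d (size (ys x)).+2 (its x) (ys x) k.
  apply: leq_trans (sz_auction_inv inv) _.
  have le_r : size (ys x) <= r (sz x) := leq_trans (size_sz _) (rP x).
  rewrite leq_add2r; apply: leq_add; last by apply: leq_mul => //; lia.
  by apply: leq_add; [rewrite leq_mul2l; exact: qP | exact: rP].
Qed.

Lemma PTlevel d lv G `{coded G} (e : G -> rel nat) (X : G -> seq nat)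
    (st : G -> seq (seq nat) * (seq item * nat)) :
  PTrel e -> PT X -> PT st -> PT (fun x => level (e x) d lv (X x) (st x)).
Proof.
move=> pe pX ps; rewrite /level.
pose r x := auction (e x) lv.+1 (st x).2.1 (chunks d (beta lv.+1) (X x) (st x).1).
have pr : PT r by apply: PTauction => //; [pt | apply: PTchunks => //; pt].
apply: (PT_ext (g := fun x => level_with (e x) lv (st x) (r x))) => //.
rewrite /level_with /owners /split_item.
have pe' : PTrel (fun p : G * item => e p.1) by apply: PTrel_comp => //; pt.
have pr' : PT (fun p : G * item => root_alg (e p.1) lv p.2.2) by apply: PTroot => //; pt.
pt.
- by apply: (PT_comp (f := fst)) pr' _; pt.
- by apply: PTcomps => //; apply: PTdel => //; pt.
- by apply: PTalpha_alg => //; pt.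
Qed.

Lemma PTlevels d lv G `{coded G} (e : G -> rel nat) (X : G -> seq nat)
    (st : G -> seq (seq nat) * (seq item * nat)) :
  PTrel e -> PT X -> PT st -> PT (fun x => levels (e x) d lv (X x) (st x)).
Proof.
elim: lv st => //= lv IH st pe pX ps; apply: IH => //; exact: PTlevel.
Qed.

Lemma PTodd_half G `{coded G} (n : G -> nat) : PT n -> PT (fun x => (odd (n x), (n x)./2)).
Proof.
move=> pn.
have E k : iter k (fun p : bool * nat => (~~ p.1, if p.1 then p.2.+1 else p.2)) (false, 0)
    = (odd k, k./2).
  by elim: k => // k IH; rewrite iterS IH /= uphalf_half; case: (odd k).
apply: (PT_ext (g := fun x => iter (n x) (fun p : bool * nat =>
  (~~ p.1, if p.1 then p.2.+1 else p.2)) (false, 0))) => [x|]; first by rewrite E.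
apply: (PTiter (f := fun _ p => (~~ p.1, if p.1 then p.2.+1 else p.2)) (i := fun=> (false, 0))) => //.
- by pt.
- by pt.
have [q pq qP] := PT_sizeb pn; exists (fun t => q t + 4).
  exact: polyb_add (polyb_const _).
move=> x k lek; rewrite E sz_pair sz_nat; have := qP x; rewrite sz_nat.
by have := sz_bool (odd k); lia.
Qed.

Lemma PTodd G `{coded G} (n : G -> nat) : PT n -> PT (fun x => odd (n x)).
Proof. by move=> pn; apply: (PT_ext _ (PTfst (PTodd_half pn))). Qed.
Lemma PThalf G `{coded G} (n : G -> nat) : PT n -> PT (fun x => (n x)./2).
Proof. by move=> pn; apply: (PT_ext _ (PTsnd (PTodd_half pn))). Qed.

Lemma PTif_pos A G `{coded A} `{coded G} (n : G -> nat) (f g : G -> A) :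
  PT n -> PT f -> PT g -> PT (fun x => if n x is _.+1 then f x else g x).
Proof.
move=> pn pf pg; apply: (PT_ext (g := fun x => if 1 <= n x then f x else g x)) => [x|].
  by case: (n x).
by pt.
Qed.

Lemma sz_bits (s : seq bool) : sz s <= 4 * size s + 1.
Proof. by elim: s => // b s IH; rewrite sz_cons /=; have := sz_bool b; lia. Qed.
Lemma sz_bits_ge (s : seq bool) : size s <= sz s.
Proof. exact: size_sz. Qed.

Lemma PTnat_bits G `{coded G} (n : G -> nat) : PT n -> PT (fun x => nat_bits (n x)).
Proof.
move=> pn; rewrite /nat_bits; set f := fun p : nat * seq bool => _.
apply: PTcat; last exact: PT_const.
apply: PTsnd; apply: (PTiter (f := fun _ => f)) => //.
- rewrite /f; apply: PTif_pos; [by pt | | by pt].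
  apply: PT_pair; first by apply: PThalf; pt.
  by pt; apply: PTodd; pt.
- by pt.
have [q pq qP] := PT_sizeb pn; exists (fun t => q t + 8 * q t + 4).
  by apply: polyb_add (polyb_const _); apply: polyb_add => //; apply: polyb_mul (polyb_const _) _.
move=> x k lek; have E : (iter k f (n x, [::])).1 <= n x /\ size (iter k f (n x, [::])).2 <= 2 * k.
  elim: k {lek} => //= k [IH1 IH2]; set p := iter _ _ _ in IH1 IH2 *; rewrite /f.
  case E : p.1 => [|m]; first by rewrite E; split=> //; lia.
  by rewrite size_cat /=; split; lia.
move: E; case: (iter _ _ _) => a b /= [le_a le_b]; rewrite sz_pair sz_nat.
by have := qP x; have := sz_bits b; rewrite sz_nat; lia.
Qed.

Lemma PTinstance_bits G `{coded G} (e : G -> rel nat) (V X : G -> seq nat) (l : G -> nat) :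
  PTrel e -> PT V -> PT X -> PT l -> PT (fun x => instance_bits (e x) (V x) (X x) (l x)).
Proof.
move=> pe pV pX pl; rewrite /instance_bits.
apply: PTcat; first by apply: PTnat_bits; pt.
apply: PTcat.
  apply: PTflatten; apply: PTmap => //; apply: PTmap.
    by apply: PTrel_comp => //; pt.
  by apply: (PT_comp (f := fst)) pV _; pt.
apply: PTcat; first exact: PTnat_bits.
apply: PTcat; last by apply: PTnat_bits; pt.
by apply: PTmap => //; apply: PTmem; [pt | apply: (PT_comp (f := fst)) pX _; pt].
Qed.

Lemma PTkernel d G `{coded G} (e : G -> rel nat) (n l : G -> nat) (X : G -> seq nat) :
  PTrel e -> PT n -> PT l -> PT X -> PT (fun x => kernel (e x) d (n x) (l x) (X x)).
Proof.
move=> pe pn pl pX; pose st x := levels (e x) d d (X x) (init_state (e x) (n x) (X x)).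
have pst : PT st.
  apply: PTlevels => //; rewrite /init_state.
  apply: PT_pair; first by pt.
  apply: PT_pair; last by pt.
  apply: PTmap; first by pt.
  apply: PTcomps => //; apply: PTfilter; last by pt.
  by apply: PTneg; apply: PTmem; [pt | apply: (PT_comp (f := fst)) pX _; pt].
have pV : PT (fun x => kept_vertices (X x) (st x).1) by rewrite /kept_vertices; pt.
apply: (PT_ext (g := fun x => output_bits (e x) (n x) (l x) (X x) (st x))) => //.
rewrite /output_bits; apply: PT_if; [by pt | | by pt].
by apply: PTinstance_bits => //; pt.
Qed.

Lemma PTread_digits G `{coded G} (w : G -> seq bool) : PT w -> PT (fun x => read_digits (w x)).
Proof.
move=> pw; rewrite /read_digits; apply: PTsnd; apply: (PTiter (f := fun _ => read_step)) => //.
- by pt.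
- rewrite /read_step; apply: PT_if; [by pt | by pt |].
  apply: PTcase; [by pt | by pt |].
  apply: PT_if; [by pt | | by pt].
  by apply: PTcase; pt.
- by pt.
have [q pq qP] := PT_sizeb pw; exists (fun t => 4 * q t + 10).
  by apply: polyb_add (polyb_const _); apply: polyb_mul (polyb_const _) _.
move=> x k _; have : size (iter k read_step (false, ([::], w x))).2.1 +
    size (iter k read_step (false, ([::], w x))).2.2 <= size (w x).
  elim: k => // k; rewrite iterS; case: (iter k _ _) => [[] [a [|b r]]] //=.
  by case: b; case: r => [|b r] /=; lia.
case: (iter _ _ _) => [b [u v]] /=; rewrite !sz_pair.
have := sz_bits u; have := sz_bits v; have := sz_bool b; have := qP x; have := sz_bits_ge (w x).
by lia.
Qed.

Lemma PTbits_value G `{coded G} (c : G -> nat) (bs : G -> seq bool) :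
  PT c -> PT bs -> PT (fun x => bits_value (c x) (bs x)).
Proof.
move=> pc pb; rewrite /bits_value.
apply: (PTfoldl (g := fun x v b => minn (c x) (v + v + (if b then 1 else 0))) (i := fun=> 0)) => //.
- apply: PTminn; first by apply: (PT_comp (f := fst)) pc _; pt.
  by pt.
- by pt.
have [q pq qP] := PT_sizeb pc; exists (fun t => q t) => // x l1 l2 _; apply: leq_trans (qP x).
rewrite !sz_nat ltnS leq_mul2l /=; elim/last_ind: l1 => // l1 b _.
by rewrite foldl_rcons geq_minl.
Qed.

Lemma PTkernel_bits d : PT (kernel_bits d).
Proof.
pose p (w : seq bool) := read_digits w.
have pp : PT p by apply: PTread_digits; pt.
pose n w := bits_value (size w) (p w).1.
have pn : PT n by rewrite /n; apply: PTbits_value; pt.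
pose r w := read_digits (drop (n w * n w) (p w).2).
have pr : PT r by rewrite /r; apply: PTread_digits; pt.
apply: (PT_ext (g := fun w => parsed_kernel d w (n w) (p w).2 (r w))) => //.
rewrite /parsed_kernel; apply: PTkernel => //.
- rewrite /adj; pt.
  + by apply: (PT_comp (f := fst)) pn _; pt.
  + by apply: (PT_comp (f := fst)) pp _; pt.
- by apply: PTbits_value; pt.
- pt.
  by apply: (PT_comp (f := fst)) pr _; pt.
Qed.

(** * From word functions in [PT] to Turing machines *)

(** [S0] delivers the last bit of the word first, so consing onto the empty list restores the order.
    The control bit on [S2] is renewed in each round until [S0] is empty. *)
Definition load_prog : prog :=
  Seq (Push S1 false) (Seq (Push S2 true) (While S2 (Pop S0
    (Seq (push_bits (true :: enc (code true))) (Push S2 true))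
    (Seq (push_bits (true :: enc (code false))) (Push S2 true))
    Skip))).

Lemma evle_load w :
  evle load_prog (Stacks (rev w) [::] [::] [::]) (Stacks [::] (enc (code w)) [::] [::])
    (20 * (size w).+1).
Proof.
have loopP u v : evle (While S2 (Pop S0
    (Seq (push_bits (true :: enc (code true))) (Push S2 true))
    (Seq (push_bits (true :: enc (code false))) (Push S2 true)) Skip))
    (Stacks (rev u) (enc (code v)) [:: true] [::]) (Stacks [::] (enc (code (u ++ v))) [::] [::])
    (14 * size u + 5).
  elim/last_ind: u v => [|u b IH] v.
    exists 4 => //; apply: (@EvWhileT S2 _ _ [::] _ _ 2 1) => //; last exact: EvWhileE.
    by apply: (@EvPopE S0) => //; constructor.
  rewrite rev_rcons cat_rcons size_rcons; apply: evle_mono.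
    apply: (@evle_whileT S2); [reflexivity | | exact: (IH (b :: v))].
    apply: (_ : evle _ _ _ 12).
    case: b; [apply: (@evle_popT S0); first reflexivity | apply: (@evle_popF S0); first reflexivity];
      (apply: (@evle_seq _ _ _ _ _ 9 1); [exact: (evle_mono (n := 9) (evle_push_bits _ _ _ _ _)) | exact: evle_push2]).
  by lia.
apply: evle_mono.
  apply: evle_seq; first exact: evle_push1.
  apply: evle_seq; first exact: evle_push2.
  by have := loopP w [::]; rewrite cats0; apply.
by lia.
Qed.

Definition unload_prog : prog :=
  While S1 (Pop S1 (Seq (Pop S1 Skip Skip Skip) (Seq (Pop S1 Skip Skip Skip) (Push S0 true)))
    (Push S0 false) Skip).

Lemma evle_unload u :
  evle unload_prog (Stacks [::] (enc (code u)) [::] [::]) (Stacks (rev u) [::] [::] [::])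
    (12 * (size u).+1).
Proof.
have loopP v c : evle unload_prog (Stacks c (enc (code v)) [::] [::])
    (Stacks (catrev v c) [::] [::] [::]) (12 * (size v).+1).
  elim: v c => [|b v IH] c; first by apply: evle_mono; first exact: (evle_whileF (j := S1)).
  apply: evle_mono; first apply: (@evle_whileT S1); [reflexivity | | exact: IH |].
    apply: (_ : evle _ _ _ 10); case: b => /=.
      apply: evle_mono; first apply: (@evle_popT S1) => //=.
        apply: evle_seq; first by apply: (@evle_popF S1) => //=; exact: evle_skip.
        apply: evle_seq; first by apply: (@evle_popF S1) => //=; exact: evle_skip.
        exact: evle_push0.
      by [].
    by apply: evle_mono; first by apply: (@evle_popF S1) => //=; exact: evle_push0.
  by rewrite /=; lia.
exact: loopP.
Qed.

Lemma PT_computable (f : seq bool -> seq bool) : PT f ->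
  exists (M : TM) (c : nat), forall w, 0 < size w ->
    exists2 t, t <= c * (size w).+1 ^ c & computes_within M w t (f w).
Proof.
move=> pf; have [q pq qP] := PT_sizeb pf; have [p [pc [evp ppc hp]]] := PT_elim pf.
have hq : polyb (fun n => pc (4 * n + 1)).
  by apply: polyb_comp => //; apply: polyb_add (polyb_const _); exact: polyb_mul (polyb_const _) polyb_id.
have [c0 c0P] := pq.
pose T n := 20 * n.+1 + (pc (4 * n + 1) + 12 * (c0 * (4 * n + 2) ^ c0).+1) + 10.
have pT : polyb T.
  apply: polyb_add (polyb_const _); apply: polyb_add.
    by apply: polyb_mul (polyb_const _) (polyb_S polyb_id).
  apply: polyb_add => //; apply: polyb_mul (polyb_const _) (polyb_S _).
  apply: polyb_mul (polyb_const _) (polyb_exp _ _); apply: polyb_add (polyb_const _).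
  exact: polyb_mul (polyb_const _) polyb_id.
have [c cP] : polyb (fun n => 200 * T n * (n + T n).+1).
  apply: polyb_mul; first exact: polyb_mul (polyb_const _) pT.
  exact: polyb_S (polyb_add polyb_id pT).
exists (prog_tm (Seq load_prog (Seq p unload_prog))), c => w w_gt0.
have szw := sz_bits w.
have [n le_n evn] : evle (Seq load_prog (Seq p unload_prog)) (Stacks (rev w) [::] [::] [::])
    (Stacks (rev (f w)) [::] [::] [::]) (T (size w)).
  apply: evle_mono.
    apply: evle_seq; first exact: evle_load.
    apply: evle_seq; last exact: evle_unload.
    by have := evp w [::] [::] [::] [::] (4 * size w + 1) szw; rewrite !cats0; apply.
  rewrite /T; have : size (f w) <= c0 * (4 * size w + 2) ^ c0.
    apply: leq_trans (sz_bits_ge _) _; apply: leq_trans (qP w) _; apply: leq_trans (c0P _) _.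
    by have -> : 4 * size w + 2 = (4 * size w + 1).+1; [lia | exact: polyE].
  by lia.
exists (200 * n * (size w + n).+1); last exact: prog_tm_computes evn.
apply: leq_trans (cP _); apply: leq_mul; first by rewrite leq_mul2l le_n.
by lia.
Qed.

Lemma kernel_bits_computable d :
  exists (M : TM) (c : nat), forall w, 0 < size w ->
    exists2 t, t <= c * (size w).+1 ^ c & computes_within M w t (kernel_bits d w).
Proof. exact: PT_computable (PTkernel_bits d). Qed.

(** * Independence number, treedepth and blocking sets *)

Section Graph.
Variables (T : finType) (e : rel T).
Hypotheses (e_sym : symmetric e) (e_irr : irreflexive e).
Implicit Types (A B I N R S Y Z : {set T}) (u v : T).

Definition nonadj A B : bool := [forall u in A, forall v in B, ~~ e u v].
Definition nbrs Y : {set T} := [set u | [exists y in Y, e u y]].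
Definition indep S : nat := \max_(I : {set T} | (I \subset S) && nonadj I I) #|I|.

Lemma nonadjP A B : reflect (forall u v, u \in A -> v \in B -> ~~ e u v) (nonadj A B).
Proof.
apply: (iffP forall_inP) => [h u v uA vB|h u uA]; first by have /forall_inP := h u uA; apply.
by apply/forall_inP => v vB; exact: h.
Qed.

Lemma nonadjS A A' B B' : A' \subset A -> B' \subset B -> nonadj A B -> nonadj A' B'.
Proof.
move=> sA sB /nonadjP h; apply/nonadjP => u v uA vB.
by apply: h; [exact: (subsetP sA) | exact: (subsetP sB)].
Qed.

Lemma nonadjC A B : nonadj A B = nonadj B A.
Proof. by apply/nonadjP/nonadjP => h u v uA vB; rewrite e_sym; exact: h. Qed.

Lemma nonadjUl A B S : nonadj (A :|: B) S = nonadj A S && nonadj B S.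
Proof.
apply/nonadjP/andP => [h|[/nonadjP hA /nonadjP hB] u v].
  by split; apply/nonadjP => u v uA vS; apply: h; rewrite // inE uA ?orbT.
by rewrite inE => /orP [uA|uB] vS; [exact: hA | exact: hB].
Qed.

Lemma nonadjUr A B S : nonadj S (A :|: B) = nonadj S A && nonadj S B.
Proof. by rewrite ![nonadj S _]nonadjC nonadjUl. Qed.

Lemma in_nbrs u Y : (u \in nbrs Y) = [exists y in Y, e u y].
Proof. by rewrite inE. Qed.

Lemma nbrsS Y Z : Y \subset Z -> nbrs Y \subset nbrs Z.
Proof.
move=> sYZ; apply/subsetP => u; rewrite !in_nbrs => /exists_inP [y yY uy].
by apply/exists_inP; exists y; rewrite ?(subsetP sYZ).
Qed.

Lemma nonadj_nbrs A B : nonadj (A :\: nbrs B) B.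
Proof.
apply/nonadjP => u v; rewrite inE in_nbrs => /andP [/exists_inP h _] vB.
by apply/negP => uv; apply: h; exists v.
Qed.

Lemma indepP S : exists I, [/\ I \subset S, nonadj I I & #|I| = indep S].
Proof.
have P0 : (set0 \subset S) && nonadj set0 set0.
  by rewrite sub0set; apply/nonadjP => u v; rewrite inE.
rewrite /indep (bigmax_eq_arg set0 P0); case: arg_maxnP => // I /andP [sI nI] _.
by exists I.
Qed.

Lemma indep_ge I S : I \subset S -> nonadj I I -> #|I| <= indep S.
Proof. by move=> sI nI; apply: (leq_bigmax_cond (F := fun I : {set T} => #|I|)); rewrite sI. Qed.

Lemma indepS A B : A \subset B -> indep A <= indep B.
Proof.
move=> sAB; have [I [sI nI <-]] := indepP A.
by apply: indep_ge nI; exact: subset_trans sAB.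
Qed.

Lemma indep_card S : indep S <= #|S|.
Proof. by have [I [sI _ <-]] := indepP S; exact: subset_leq_card. Qed.

Lemma indep0 : indep set0 = 0.
Proof. by apply/eqP; rewrite -leqn0 -(cards0 T) indep_card. Qed.

Lemma indepD1 S v : indep S <= (indep (S :\ v)).+1.
Proof.
have [I [sI nI <-]] := indepP S.
apply: (@leq_trans #|I :\ v|.+1); first by rewrite (cardsD1 v I); case: (v \in I).
by rewrite ltnS; apply: indep_ge; [exact: setSD | apply: nonadjS nI; exact: subsetDl].
Qed.

Lemma indep_leU A B : indep (A :|: B) <= indep A + indep B.
Proof.
have [I [sI nI <-]] := indepP (A :|: B).
rewrite -(setIidPl sI) setIUr (leq_trans (leq_card_setU _ _)) //.
by apply: leq_add; apply: indep_ge (subsetIr _ _) _; apply: nonadjS nI; exact: subsetIl.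
Qed.

Lemma indepU A B : [disjoint A & B] -> nonadj A B -> indep (A :|: B) = indep A + indep B.
Proof.
move=> dAB nAB; apply/eqP; rewrite eqn_leq indep_leU /=.
have [I [sI nI <-]] := indepP A; have [J [sJ nJ <-]] := indepP B.
have dIJ : #|I :|: J| = #|I| + #|J|.
  apply/eqP; rewrite (eq_sym _ (#|I| + _)) eq_sym; have := leq_card_setU I J => /leqifP.
  by rewrite (disjointWl sI (disjointWr sJ dAB)).
rewrite -dIJ; apply: indep_ge; first exact: setUSS.
rewrite nonadjUl !nonadjUr nI nJ (nonadjS sI sJ nAB).
by rewrite nonadjC (nonadjS sI sJ nAB).
Qed.

(** An independent set either avoids [v], or contains it and then avoids its neighbours. *)
Lemma indep_vertex v S : v \notin S ->
  indep (v |: S) = maxn (indep S) (indep (S :\: nbrs [set v])).+1.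
Proof.
move=> vS; apply/eqP; rewrite eqn_leq geq_max; apply/and3P; split.
- have [I [sI nI <-]] := indepP (v |: S); rewrite leq_max.
  have [vI|vI] := boolP (v \in I); last first.
    rewrite indep_ge //; apply/subsetP => u uI; have := subsetP sI u uI.
    by rewrite !inE => /orP [/eqP Eu|//]; rewrite -Eu uI in vI.
  apply/orP; right; rewrite (cardsD1 v I) vI ltnS; apply: indep_ge.
    apply/subsetP => u; rewrite !inE => /andP [uv uI].
    have := subsetP sI u uI; rewrite !inE (negbTE uv) /= => ->; rewrite andbT.
    apply/exists_inP => -[w]; rewrite inE => /eqP ->; apply/negP.
    by have /nonadjP := nI; apply.
  by apply: nonadjS nI; exact: subsetDl.
- by apply: indepS; exact: subsetUr.
- have [I [sI nI <-]] := indepP (S :\: nbrs [set v]).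
  have vI : v \notin I by apply/negP => /(subsetP sI); rewrite !inE (negbTE vS) andbF.
  have := cardsU1 v I; rewrite vI add1n => <-; apply: indep_ge.
    by apply: setUS; apply: subset_trans sI _; exact: subsetDl.
  have nIv : nonadj I [set v] by apply: nonadjS sI (subxx _) (nonadj_nbrs _ _).
  rewrite nonadjUl !nonadjUr nI nIv nonadjC nIv !andbT.
  by apply/nonadjP => x y; rewrite !inE => /eqP -> /eqP ->; rewrite e_irr.
Qed.

(** * Treedepth by recursive decomposition *)

(** Induction on such derivations replaces reasoning about forests; agreement with [td_le] is shown
    in both directions. *)
Inductive TD : nat -> {set T} -> Prop :=
  | TD0 d : TD d set0
  | TDU d A B : TD d A -> TD d B -> [disjoint A & B] -> nonadj A B -> TD d (A :|: B)
  | TDv d v A : v \notin A -> TD d A -> TD d.+1 (v |: A).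

Lemma TDS d A : TD d A -> TD d.+1 A.
Proof.
elim=> {d A} [d|d A B _ hA _ hB|d v A vA _ h].
- exact: TD0.
- exact: TDU.
- exact: TDv.
Qed.

Lemma TD_sub d A B : TD d A -> B \subset A -> TD d B.
Proof.
move=> td; elim: td B => {d A} [d|d A1 A2 _ h1 _ h2 dA nA|d v A vA tA h] B sB.
- by move: sB; rewrite subset0 => /eqP ->; exact: TD0.
- rewrite -(setIidPl sB) setIUr; apply: TDU.
  + by apply: h1; exact: subsetIr.
  + by apply: h2; exact: subsetIr.
  + by apply: disjointWl (disjointWr _ dA); exact: subsetIr.
  + by apply: nonadjS nA; exact: subsetIr.
- have [vB|vB] := boolP (v \in B).
    by rewrite -(setD1K vB); apply: TDv; [rewrite !inE eqxx | apply: h; rewrite subDset].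
  apply: TDS; apply: h; apply/subsetP => u uB; have := subsetP sB u uB.
  by rewrite !inE => /orP [/eqP Eu|//]; rewrite -Eu uB in vB.
Qed.

Lemma TD_set0 A : TD 0 A -> A = set0.
Proof.
move: {1 3}0 (erefl 0) => d E td; elim: td E => {d A} // d A B _ hA _ hB _ _ E.
by rewrite (hA E) (hB E) setU0.
Qed.

(** * Small blocking sets *)

Definition blocked_by (b : nat) S : Prop := forall Y, indep (S :\: Y) < indep S ->
  exists2 Z : {set T}, Z \subset Y & (#|Z| <= b) && (indep (S :\: Z) < indep S).

Lemma blocked_byW b b' S : b <= b' -> blocked_by b S -> blocked_by b' S.
Proof.
move=> le h Y /h [Z sZ /andP [cZ lt]]; exists Z => //; by rewrite lt (leq_trans cZ le).
Qed.

(** The independence number is additive here, so a set that lowers it on the union lowers it on one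
    part, and that part alone supplies [Z]. *)
Lemma blocked_byU b A B : [disjoint A & B] -> nonadj A B ->
  blocked_by b A -> blocked_by b B -> blocked_by b (A :|: B).
Proof.
move=> dAB nAB hA hB Y.
have E Z : indep ((A :|: B) :\: Z) = indep (A :\: Z) + indep (B :\: Z).
  rewrite setDUl indepU //; first exact: disjointWl (subsetDl _ _) (disjointWr (subsetDl _ _) dAB).
  exact: nonadjS (subsetDl _ _) (subsetDl _ _) nAB.
have leA Z : indep (A :\: Z) <= indep A by exact: indepS (subsetDl _ _).
have leB Z : indep (B :\: Z) <= indep B by exact: indepS (subsetDl _ _).
rewrite E indepU // => lt.
have [/hA [Z sZ /andP [cZ ltZ]]|leAY] := ltnP (indep (A :\: Y)) (indep A).
  by exists Z; rewrite // cZ E; have := leB Z; lia.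
have /hB [Z sZ /andP [cZ ltZ]] : indep (B :\: Y) < indep B by lia.
by exists Z; rewrite // cZ E; have := leA Z; lia.
Qed.

(* The hard case of [blocked_by_vertex]: the graph is [v |: S], [N] is the
   neighbourhood of [v] in it, and there are maximum independent sets both through
   and off [v]. Blocking [S] and [S :\: N] separately would cost [2b]. One vertex
   is saved by extending a blocking set [Z0] of [S] with a blocking set of
   [S :\: Z0] taken inside [N :|: Y]: it must use a vertex outside [Y]. *)
Lemma blocked_both b S N Y a :
  (forall R, R \subset S -> blocked_by b R) -> indep S = a.+1 -> indep (S :\: N) = a ->
  0 < b -> indep (S :\: Y) <= a -> indep ((S :\: N) :\: Y) < a ->
  exists2 Z : {set T}, Z \subset Y & [&& #|Z| <= b + b.-1, indep (S :\: Z) <= a &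
    indep ((S :\: N) :\: Z) < a].
Proof.
move=> hb aS aN b_gt0; have [n] := ubnP #|Y|; elim: n Y => // n IHn Y ltYn aY aNY.
(* If some [u] is essential for blocking [S], then [Y] lowers the independence number of [S] by
   exactly one. Otherwise any single vertex may leave [Y] without harm to the effect on [S]. *)
have [/exists_inP [u uY lt]|/exists_inP none] := boolP [exists u in Y, a < indep (S :\: (Y :\ u))].
  have geY : a <= indep (S :\: Y).
    have -> : S :\: Y = (S :\: (Y :\ u)) :\ u.
      apply/setP => x; rewrite !inE; case: (eqVneq x u) => [->|]; rewrite ?uY //=.
    by have := indepD1 (S :\: (Y :\ u)) u; lia.
  have [|Z0 sZ0 /andP [cZ0 ltZ0]] := hb S (subxx _) Y; first by rewrite aS ltnS.
  have geZ0 : a <= indep (S :\: Z0) by apply: leq_trans geY (indepS (setDS _ sZ0)).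
  have [|R sR /andP [cR ltR]] := hb (S :\: Z0) (subsetDl _ _) (N :|: Y).
    apply: leq_ltn_trans (leq_trans aNY geZ0); apply: indepS.
    by apply/subsetP => x; rewrite !inE; case: (x \in N); case: (x \in Y); rewrite ?andbF //= => /andP [].
  have aZ0 : indep (S :\: Z0) = a by move: ltZ0; rewrite aS; lia.
  (* Since all of [Y] leaves [a] in [S], no part of [Y] added to [Z0] can go below [a]; so [R]
     spends a vertex outside [Y], and this is the vertex saved. *)
  have RY : ~~ (R \subset Y).
    apply/negP => sRY; move: ltR; rewrite aZ0 ltnNge => /negP; apply.
    apply: leq_trans geY _; apply: indepS; rewrite setDDl; apply: setDS.
    by rewrite subUset sZ0.
  exists (Z0 :|: (R :&: Y)); first by rewrite subUset sZ0 subsetIr.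
  apply/and3P; split.
  - apply: leq_trans (leq_card_setU _ _) (leq_add cZ0 _).
    rewrite -ltnS prednK //; apply: leq_trans cR; apply: proper_card.
    by rewrite properE subsetIl subsetI subxx.
  - by rewrite -aZ0; apply: indepS; apply: setDS; exact: subsetUl.
  - rewrite -aZ0; apply: leq_ltn_trans ltR; apply: indepS.
    rewrite !setDDl; apply: setDS; apply/subsetP => x; rewrite !inE.
    case/orP => [->|xR]; first by rewrite orbT.
    by have := subsetP sR x xR; rewrite inE xR => /orP [->|->]; rewrite ?orbT.
(* [Z1] suffices for [S :\: N], so a vertex of [Y] outside [Z1] can be discarded; if there is none,
   [Y] itself has at most [b] vertices. *)
have [|Z1 sZ1 /andP [cZ1 ltZ1]] := hb (S :\: N) (subsetDl _ _) Y; first by rewrite aN.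
rewrite aN in ltZ1.
have [EZ|] := eqVneq Z1 Y.
  by exists Y => //; rewrite aY aNY -EZ !andbT; lia.
rewrite eqEsubset sZ1 => /subsetPn [u uY uZ1].
have [||| Z sZ hZ] := IHn (Y :\ u).
- by have := cardsD1 u Y; rewrite uY; lia.
- by rewrite leqNgt; apply/negP => lt; apply: none; exists u.
- apply: leq_ltn_trans ltZ1; apply: indepS; apply: setDS.
  by apply/subsetP => x xZ; rewrite !inE (subsetP sZ1) // andbT; apply: contraNneq uZ1 => <-.
- by exists Z => //; apply: subset_trans sZ _; exact: subsetDl.
Qed.

(** If [v] is in [Y], either [v] alone blocks or it joins a blocking set of [S], at cost [b + 1].
    Otherwise only the larger of the two kinds of independent sets has to be lowered, at cost [b]; a
    tie costs [2 * b - 1] by [blocked_both]. *)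
Lemma blocked_by_vertex b v S : v \notin S -> 0 < b ->
  (forall R, R \subset S -> blocked_by b R) -> blocked_by (maxn b.+1 (b + b.-1)) (v |: S).
Proof.
move=> vS b_gt0 hb Y; set N := nbrs [set v]; have Ev := indep_vertex vS; rewrite -/N in Ev.
have vSN : indep S <= indep (v |: S) by apply: indepS; exact: subsetUr.
have [vY|vY] := boolP (v \in Y).
  move=> lt; have [aS|aS] := ltnP (indep S) (indep (v |: S)).
    exists [set v]; first by rewrite sub1set.
    by rewrite cards1 setU1K // aS andbT; lia.
  have [|Z sZ /andP [cZ ltZ]] := hb S (subxx _) Y.
    by apply: leq_trans aS; apply: leq_ltn_trans lt; apply: indepS; apply: setSD; exact: subsetUr.
  exists (v |: Z); first by rewrite subUset sub1set vY.
  rewrite (leq_trans (_ : _ <= b.+1)) ?leq_max ?leqnn //=; last first.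
    by apply: leq_trans (leq_card_setU _ _) _; rewrite cards1.
  apply: leq_trans (leq_trans ltZ vSN); rewrite ltnS; apply: indepS.
  by apply/subsetP => x; rewrite !inE; case: (x == v) => //=.
have EZ Z : v \notin Z ->
    indep ((v |: S) :\: Z) = maxn (indep (S :\: Z)) (indep ((S :\: N) :\: Z)).+1.
  move=> vZ; have -> : (v |: S) :\: Z = v |: (S :\: Z).
    by apply/setP => x; rewrite !inE; case: (eqVneq x v) => [->|]; rewrite ?vZ.
  rewrite indep_vertex ?inE ?(negbTE vS) ?andbF //; congr (maxn _ (indep _).+1).
  by rewrite !setDDl setUC.
have vsub Z : Z \subset Y -> v \notin Z by move=> sZ; apply: contra vY; exact: (subsetP sZ).
rewrite EZ // Ev => lt.
have finish Z : Z \subset Y -> #|Z| <= b + b.-1 ->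
    maxn (indep (S :\: Z)) (indep ((S :\: N) :\: Z)).+1 < maxn (indep S) (indep (S :\: N)).+1 ->
    exists2 Z : {set T}, Z \subset Y & (#|Z| <= maxn b.+1 (b + b.-1)) && (indep ((v |: S) :\: Z) <
      maxn (indep S) (indep (S :\: N)).+1).
  by move=> sZ cZ ltZ; exists Z => //; rewrite EZ ?vsub // ltZ leq_max cZ orbT.
have leS Z : indep (S :\: Z) <= indep S by exact: indepS (subsetDl _ _).
have leN Z : indep ((S :\: N) :\: Z) <= indep (S :\: N) by exact: indepS (subsetDl _ _).
have [lt1|] := boolP (indep S < (indep (S :\: N)).+1).
  have [|Z sZ /andP [cZ ltZ]] := hb (S :\: N) (subsetDl _ _) Y; first by move: lt; lia.
  by apply: (finish Z) => //; [lia | have := leS Z; lia].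
rewrite -leqNgt leq_eqVlt => /orP [/eqP Ea|lt2]; last first.
  have [|Z sZ /andP [cZ ltZ]] := hb S (subxx _) Y; first by move: lt; lia.
  by apply: (finish Z) => //; [lia | have := leN Z; lia].
have [| |Z sZ /and3P [cZ h1 h2]] := @blocked_both b S N Y _ hb (esym Ea) erefl b_gt0.
- by move: lt; lia.
- by move: lt; lia.
- by apply: (finish Z) => //; lia.
Qed.

(** For [b = 2 ^ (d - 1) + 1] the value [2 * b - 1] is exactly the next bound. The alternative
    [b + 1] is larger only for [b = 1], at the start of the recursion, where it gives the required
    2. *)
Lemma beta_step d : maxn (beta d.+1).+1 (beta d.+1 + (beta d.+1).-1) <= beta d.+2.
Proof.
rewrite /beta /= expnS mul2n doubleK; set p := 2 ^ d.
have p_gt0 : 0 < p by rewrite expn_gt0.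
by have := odd_double_half p; lia.
Qed.

(** The root case needs the bound for all subsets of the rest, which the derivation at hand does not
    provide; hence an outer induction on the depth around the one on derivations. *)
Lemma TD_blocked d S : TD d S -> blocked_by (beta d) S.
Proof.
elim: d {-2}d (leqnn d) S => [|n IHn] d led S tdS.
  by move: led tdS; rewrite leqn0 => /eqP -> /TD_set0 -> Y; rewrite indep0.
elim: tdS led => {d S} [d|d A B _ hA _ hB dAB nAB|d v A vA tA _] led.
- by move=> Y; rewrite indep0.
- by apply: blocked_byU => //; [exact: hA | exact: hB].
- case: d led tA => [|d] led tA.
    move=> Y; rewrite (TD_set0 tA) setU0 => lt; exists [set v].
      rewrite sub1set; apply/negPn/negP => vY; move: lt; rewrite (_ : _ :\: _ = [set v]) ?ltnn //.
      by apply/setP => x; rewrite !inE; case: eqP => [->|]; rewrite ?vY ?andbF.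
    by rewrite cards1 setDv indep0; apply: leq_ltn_trans lt.
  apply: blocked_byW (beta_step d) _; apply: blocked_by_vertex => // R sR.
  by apply: IHn; [lia | exact: TD_sub sR].
Qed.
End Graph.

(* [anc] is the ancestor order of a forest and [dp] its depth; unlike a parent
   map, this data restricts to arbitrary vertex sets. *)
Lemma ordered_TD (T : finType) (e anc : rel T) (dp : T -> nat) d (S : {set T}) :
  symmetric e -> {in S, forall v, dp v < d} -> {in S, reflexive anc} ->
  {in S &, forall u v, anc u v -> u = v \/ dp u < dp v} ->
  {in S & S & S, forall v u w, anc u v -> anc v w -> anc u w} ->
  {in S & S & S, forall u v w, anc u w -> anc v w -> anc u v || anc v u} ->
  {in S &, forall u v, e u v -> anc u v || anc v u} -> TD e d S.
Proof.
move=> e_sym; elim: d dp S => [|d IHd] dp S.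
  move=> hd *; suff -> : S = set0 by exact: TD0.
  by apply/setP => v; rewrite inE; apply/negP => /hd.
have [m] := ubnP #|S|; elim: m S => // m IHm S ltS hd hr ha ht hc he.
have [->|[v vS]] := set_0Vmem S; first exact: TD0.
(* A vertex [r] of least depth is a root and [A] is its tree: an ancestor of a vertex of [A] is
   comparable with [r], and by minimality it lies in [A] too. *)
case: (@arg_minnP _ v (fun x => x \in S) dp vS) => r rS rmin.
pose A := [set u in S | anc r u]; pose B := S :\: A.
have AS : A \subset S by apply/subsetP => u; rewrite inE => /andP [].
have BS : B \subset S by exact: subsetDl.
have sAB : S = A :|: B by rewrite -(setID S A) (setIidPr AS).
have rA : r \in A by rewrite inE rS hr.
have nAB : nonadj e A B.
  apply/nonadjP => u w; rewrite !inE => /andP [uS ru] /andP []; rewrite negb_and => /orP [/negbTE ->|rw] // wS.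
  apply/negP => /(he _ _ uS wS) /orP [uw|wu].
    by move/negP: rw; apply; exact: (ht u r w).
  have := hc r w u rS wS uS ru wu; rewrite (negbTE rw) /= => wr.
  have [Ew|lt] := ha w r wS rS wr; first by rewrite Ew hr in rw.
  by have := leq_trans lt (rmin w wS); rewrite ltnn.
rewrite sAB; apply: TDU => //; last by rewrite disjoints_subset; apply/subsetP => u; rewrite !inE => /andP [-> ->].
  rewrite -(setD1K rA); apply: TDv; first by rewrite !inE eqxx.
  have sub u : u \in A :\ r -> [/\ u \in S, anc r u & dp r < dp u].
    rewrite !inE => /and3P [ur uS ru]; split=> //.
    by have [Eu|//] := ha r u rS uS ru; rewrite Eu eqxx in ur.
  apply: (IHd (fun u => (dp u).-1)).
  - by move=> u /sub [uS _ lt]; have := hd u uS; move: lt; clear; lia.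
  - by move=> u /sub [uS _ _]; exact: hr.
  - move=> u w /sub [uS _ ltu] /sub [wS _ ltw] /(ha u w uS wS) [->|lt]; [by left | right].
    by move: ltu lt; clear; lia.
  - by move=> u v' w /sub [uS _ _] /sub [vS' _ _] /sub [wS _ _]; exact: ht.
  - by move=> u v' w /sub [uS _ _] /sub [vS' _ _] /sub [wS _ _]; exact: hc.
  - by move=> u w /sub [uS _ _] /sub [wS _ _]; exact: he.
have sub := subsetP BS; apply: IHm.
- rewrite -ltnS; apply: leq_trans ltS; rewrite ltnS; apply: proper_card.
  by rewrite properE BS; apply/subsetPn; exists r; rewrite // inE rA.
- by move=> u /sub; exact: hd.
- by move=> u /sub; exact: hr.
- by move=> u w /sub uS /sub; exact: ha.
- by move=> u w x /sub uS /sub wS /sub; exact: ht.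
- by move=> u w x /sub uS /sub wS /sub; exact: hc.
- by move=> u w /sub uS /sub; exact: he.
Qed.

Lemma iter_obindN (T : Type) (p : T -> option T) i : iter i (fun o => obind p o) None = None.
Proof. by elim: i => //= i ->. Qed.

Lemma iter_closed (T : finType) (p : T -> option T) (S : {set T}) i u v :
  (forall v u, v \in S -> p v = Some u -> u \in S) -> v \in S ->
  iter i (fun o => obind p o) (Some v) = Some u -> u \in S.
Proof.
move=> cl; elim: i v => [|i IHi] v vS; first by case=> <-.
by rewrite iterSr /=; case E: (p v) => [w|]; [apply: IHi; exact: cl E | rewrite iter_obindN].
Qed.

(** The number [k v] of parent steps until [None] drops by one with each step towards the root; it
    serves as a depth and excludes cycles. *)
Lemma td_le_TD n (E : {ffun 'I_n * 'I_n -> bool}) S d :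
  simple_graph E -> td_le E S d -> TD (fun u v => E (u, v)) d S.
Proof.
move=> [Esym _] [p [cl ht ed]]; set f := fun o => obind p o in ht.
have fN i : iter i f None = None by exact: iter_obindN.
pose k v := find (fun j => iter j f (Some v) == None) (iota 0 d.+1).
have hask v : v \in S -> has (fun j => iter j f (Some v) == None) (iota 0 d.+1).
  by move=> vS; apply/hasP; exists d; rewrite ?mem_iota ?ltnSn //= ht.
have ltk v : v \in S -> k v < d.+1 by move=> /hask; rewrite has_find size_iota.
have atk v : v \in S -> iter (k v) f (Some v) = None.
  by move=> vS; apply/eqP; have := nth_find 0 (hask v vS); rewrite nth_iota ?ltk.
have bfk v j : v \in S -> j < k v -> iter j f (Some v) != None.
  move=> vS ltj; have := before_find 0 ltj; rewrite nth_iota ?add0n => [->//|].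
  exact: ltn_trans ltj (ltk v vS).
have kE i u v : v \in S -> iter i f (Some v) = Some u -> k v = i + k u.
  move=> vS E1; have uS := iter_closed cl vS E1.
  have E2 j : iter j f (Some u) = iter (j + i) f (Some v) by rewrite iterD E1.
  apply/eqP; rewrite eqn_leq; apply/andP; split; rewrite leqNgt; apply/negP => lt.
    by have := bfk v _ vS lt; rewrite addnC -E2 atk.
  have le_i : i <= k v.
    rewrite leqNgt; apply/negP => lti; have := E1; have -> : i = (i - k v) + k v by lia.
    by rewrite iterD atk // fN.
  have := bfk u (k v - i) uS ltac:(lia); rewrite E2 subnK // atk //.
have kgt0 v : v \in S -> 0 < k v.
  by move=> vS; have := atk v vS; case: (k v).
(* Restricting to fewer than [d] steps makes ancestry boolean and, by the height bound, loses
   nothing on [S]. *)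
pose anc u v := [exists i : 'I_d, iter i f (Some v) == Some u].
have ancP u v : v \in S -> reflect (ancestor p u v) (anc u v).
  move=> vS; apply: (iffP existsP) => [[i /eqP Ei]|[i Ei]]; first by exists i.
  suff lt_i : i < d by exists (Ordinal lt_i); apply/eqP.
  have uS := iter_closed cl vS Ei.
  by have := kE _ _ _ vS Ei; have := kgt0 u uS; have := ltk v vS; lia.
apply: (@ordered_TD _ _ anc (fun v => (k v).-1)).
- by move=> u v.
- by move=> v vS; have := kgt0 v vS; have := ltk v vS; lia.
- by move=> v vS; apply/ancP => //; exists 0.
- move=> u v uS vS /(ancP _ _ vS) [[|i] Ei]; first by case: Ei => ->; left.
  by right; have := kE _ _ _ vS Ei; have := kgt0 u uS; lia.
- move=> v u w vS uS wS /(ancP _ _ vS) [i Ei] /(ancP _ _ wS) [j Ej].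
  by apply/ancP => //; exists (i + j); rewrite iterD Ej.
- move=> u v w uS vS wS /(ancP _ _ wS) [i Ei] /(ancP _ _ wS) [j Ej].
  case/orP: (leq_total i j) => le; apply/orP; [right|left]; apply/ancP => //.
    by exists (j - i); rewrite -Ei -iterD subnK.
  by exists (i - j); rewrite -Ej -iterD subnK.
- move=> u v uS vS /(ed u v uS vS) [h|h]; apply/orP; [left|right]; exact/ancP.
Qed.

Lemma TD_td_le n (E : {ffun 'I_n * 'I_n -> bool}) S d :
  simple_graph E -> TD (fun u v => E (u, v)) d S -> td_le E S d.
Proof.
move=> [Esym _].
have agree (p q : 'I_n -> option 'I_n) (A : {set 'I_n}) i v : (forall v u, v \in A -> p v = Some u -> u \in A) ->
    (forall v, v \in A -> q v = p v) -> v \in A ->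
    iter i (fun o => obind q o) (Some v) = iter i (fun o => obind p o) (Some v).
  move=> cl qp; elim: i v => // i IHi v vA; rewrite !iterSr /= qp //.
  by case Ep: (p v) => [u|]; [apply: IHi; exact: cl Ep | rewrite !iter_obindN].
elim=> {S d} [d|d A B _ [p [clp hp ep]] _ [q [clq hq eq]] dAB nAB|d v A vA tA [p [cl ht ed]]].
- by exists (fun _ => None); split=> [v u|v|u v]; rewrite inE.
- pose r v := if v \in A then p v else q v.
  have rA v : v \in A -> r v = p v by rewrite /r => ->.
  have rB v : v \in B -> r v = q v.
    by rewrite /r => vB; rewrite (disjointFl dAB vB).
  have aA i := fun v => @agree p r A i v clp rA.
  have aB i := fun v => @agree q r B i v clq rB.
  exists r; split.
  + move=> v u; rewrite !inE => /orP [vA|vB]; first by rewrite rA // => /(clp v u vA) ->.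
    by rewrite rB // => /(clq v u vB) ->; rewrite orbT.
  + by move=> v; rewrite inE => /orP [vA|vB]; [rewrite aA // hp | rewrite aB // hq].
  + move=> u v; rewrite !inE => /orP [uA|uB] /orP [vA|vB] uv.
    * by case: (ep u v uA vA uv) => -[i Ei]; [left|right]; exists i; rewrite aA.
    * by have /nonadjP h := nAB; have := h u v uA vB; rewrite uv.
    * by have /nonadjP h := nAB; have := h v u vA uB; rewrite Esym uv.
    * by case: (eq u v uB vB uv) => -[i Ei]; [left|right]; exists i; rewrite aB.
(* All former roots of [A] are hung below [v], which lengthens each path by one. *)
- pose r u := if u \in A then (if p u is Some w then Some w else Some v) else None.
  have rv : r v = None by rewrite /r (negbTE vA).
  have rS i u w : u \in A -> iter i (fun o => obind p o) (Some u) = Some w ->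
      iter i (fun o => obind r o) (Some u) = Some w.
    elim: i u => // i IHi u uA; rewrite !iterSr /= /r uA.
    by case Ep: (p u) => [x|]; [apply: IHi; exact: cl Ep | rewrite iter_obindN].
  have hr i u : u \in A -> iter i (fun o => obind p o) (Some u) = None ->
      iter i.+1 (fun o => obind r o) (Some u) = None /\ ancestor r v u.
    elim: i u => // i IHi u uA; rewrite iterSr [iter i.+2 _ _]iterSr /=.
    have : r u = if p u is Some w then Some w else Some v by rewrite /r uA.
    case Ep: (p u) => [x|] Er h; rewrite Er.
      have [h1 [j Ej]] := IHi x (cl _ _ uA Ep) h.
      by split=> //; exists j.+1; rewrite iterSr /= Er.
    by split; [rewrite -[LHS]/(iter i.+1 _ (Some v)) iterSr /= rv iter_obindN | exists 1; rewrite /= Er].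
  exists r; split.
  + move=> u w; rewrite !inE => /orP [/eqP ->|uA]; first by rewrite rv.
    by rewrite /r uA; case Ep: (p u) => [x|] [<-]; rewrite ?eqxx // (cl _ _ uA Ep) orbT.
  + move=> u; rewrite !inE => /orP [/eqP ->|uA].
      by rewrite iterSr /= rv iter_obindN.
    by have [] := hr d u uA (ht u uA).
  + move=> u w; rewrite !inE => /orP [/eqP ->|uA] /orP [/eqP ->|wA] uw.
    * by left; exists 0.
    * by left; have [] := hr d w wA (ht w wA).
    * by right; have [] := hr d u uA (ht u uA).
    * by case: (ed u w uA wA uw) => -[i Ei]; [left|right]; exists i; exact: rS.
Qed.

(** * Correctness of the algorithm *)

Lemma perm_pairwise (T : eqType) (r : rel T) (s t : seq T) :
  symmetric r -> perm_eq s t -> pairwise r s -> pairwise r t.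
Proof.
move=> r_sym; elim: s t => [|x s IHs] t; first by rewrite perm_sym => /perm_nilP ->.
move=> pst; have xt : x \in t by rewrite -(perm_mem pst) mem_head.
move: pst; case/splitPr: xt => t1 t2 pst; rewrite pairwise_cons => /andP [/allP rx ps].
have pst' : perm_eq s (t1 ++ t2).
  by rewrite -(perm_cons x) (perm_trans pst) // -cat1s perm_catCA.
have := IHs _ pst' ps; rewrite !pairwise_cat pairwise_cons => /and3P [r12 -> ->].
rewrite andbT /=; apply/andP; split; last by apply/allP => y yt; apply: rx; rewrite (perm_mem pst') mem_cat yt orbT.
apply/allrelP => y z y1; rewrite inE => /orP [/eqP ->|z2].
  by rewrite r_sym; apply: rx; rewrite (perm_mem pst') mem_cat y1.
by have /allrelP := r12; apply.
Qed.

(** * Vertex lists as sets, and exactness of the recursive procedures *)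

Section ListGraph.
Variables (n : nat) (e : rel nat).
Let g : rel 'I_n := fun u v => e u v.
Hypotheses (g_sym : symmetric g) (g_irr : irreflexive g).

Definition ts (s : seq nat) : {set 'I_n} := [set i | val i \in s].
Definition good (s : seq nat) : bool := uniq s && all (fun x => x < n) s.
Notation alpha s := (indep g (ts s)).

Lemma ts_nil : ts [::] = set0.
Proof. by apply/setP => i; rewrite !inE. Qed.
Lemma ts_cat s t : ts (s ++ t) = ts s :|: ts t.
Proof. by apply/setP => i; rewrite !inE mem_cat. Qed.
Lemma ts_cons (v : 'I_n) s : ts (val v :: s) = v |: ts s.
Proof. by apply/setP => i; rewrite !inE. Qed.
Lemma ts_perm s t : perm_eq s t -> ts s = ts t.
Proof. by move=> st; apply/setP => i; rewrite !inE (perm_mem st). Qed.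
Lemma tsS s t : {subset s <= t} -> ts s \subset ts t.
Proof. by move=> st; apply/subsetP => i; rewrite !inE; exact: st. Qed.
Lemma ts_del (v : 'I_n) s : ts (del v s) = ts s :\ v.
Proof. by apply/setP => i; rewrite !inE mem_filter. Qed.
Lemma ts_disjoint s t : uniq (s ++ t) -> [disjoint ts s & ts t].
Proof.
rewrite cat_uniq => /and3P [_ /hasPn h _]; rewrite disjoints_subset.
by apply/subsetP => i; rewrite !inE => i_s; apply/negP => /h /=; rewrite i_s.
Qed.
Lemma card_ts_le s : #|ts s| <= size s.
Proof.
elim: s => [|v s IH]; first by rewrite ts_nil cards0.
have [lt|le] := ltnP v n.
  by rewrite (ts_cons (Ordinal lt)) cardsU1 /=; case: (_ \notin _); rewrite // (leq_trans IH).
apply: leq_trans (subset_leq_card _) (leqW IH).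
apply/subsetP => i; rewrite !inE => /orP [/eqP Ei|//].
by have := ltn_ord i; move: Ei le => /= ->; rewrite ltnNge => ->.
Qed.
Lemma card_ts s : good s -> #|ts s| = size s.
Proof.
elim: s => [|v s IH]; first by rewrite ts_nil cards0.
move=> /andP /= [/andP [vs us] /andP [lt bs]].
by rewrite (ts_cons (Ordinal lt)) cardsU1 inE /= vs IH // /good us.
Qed.

Lemma goodP s v : good s -> v \in s -> v < n.
Proof. by move=> /andP [_ /allP h]; exact: h. Qed.
Lemma good_sub s t : good s -> uniq t -> {subset t <= s} -> good t.
Proof.
move=> gs ut st; rewrite /good ut; apply/allP => v /st; exact: goodP.
Qed.
Lemma good_filter p s : good s -> good [seq x <- s | p x].
Proof.
move=> gs; apply: (good_sub gs); first by case/andP: gs => us _; rewrite filter_uniq.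
by move=> x; rewrite mem_filter => /andP [].
Qed.
Lemma good_catl s t : good (s ++ t) -> good s.
Proof. by rewrite /good cat_uniq all_cat => /andP [/and3P [-> _ _] /andP [-> _]]. Qed.
Lemma good_catr s t : good (s ++ t) -> good t.
Proof. by rewrite /good cat_uniq all_cat => /andP [/and3P [_ _ ->] /andP [_ ->]]. Qed.
Lemma good_perm s t : perm_eq s t -> good s = good t.
Proof. by move=> st; rewrite /good (perm_uniq st) (perm_all _ st). Qed.

Lemma ts_del_nbrs y s : all (fun x => x < n) y -> ts (del_nbrs e y s) = ts s :\: nbrs g (ts y).
Proof.
move=> /allP by_; apply/setP => i; rewrite !inE mem_filter; congr (~~ _ && _).
apply/hasP/exists_inP => [[x xy eix]|[x]].
  by exists (Ordinal (by_ x xy)); rewrite ?inE.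
by rewrite inE => xy gix; exists (val x).
Qed.

(** Connectivity without paths, in the form that matches the union rule of [TD]. *)
Definition conn (s : seq nat) : Prop := forall A B : {set 'I_n},
  nonadj g A B -> ts s \subset A :|: B -> (ts s \subset A) || (ts s \subset B).

Definition apart (s t : seq nat) : bool := nonadj g (ts s) (ts t).

Lemma apart_sym : symmetric apart.
Proof. by move=> s t; exact: nonadjC. Qed.

Lemma apartP s t : reflect (forall u v : 'I_n, val u \in s -> val v \in t -> ~~ g u v) (apart s t).
Proof.
by apply: (iffP (nonadjP _ _ _)) => h u v; have := h u v; rewrite !inE.
Qed.

Lemma comps_apart s : good s -> pairwise apart (comps e s).
Proof.
elim: s => //= v s IH gvs; have gs : good s := good_catr (s := [:: v]) gvs.
have lt : v < n by apply: goodP gvs _; rewrite mem_head.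
rewrite pairwise_filter ?IH // andbT; apply/allP => c.
rewrite mem_filter => /andP [nvc c_s]; apply/apartP => x y.
rewrite inE => /orP [/eqP Ex yc|/flattenP [c' c'F xc'] yc].
  by apply/negP => gxy; move/hasPn: nvc => /(_ _ yc); rewrite -Ex; apply/negP/negPn.
move: c'F; rewrite mem_filter => /andP [vc' c'_s].
have pw : pairwise apart ([seq c <- comps e s | has (e v) c] ++ [seq c <- comps e s | ~~ has (e v) c]).
  by apply: perm_pairwise (IH gs); [exact: apart_sym | rewrite perm_sym perm_filterC].
move: pw; rewrite pairwise_cat => /and3P [/allrelP h _ _].
by have := h c' c; rewrite !mem_filter vc' nvc c'_s c_s => /(_ isT isT) /apartP; apply.
Qed.

Lemma comps_sub s c : c \in comps e s -> {subset c <= s}.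
Proof.
move=> cs x xc; rewrite -(perm_mem (perm_comps e s)); apply/flattenP; by exists c.
Qed.

Lemma comps_good s c : good s -> c \in comps e s -> good c.
Proof.
move=> gs cs; have: good (flatten (comps e s)) by rewrite (good_perm (perm_comps e s)).
case/splitPr: cs => c1 c2; rewrite flatten_cat => /good_catr /=; exact: good_catl.
Qed.

Lemma comps_neq0 s c : c \in comps e s -> c != [::].
Proof.
elim: s c => //= v s IH c; rewrite inE => /orP [/eqP -> //|].
by rewrite mem_filter => /andP [_ /IH].
Qed.

Lemma comps_conn s c : good s -> c \in comps e s -> conn c.
Proof.
elim: s c => //= v s IH c gvs; have gs : good s := good_catr (s := [:: v]) gvs.
have lt : v < n by apply: goodP gvs _; rewrite mem_head.
rewrite inE => /orP [/eqP -> A B nAB|]; last by rewrite mem_filter => /andP [_ /(IH _ gs)].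
pose w := Ordinal lt; rewrite -[v]/(val w) ts_cons.
wlog wA : A B nAB / w \in A.
  move=> wl sub; have := subsetP sub w; rewrite setU11 inE => /(_ isT) /orP [wA|wB]; first exact: wl.
  by rewrite orbC; apply: wl => //; [rewrite (nonadjC g_sym) | rewrite [B :|: A]setUC].
rewrite !subUset => /andP [_ sub]; rewrite sub1set wA /= orbC.
apply/orP; right; apply/subsetP => x; rewrite inE => /flattenP [c'].
rewrite mem_filter => /andP [vc' c's] xc'.
have subc : ts c' \subset A :|: B.
  apply: subset_trans sub; apply: tsS => y yc'; apply/flattenP; exists c' => //.
  by rewrite mem_filter vc'.
case/orP: (IH _ gs c's A B nAB subc) => [/subsetP|/subsetP sB]; first by apply; rewrite inE.
case/hasP: vc' => y yc' vy.
have lty : y < n by apply: goodP gs _; exact: comps_sub yc'.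
have yB : Ordinal lty \in B by apply: sB; rewrite inE.
by have /nonadjP/(_ w (Ordinal lty) wA yB) := nAB; rewrite /g /= vy.
Qed.

(** [S] may exceed [c] because the induction follows [c] into one side of each union. If the root
    met there is not in [c], any vertex of [c] will do. *)
Lemma TD_conn d (S : {set 'I_n}) c : TD g d S -> ts c \subset S -> c != [::] -> good c -> conn c ->
  exists d', d = d'.+1 /\ exists2 r : 'I_n, val r \in c & TD g d' (ts c :\ r).
Proof.
move=> td; elim: td c => {d S} [d|d A B _ hA _ hB dAB nAB|d v A vA tA _] c.
- case: c => // x c; rewrite subset0 => /eqP E _ gc _; have lt : x < n by apply: goodP gc (mem_head _ _).
  have : Ordinal lt \in ts (x :: c) by rewrite inE mem_head.
  by rewrite E inE.
- move=> sub c0 gc cc; case/orP: (cc A B nAB sub) => sub'; [exact: hA | exact: hB].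
- move=> sub c0 gc cc; exists d; split=> //.
  have [vc|vc] := boolP (val v \in c).
    by exists v => //; apply: TD_sub tA _; rewrite subDset.
  case: c c0 sub gc {cc} vc => // x c _ sub gc vc; have lt : x < n by apply: goodP gc (mem_head _ _).
  exists (Ordinal lt); first exact: mem_head.
  apply: TD_sub tA _; apply: subset_trans (subsetDl _ _) _; apply/subsetP => u uc.
  have := subsetP sub u uc; rewrite !inE => /orP [/eqP Eu|//].
  by move: uc; rewrite inE Eu (negbTE vc).
Qed.

Lemma indep_flatten cs (Z : {set 'I_n}) : uniq (flatten cs) -> pairwise apart cs ->
  indep g (ts (flatten cs) :\: Z) = sumn [seq indep g (ts c :\: Z) | c <- cs].
Proof.
elim: cs => [|c cs IH] /=; first by rewrite ts_nil set0D indep0.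
move=> us /andP [/allP ac pw]; have := us; rewrite cat_uniq => /and3P [_ _ us'].
rewrite ts_cat setDUl indepU ?IH //.
  by apply: disjointWl (subsetDl _ _) (disjointWr (subsetDl _ _) (ts_disjoint us)).
apply/nonadjP => u v; rewrite !inE => /andP [_ uc] /andP [_ /flattenP [c' c'_cs vc']].
by have /apartP := ac c' c'_cs; apply.
Qed.

Lemma TD_flatten d cs : uniq (flatten cs) -> pairwise apart cs ->
  (forall c, c \in cs -> TD g d (ts c)) -> TD g d (ts (flatten cs)).
Proof.
elim: cs => [|c cs IH] /=; first by rewrite ts_nil => *; exact: TD0.
move=> us /andP [/allP ac pw] h; have := us; rewrite cat_uniq => /and3P [_ _ us'].
rewrite ts_cat; apply: TDU.
- by apply: h; rewrite mem_head.
- by apply: IH => // c' c'_cs; apply: h; rewrite inE c'_cs orbT.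
- exact: ts_disjoint.
apply/nonadjP => u v; rewrite !inE => uc /flattenP [c' c'_cs vc'].
by have /apartP := ac c' c'_cs; apply.
Qed.

Lemma flatten_comps_uniq s : good s -> uniq (flatten (comps e s)).
Proof. by move=> /andP [us _]; rewrite (perm_uniq (perm_comps e s)). Qed.

Lemma alpha_comps s : good s -> alpha s = sumn [seq alpha c | c <- comps e s].
Proof.
move=> gs; have := indep_flatten set0 (flatten_comps_uniq gs) (comps_apart gs).
by rewrite setD0 (ts_perm (perm_comps e s)) => ->; congr sumn; apply: eq_map => c; rewrite setD0.
Qed.

Lemma foldr_maxn_ge x l : x \in l -> x <= foldr maxn 0 l.
Proof.
elim: l => //= y l IH; rewrite inE => /orP [/eqP ->|/IH le]; first exact: leq_maxl.
exact: leq_trans le (leq_maxr _ _).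
Qed.
Lemma foldr_maxn_le b l : (forall x, x \in l -> x <= b) -> foldr maxn 0 l <= b.
Proof.
elim: l => //= y l IH h; rewrite geq_max h ?mem_head //=; apply: IH => x xl.
by apply: h; rewrite inE xl orbT.
Qed.

Lemma alpha_branch (v : 'I_n) c : val v \in c -> good c ->
  alpha c = maxn (alpha (del v c)) (alpha (del_nbrs e [:: val v] (del v c))).+1.
Proof.
move=> vc gc; rewrite ts_del_nbrs /= ?ltn_ord // ts_cons ts_nil setU0 ts_del.
by rewrite -indep_vertex ?inE ?eqxx // setD1K // inE.
Qed.

Lemma good_del v s : good s -> good (del v s). Proof. exact: good_filter. Qed.
Lemma good_del_nbrs y s : good s -> good (del_nbrs e y s). Proof. exact: good_filter. Qed.

(** The unconditional inequality is needed inside the induction: the maximum also runs over bad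
    roots, whose recursive values may be inexact but must not overshoot. *)
Lemma alpha_algP d s : good s ->
  alpha_alg e d s <= alpha s /\ (TD g d (ts s) -> alpha_alg e d s = alpha s).
Proof.
elim: d s => [|d IHd] s gs /=.
  by split=> // /TD_set0 ->; rewrite indep0.
rewrite alpha_comps //; set F := fun c => foldr maxn 0 _.
have leF c : c \in comps e s -> F c <= alpha c.
  move=> cs; have gc := comps_good gs cs; apply: foldr_maxn_le => x /mapP [v vc ->].
  have lt : v < n := goodP gc vc; rewrite -[v]/(val (Ordinal lt)).
  rewrite (alpha_branch (v := Ordinal lt) vc gc) geq_max !leq_max ltnS.
  by rewrite (proj1 (IHd _ (good_del _ gc))) (proj1 (IHd _ (good_del_nbrs _ (good_del _ gc)))) orbT.
split; first by elim: (comps e s) leF => //= c cs IH h; rewrite leq_add ?h ?mem_head //= IH // => c' c'c; apply: h; rewrite inE c'c orbT.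
move=> td; congr sumn; apply/eq_in_map => c cs; apply/eqP; rewrite eqn_leq leF //=.
have gc := comps_good gs cs.
have [|_ [[<-] [r rc tdr]]] := TD_conn td _ (comps_neq0 cs) gc (comps_conn gs cs).
  by apply: tsS; exact: comps_sub.
rewrite (alpha_branch rc gc); apply: leq_trans (foldr_maxn_ge (map_f _ rc)).
rewrite (proj2 (IHd _ (good_del _ gc))) ?ts_del //.
rewrite (proj2 (IHd _ (good_del_nbrs _ (good_del _ gc)))) // ts_del_nbrs /= ?ltn_ord //.
by rewrite ts_del; apply: TD_sub tdr (subsetDl _ _).
Qed.

Lemma alpha_algE d s : good s -> TD g d (ts s) -> alpha_alg e d s = alpha s.
Proof. by move=> /(alpha_algP d) []. Qed.

Lemma td_algP d s : good s -> td_alg e d s <-> TD g d (ts s).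
Proof.
elim: d s => [|d IHd] s gs /=.
  split; first by rewrite leqn0 => /nilP ->; rewrite ts_nil; exact: TD0.
  by move=> /TD_set0 E; rewrite -card_ts // E cards0.
split=> [/allP h|td].
  rewrite -(ts_perm (perm_comps e s)); apply: TD_flatten => [||c cs].
  - exact: flatten_comps_uniq.
  - exact: comps_apart.
  have gc := comps_good gs cs; have /hasP [v vc] := h c cs.
  have lt : v < n := goodP gc vc; rewrite -[v]/(val (Ordinal lt)) => /(IHd _ (good_del _ gc)).
  rewrite ts_del => tdv; rewrite -(setD1K (_ : Ordinal lt \in ts c)) ?inE //.
  by apply: TDv; rewrite // !inE eqxx.
apply/allP => c cs; have gc := comps_good gs cs.
have [|_ [[<-] [r rc tdr]]] := TD_conn td _ (comps_neq0 cs) gc (comps_conn gs cs).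
  by apply: tsS; exact: comps_sub.
by apply/hasP; exists (val r) => //; apply/(IHd _ (good_del _ gc)); rewrite ts_del.
Qed.

Lemma root_algP d c : TD g d.+1 (ts c) -> c != [::] -> good c -> conn c ->
  root_alg e d c \in c /\ TD g d (ts (del (root_alg e d c) c)).
Proof.
move=> td c0 gc cc; have [_ [[<-] [r rc tdr]]] := TD_conn td (subxx _) c0 gc cc.
have : val r \in [seq v <- c | td_alg e d (del v c)].
  by rewrite mem_filter rc andbT; apply/(td_algP _ (good_del _ gc)); rewrite ts_del.
rewrite /root_alg; case E : [seq v <- c | _] => [//|x l] _ /=.
have : x \in [seq v <- c | td_alg e d (del v c)] by rewrite E mem_head.
by rewrite mem_filter => /andP [/(td_algP _ (good_del _ gc))].
Qed.

Lemma conflictP d y c : good c -> all (fun x => x < n) y -> TD g d (ts c) ->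
  conflict e d y c = (indep g (ts c :\: nbrs g (ts y)) < alpha c).
Proof.
move=> gc by_ td; rewrite /conflict !alpha_algE ?ts_del_nbrs //; first exact: good_del_nbrs.
exact: TD_sub td (subsetDl _ _).
Qed.

(** * Correctness of one level *)

Notation heads W := [seq head 0 w | w <- W].
Notation fl its := (flatten [seq i.2 | i <- its]).

(** Among all chosen roots a component sees only those on its own path ([li_nbr]), and every upper
    end of that path is recorded ([li_path]); this is why a deepest root determines where the other
    roots of a chunk can be. [li_indep] always refers to the whole input graph, so levels chain. *)
Record level_inv (d lv : nat) (X : seq nat) (st : seq (seq nat) * (seq item * nat)) : Prop := LevelInv {
  li_good : good (X ++ heads st.1 ++ fl st.2.1);
  li_td : forall i : item, i \in st.2.1 -> TD g lv (ts i.2);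
  li_conn : forall i : item, i \in st.2.1 -> conn i.2;
  li_neq0 : forall i : item, i \in st.2.1 -> i.2 != [::];
  li_apart : pairwise apart [seq i.2 | i <- st.2.1];
  li_nbr : forall (i : item) u v, i \in st.2.1 -> u \in heads st.1 -> v \in i.2 -> e v u -> u \in i.1;
  li_path : forall (i : item) p1 r p2, i \in st.2.1 -> i.1 = p1 ++ r :: p2 -> r :: p2 \in st.1;
  li_size : forall i : item, i \in st.2.1 -> size i.1 + lv <= d;
  li_wsize : forall w : seq nat, w \in st.1 -> size w <= d;
  li_indep : indep g setT = alpha (X ++ heads st.1 ++ fl st.2.1) + st.2.2 }.

Definition lset (S : {set 'I_n}) : seq nat := [seq val x | x <- enum S].

Lemma lsetP (S : {set 'I_n}) x : reflect (exists2 u : 'I_n, u \in S & val u = x) (x \in lset S).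
Proof.
apply: (iffP mapP) => [[u uS ->]|[u uS <-]]; exists u => //.
  by rewrite mem_enum in uS.
by rewrite mem_enum.
Qed.
Lemma mem_lset (S : {set 'I_n}) (u : 'I_n) : (val u \in lset S) = (u \in S).
Proof. by apply/lsetP/idP => [[v vS /val_inj <-]|uS]; [|exists u]. Qed.
Lemma lset_lt (S : {set 'I_n}) x : x \in lset S -> x < n.
Proof. by case/lsetP => u _ <-; exact: ltn_ord. Qed.
Lemma ts_sub_lset y (S : {set 'I_n}) : all (fun x => x \in lset S) y -> ts y \subset S.
Proof. by move=> /allP h; apply/subsetP => u; rewrite inE => /h; rewrite mem_lset. Qed.

Lemma mem_words b X y : size y <= b -> {subset y <= X} -> y \in words b X.
Proof.
elim: b y => [|b IH] [|v y] //= lt sub; rewrite inE /=; apply/flattenP.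
exists [seq v :: z | z <- words b X]; first by apply: map_f; apply: sub; rewrite mem_head.
by apply: map_f; apply: IH => // x xy; apply: sub; rewrite inE xy orbT.
Qed.

Lemma mem_chunks_head d b X W r p a y : r :: p \in W -> a \in words d p -> y \in words b.-1 X ->
  r :: a ++ y \in chunks d b X W.
Proof.
move=> rW aw yw; rewrite mem_cat; apply/orP; right; apply/flattenP.
eexists; first exact: map_f rW.
apply/flattenP; eexists; first by apply: map_f; exact: aw.
exact: map_f yw.
Qed.

Lemma mem_heads W r p : r :: p \in W -> r \in heads W.
Proof. by move=> /(map_f (head 0)). Qed.

(** The neighbours of [S] contain a small blocking set of the component; one neighbour in [S] for
    each of its vertices in the component already conflicts, and these neighbours lie in [X] or on
    the path of the item. *)
Lemma chunk_cover d lv X st (i : item) (S : {set 'I_n}) :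
  level_inv d lv.+1 X st -> i \in st.2.1 -> S \subset ts (X ++ heads st.1) ->
  indep g (ts i.2 :\: nbrs g S) < alpha i.2 ->
  exists y, [/\ y \in chunks d (beta lv.+1) X st.1, all (fun x => x \in lset S) y &
    conflict e lv.+1 y i.2].
Proof.
move=> li i_st sS lt; set b := beta lv.+1.
have gi : good i.2.
  have := good_catr (good_catr (li_good li)); case/splitPr: i_st => l1 l2.
  by rewrite map_cat flatten_cat => /good_catr /=; exact: good_catl.
have tdi := li_td li i_st.
have [Z sZ /andP [cZ ltZ]] := TD_blocked g_sym g_irr tdi lt.
pose Z' := Z :&: ts i.2.
have EZ : ts i.2 :\: Z' = ts i.2 :\: Z by rewrite setDIr setDv setU0.
have adjP z : z \in Z' -> exists2 y, y \in S & g z y.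
  by rewrite inE => /andP [/(subsetP sZ)]; rewrite inE => /exists_inP.
pose f z := odflt z [pick y in S | g z y].
have fP z : z \in Z' -> f z \in S /\ g z (f z).
  move=> /adjP [y yS zy]; rewrite /f; case: pickP => [y' /andP [] //|/(_ y)].
  by rewrite /= yS zy.
pose L := lset (f @: Z').
have sL x : x \in L -> x \in lset S.
  by case/lsetP => _ /imsetP [z zZ ->] <-; rewrite mem_lset; case: (fP z zZ).
have LX x : x \in L -> (x \in X) || (x \in i.1).
  move=> xL; case/lsetP: (xL) => _ /imsetP [z zZ ->] Ex.
  have [fS zf] := fP z zZ; have := subsetP sS _ fS; rewrite inE mem_cat Ex => /orP [->//|xW].
  apply/orP; right; apply: (li_nbr li i_st xW (v := val z)); last by rewrite -Ex.
  by move: zZ; rewrite !inE => /andP [].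
have cL : size L <= b.
  rewrite size_map -cardE; apply: leq_trans (leq_imset_card _ _) (leq_trans _ cZ).
  by apply: subset_leq_card; exact: subsetIl.
have finish y : {subset y <= L} -> {subset L <= y} ->
    all (fun x => x \in lset S) y /\ conflict e lv.+1 y i.2.
  move=> sy sy'; have by_ : all (fun x => x \in lset S) y by apply/allP => x /sy /sL.
  split=> //; rewrite conflictP //; last by apply: sub_all by_ => x; exact: lset_lt.
  apply: leq_ltn_trans ltZ; apply: indepS; rewrite -EZ; apply: setDS.
  apply/subsetP => z zZ; rewrite in_nbrs; apply/exists_inP; exists (f z); last by case: (fP z zZ).
  by rewrite inE; apply: sy'; rewrite mem_lset; exact: imset_f.
have [hp|nhp] := boolP (has (mem L) i.1); last first.
  have sLX : {subset L <= X}.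
    by move=> x xL; case/orP: (LX x xL) => // xi; case/hasP: nhp; exists x.
  have [h1 h2] := finish L (fun _ => id) (fun _ => id); exists L; split=> //.
  by rewrite mem_cat mem_words.
(* Paths list the deepest root first, so [r] is the deepest root in [L] and the other roots of [L]
   lie in [p2]. *)
have [r [p1 [p2 [rL nL Ei]]]] : exists r p1 p2, [/\ r \in L, ~~ has (mem L) p1 & i.1 = p1 ++ r :: p2].
  by case/split_find: hp => r p1 p2 rL nL; exists r, p1, p2; rewrite cat_rcons.
have rW := li_path li i_st Ei.
have rX : r \notin X.
  have /andP [] := li_good li; rewrite cat_uniq => /and3P [_ /hasPn h _] _.
  by apply: (h r); rewrite mem_cat (mem_heads rW).
pose A := [seq v <- p2 | v \in L]; pose B := [seq v <- L | v \in X].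
have [h1 h2] : all (fun x => x \in lset S) (r :: A ++ B) /\ conflict e lv.+1 (r :: A ++ B) i.2.
  apply: finish => x.
    by rewrite inE mem_cat !mem_filter => /or3P [/eqP ->|/andP []|/andP []].
  move=> xL; rewrite inE mem_cat !mem_filter xL /= andbT.
  case/orP: (LX x xL) => [->|]; first by rewrite !orbT.
  rewrite Ei mem_cat inE => /or3P [x1|->//|->]; last by rewrite orbT.
  by case/hasP: nL; exists x.
exists (r :: A ++ B); split=> //; apply: mem_chunks_head rW _ _; apply: mem_words.
- rewrite size_filter (leq_trans (count_size _ _)) //; have := li_size li i_st.
  by rewrite Ei size_cat /=; clear; lia.
- by move=> x; rewrite mem_filter => /andP [].
(* [r] is outside [X] and takes one of the [b] places: this saving decides the final exponent. *)
- rewrite -ltnS prednK //; apply: leq_trans cL; rewrite size_filter -(count_predC (mem X) L).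
  by rewrite -[X in X < _]addn0 ltn_add2l -has_count; apply/hasP; exists r.
- by move=> x; rewrite mem_filter => /andP [].
Qed.

(** A chunk contained in [S] costs its single owner at least one, and other owners never gain by the
    deletion of neighbours. *)
Lemma owner_gain ss (S : {set 'I_n}) :
  (forall s : slot, s \in ss -> size s.2.2 = 1) ->
  (forall (s : slot) (i : item), s \in ss -> i \in s.2.2 -> all (fun x => x \in lset S) s.1 ->
     indep g (ts i.2 :\: nbrs g S) < alpha i.2) ->
  sumn [seq indep g (ts i.2 :\: nbrs g S) | i <- owners ss] +
    size [seq s <- ss | all (fun x => x \in lset S) s.1] <= sumn [seq alpha i.2 | i <- owners ss].
Proof.
elim: ss => // s ss IH h1 h2; rewrite /owners /= !map_cat !sumn_cat.
have {}IH := IH (fun x xs => h1 x (mem_behead (s := s :: ss) xs))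
                (fun x i xs => h2 x i (mem_behead (s := s :: ss) xs)).
have := h1 s (mem_head _ _); have := h2 s _ (mem_head _ _).
case: (s.2.2) => [|i []] // /(_ i (mem_head _ _)) hs _ /=; rewrite !addn0.
have le : indep g (ts i.2 :\: nbrs g S) <= alpha i.2 by exact: indepS (subsetDl _ _).
case: ifP hs => [_ /(_ isT) lt|_ _] /=.
  by rewrite addnS -!addSn -addnA; exact: leq_add lt IH.
by rewrite -addnA; exact: leq_add le IH.
Qed.

(* Among the [B] price levels below [B] one is not the price of any of the fewer
   than [B] chunks; the owners of the chunks priced above it, together with the
   dropped items, conflict only with such chunks. *)
Lemma crown d lv X st ss D :
  let ys := chunks d (beta lv.+1) X st.1 in
  level_inv d lv.+1 X st ->
  auction_inv e lv.+1 (size ys).+2 st.2.1 ys ([::], (ss, D)) ->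
  alpha (X ++ heads st.1 ++ fl st.2.1) =
    alpha (X ++ heads st.1 ++ fl (owners ss)) + sumn [seq alpha i.2 | i <- D].
Proof.
move=> ys li [/= pm Ey le ow cf ch dr].
have [gp lt_gp gpP] : exists2 gp, gp < (size ys).+2 & forall s : slot, s \in ss -> s.2.1 != gp.
  have [/allP h|] := boolP (all (mem [seq s.2.1 | s <- ss]) (iota 0 (size ys).+2)).
    have := uniq_leq_size (iota_uniq _ _) h.
    have -> : size [seq s.2.1 | s <- ss] = size ys by rewrite -Ey !size_map.
    by rewrite size_iota ltnNge leqnSn.
  case/allPn => gp; rewrite mem_iota => /andP [_ lt] gpN; exists gp => // s s_ss.
  by apply: contraNneq gpN => <-; exact: map_f.
pose Yh := [seq s <- ss | gp < s.2.1]; pose Yl := [seq s <- ss | ~~ (gp < s.2.1)].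
have pO : perm_eq (owners ss) (owners Yh ++ owners Yl).
  rewrite /owners -flatten_cat -map_cat; apply: perm_flatten; apply: perm_map.
  by rewrite perm_sym perm_filterC.
have pI : perm_eq st.2.1 (owners Yl ++ owners Yh ++ D).
  rewrite perm_sym; apply: perm_trans pm; rewrite catA perm_cat2r perm_sym.
  by apply: perm_trans pO _; rewrite perm_catC.
pose H0 := X ++ heads st.1; pose P := ts H0.
have pL : perm_eq (X ++ heads st.1 ++ fl st.2.1) (H0 ++ fl (owners Yl) ++ fl (owners Yh ++ D)).
  rewrite catA perm_cat2l -flatten_cat -map_cat; apply: perm_flatten; exact: perm_map.
have pL' : perm_eq (X ++ heads st.1 ++ fl (owners ss)) (H0 ++ fl (owners Yl) ++ fl (owners Yh)).
  rewrite catA perm_cat2l -flatten_cat -map_cat; apply: perm_flatten; apply: perm_map.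
  by apply: perm_trans pO _; rewrite perm_catC.
have gL : good (H0 ++ fl (owners Yl) ++ fl (owners Yh ++ D)) by rewrite -(good_perm pL) (li_good li).
have pw : pairwise apart ([seq i.2 | i <- owners Yl] ++ [seq i.2 | i <- owners Yh ++ D]).
  rewrite -map_cat; apply: perm_pairwise (li_apart li); first exact: apart_sym.
  exact: perm_map.
have := pw; rewrite pairwise_cat => /and3P [/allrelP apLM _ pwM].
have pwO : pairwise apart [seq i.2 | i <- owners Yh].
  by move: pwM; rewrite map_cat pairwise_cat => /and3P [].
have pwD : pairwise apart [seq i.2 | i <- D].
  by move: pwM; rewrite map_cat pairwise_cat => /and3P [].
have uM : uniq (fl (owners Yh ++ D)) by have /andP [] := good_catr (good_catr gL).
have uO : uniq (fl (owners Yh)).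
  by move: uM; rewrite map_cat flatten_cat cat_uniq => /and3P [].
have uD : uniq (fl D) by move: uM; rewrite map_cat flatten_cat cat_uniq => /and3P [].
rewrite (ts_perm pL) (ts_perm pL'); apply/eqP; rewrite eqn_leq; apply/andP; split.
  rewrite map_cat flatten_cat !catA (ts_cat _ (fl D)).
  apply: leq_trans (indep_leU _ _ _) _; rewrite leq_add2l.
  have := indep_flatten set0 uD pwD; rewrite setD0 => ->; rewrite -map_comp.
  by apply: eq_leq; congr sumn; apply: eq_map => i /=; rewrite setD0.
(* An optimal [I] without the dropped items is modified: the chunks above the gap that lie inside it
   ([YS]) give up their first vertices [H], and all components in [M] are refilled optimally. *)
have [I [sI nI <-]] := indepP g (ts (H0 ++ fl (owners Yl) ++ fl (owners Yh))).
pose S := I :&: P; pose U0 := ts (fl (owners Yl)); pose O := ts (fl (owners Yh)).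
pose YS := [seq s <- Yh | all (fun x => x \in lset S) s.1].
pose H := ts [seq head 0 s.1 | s <- YS]; pose S' := S :\: H.
pose M := ts (fl (owners Yh ++ D)).
have in_items i : i \in owners Yh ++ D -> i \in st.2.1.
  by move=> iC; rewrite (perm_mem pI) mem_cat iC orbT.
(* An owner above the gap has a price of at least [gp + 1], so by [inv_cheap] its conflicting chunks
   cost at least [gp], and no chunk costs exactly [gp]. *)
have chunk_in_Yh i s : i \in owners Yh ++ D -> s \in ss -> conflict e lv.+1 s.1 i.2 -> s \in Yh.
  rewrite mem_filter => iC s_ss c; rewrite s_ss andbT ltn_neqAle eq_sym gpP //=.
  move: iC; rewrite mem_cat => /orP [/flattenP [o /mapP [s']]|iD].
    rewrite mem_filter => /andP [lt s'_ss] -> i_s'.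
    by have := ch _ _ _ s'_ss i_s' s_ss c; move: lt; clear; lia.
  by apply: leq_trans (dr _ _ iD s_ss c); exact: ltnW.
(* A conflict with [S'] would come from a chunk inside [S']. That chunk is above the gap, hence in
   [YS], and its first vertex has been removed from [S']. *)
have conf0 i : i \in owners Yh ++ D -> indep g (ts i.2 :\: nbrs g S') = alpha i.2.
  move=> iC; apply/eqP; rewrite eqn_leq indepS ?subsetDl //= leqNgt; apply/negP => lt.
  have sS' : S' \subset ts (X ++ heads st.1).
    by apply: subset_trans (subsetDl _ _) (subsetIr _ _).
  have [y [y_ys y_S' c]] := chunk_cover li (in_items i iC) sS' lt.
  have : y \in map fst ss by rewrite Ey.
  case/mapP => s s_ss Ess; rewrite {}Ess in y_S' c.
  have sYh := chunk_in_Yh i s iC s_ss c.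
  have sYS : s \in YS.
    rewrite mem_filter sYh andbT; apply: sub_all y_S' => x /lsetP [u uS' <-].
    by rewrite mem_lset; move: uS'; rewrite inE => /andP [].
  (* The empty chunk has no first vertex, but it conflicts with nothing. *)
  case Ess : s.1 y_S' c => [|v y'] /=.
    by rewrite /conflict /del_nbrs /= (eq_filter (a2 := predT)) ?filter_predT ?ltnn.
  move=> /andP [/lsetP [u]]; rewrite inE => /andP [uH _] Eu _ _; case/negP: uH.
  by rewrite inE Eu; apply/mapP; exists s; rewrite // Ess.
have [J [sJ nJ cJ]] := indepP g (M :\: nbrs g S').
have EJ : #|J| = sumn [seq alpha i.2 | i <- owners Yh] + sumn [seq alpha i.2 | i <- D].
  rewrite cJ indep_flatten // -map_comp -sumn_cat -map_cat; congr sumn.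
  by apply/eq_in_map => i /conf0.
pose K := I :&: (P :|: U0).
have cK : #|I| <= #|K| + #|I :&: O|.
  rewrite -{1}(setIidPl sI) (ts_cat H0) (ts_cat (fl (owners Yl))) setUA setIUr.
  exact: leq_card_setU.
(* Inside the owners [I] avoids the neighbours of [S], and by [owner_gain] this costs at least one
   for each chunk of [YS]. *)
have cIO : #|I :&: O| + size YS <= sumn [seq alpha i.2 | i <- owners Yh].
  apply: leq_trans (owner_gain (S := S) _ _); first last.
  - move=> s i; rewrite mem_filter => /andP [lt s_ss] i_s sub.
    have := cf _ _ s_ss i_s; rewrite conflictP //.
    + apply: leq_trans; rewrite ltnS; apply: indepS; apply: setDS; apply: nbrsS.
      exact: ts_sub_lset.
    + have := good_catr (good_catr (li_good li)).
      have i_st : i \in st.2.1.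
        apply: in_items; rewrite mem_cat; apply/orP; left; apply/flattenP; exists s.2.2 => //.
        by apply: map_f; rewrite mem_filter lt.
      case/splitPr: i_st => l1 l2.
      by rewrite map_cat flatten_cat => /good_catr /=; exact: good_catl.
    + by apply: sub_all sub => x; exact: lset_lt.
    + apply: (li_td li); apply: in_items; rewrite mem_cat; apply/orP; left.
      by apply/flattenP; exists s.2.2 => //; apply: map_f; rewrite mem_filter lt.
  - by move=> s; rewrite mem_filter => /andP [lt /ow ->]; rewrite (leq_trans _ lt).
  rewrite leq_add2r; have := indep_flatten (nbrs g S) uO pwO.
  rewrite -map_comp => <-; apply: indep_ge; last by apply: nonadjS nI; exact: subsetIl.
  apply/subsetP => u; rewrite inE => /andP [uI uO']; rewrite inE uO' andbT in_nbrs.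
  apply/exists_inP => -[w]; rewrite inE => /andP [wI _]; apply/negP.
  by have /nonadjP := nI; apply.
have cKH : #|K| <= #|K :\: H| + size YS.
  rewrite -(cardsID H K) addnC leq_add2l; apply: leq_trans (subset_leq_card (subsetIr _ _)) _.
  by apply: leq_trans (card_ts_le _) _; rewrite size_map.
have dKJ : [disjoint K :\: H & J].
  apply: disjointWl (_ : _ \subset ts (H0 ++ fl (owners Yl))) _.
    by rewrite ts_cat; apply: subset_trans (subsetDl _ _) (subsetIr _ _).
  apply: disjointWr (subset_trans sJ (subsetDl _ _)) _; apply: ts_disjoint.
  by rewrite -catA; case/andP: gL.
have nKJ : nonadj g (K :\: H) J.
  apply/nonadjP => u w; rewrite !inE => /andP [uH /andP [uI /orP [uP|uU]]] wJ.
    have := subsetP sJ w wJ; rewrite inE in_nbrs => /andP [/exists_inP h _].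
    apply/negP => guw; apply: h; exists u; last by rewrite g_sym.
    by rewrite !inE uH uI uP.
  have := subsetP sJ w wJ; rewrite !inE => /andP [_ wM].
  case/flattenP: uU => c1 c1Y uc1; case/flattenP: wM => c2 c2M wc2.
  by have /apartP := apLM _ _ c1Y c2M; apply.
(* The at most [size YS] vertices lost with [H] are regained in the owners, and the dropped items
   come on top. *)
rewrite (_ : _ + _ <= _) //; apply: (@leq_trans #|(K :\: H) :|: J|).
  have -> : #|(K :\: H) :|: J| = #|K :\: H| + #|J|.
    by rewrite cardsU (_ : _ :&: _ = set0) ?cards0 ?subn0 //; apply/eqP; rewrite setI_eq0.
  by rewrite EJ; move: cK cIO cKH; clear; lia.
apply: indep_ge.
  rewrite (ts_cat H0) (ts_cat (fl (owners Yl))) setUA; apply: setUSS; last exact: subset_trans sJ (subsetDl _ _).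
  exact: subset_trans (subsetDl _ _) (subsetIr _ _).
rewrite nonadjUl !(nonadjUr g_sym) nJ nKJ (nonadjC g_sym) nKJ !andbT.
by apply: nonadjS nI; apply: subset_trans (subsetDl _ _) (subsetIl _ _).
Qed.

Lemma pairwise_map_mem (A B : eqType) (r : rel B) (f : A -> B) (l : seq A) i j :
  symmetric r -> pairwise r (map f l) -> i \in l -> j \in l -> i != j -> r (f i) (f j).
Proof.
move=> r_sym; elim: l => //= x l IH /andP [/allP h pw].
rewrite !inE => /orP [/eqP ->|il] /orP [/eqP ->|jl]; rewrite ?eqxx // => ij.
- by apply: h; exact: map_f.
- by rewrite r_sym; apply: h; exact: map_f.
- exact: IH.
Qed.

Lemma split_itemP d (l : seq item) (c : item) :
  reflect (exists2 i : item, i \in l & exists2 c', c' \in comps e (del (root_alg e d i.2) i.2) &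
             c = (root_alg e d i.2 :: i.1, c'))
    (c \in flatten [seq split_item e d i | i <- l]).
Proof.
apply: (iffP flattenP) => [[s /mapP [i il ->] /mapP [c' c'i ->]]|[i il [c' c'i ->]]].
  by exists i => //; exists c'.
by exists (split_item e d i); apply: map_f.
Qed.

Lemma split_item_snd d i : [seq c.2 | c <- split_item e d i] = comps e (del (root_alg e d i.2) i.2).
Proof. by rewrite -map_comp map_id. Qed.

Lemma perm_del v s : uniq s -> v \in s -> perm_eq (v :: del v s) s.
Proof. by move=> us vs; rewrite /del -rem_filter // perm_sym perm_to_rem. Qed.

Lemma perm_split d (l : seq item) :
  (forall i : item, i \in l -> uniq i.2 /\ root_alg e d i.2 \in i.2) ->
  perm_eq ([seq root_alg e d i.2 | i <- l] ++ fl (flatten [seq split_item e d i | i <- l])) (fl l).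
Proof.
elim: l => //= i l IH h; have [ui ri] := h i (mem_head _ _).
rewrite map_cat flatten_cat split_item_snd.
apply: (@perm_trans _ ((root_alg e d i.2 :: flatten (comps e (del (root_alg e d i.2) i.2))) ++
  ([seq root_alg e d j.2 | j <- l] ++ fl (flatten [seq split_item e d j | j <- l])))).
  by rewrite /= perm_cons perm_catCA.
apply: perm_cat; last by apply: IH => j jl; apply: h; rewrite inE jl orbT.
apply: perm_trans (perm_del ui ri); rewrite perm_cons; exact: perm_comps.
Qed.

Lemma pairwise_split d (l : seq item) : (forall i : item, i \in l -> good i.2) ->
  pairwise apart [seq i.2 | i <- l] ->
  pairwise apart [seq i.2 | i <- flatten [seq split_item e d i | i <- l]].
Proof.
elim: l => //= i l IH h /andP [/allP ap pw].
rewrite map_cat pairwise_cat split_item_snd comps_apart ?IH ?andbT //; last 2 first.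
- by move=> j jl; apply: h; rewrite inE jl orbT.
- by apply: good_del; apply: h; rewrite mem_head.
apply/allrelP => c c' ci /mapP [_ /split_itemP [j jl [c'' c''j ->]] ->] /=.
have aij : apart i.2 j.2 by apply: ap; exact: map_f.
apply: nonadjS aij; apply: tsS => x.
  by move=> /(comps_sub ci); rewrite mem_filter => /andP [].
by move=> /(comps_sub c''j); rewrite mem_filter => /andP [].
Qed.

(** [crown] justifies the deletions; splitting a survivor into its root and the components of the
    rest merely regroups vertices. *)
Lemma level_correct d lv X st : level_inv d lv.+1 X st -> level_inv d lv X (level e d lv X st).
Proof.
move=> li; rewrite /level; set ys := chunks _ _ _ _.
have := auctionP e lv.+1 st.2.1 ys; case: (auction _ _ _ _) => ss D inv.
have /= pm := inv_perm inv; have cr := crown li inv.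
set rt := fun i : item => root_alg e lv i.2.
have kI (i : item) : i \in owners ss -> i \in st.2.1.
  by move=> ik; rewrite -(perm_mem pm) mem_cat ik.
have gI (i : item) : i \in st.2.1 -> good i.2.
  move=> ik; have := good_catr (good_catr (li_good li)); case/splitPr: ik => l1 l2.
  by rewrite map_cat flatten_cat => /good_catr /=; exact: good_catl.
have rtP (i : item) : i \in owners ss -> rt i \in i.2 /\ TD g lv (ts (del (rt i) i.2)).
  move=> /kI ik; apply: root_algP (li_td li ik) (li_neq0 li ik) (gI _ ik) (li_conn li ik).
have gk : good (X ++ heads st.1 ++ fl (owners ss)).
  have := li_good li; rewrite -(good_perm (_ : perm_eq (X ++ heads st.1 ++ fl (owners ss) ++ fl D) _)).
    by rewrite !catA; exact: good_catl.
  by rewrite !perm_cat2l -flatten_cat -map_cat; apply: perm_flatten; exact: perm_map.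
have hW : heads (st.1 ++ [seq rt i :: i.1 | i <- owners ss]) = heads st.1 ++ [seq rt i | i <- owners ss].
  by rewrite map_cat -map_comp.
have pmL : perm_eq (X ++ heads (st.1 ++ [seq rt i :: i.1 | i <- owners ss]) ++
      fl (flatten [seq split_item e lv i | i <- owners ss]))
    (X ++ heads st.1 ++ fl (owners ss)).
  rewrite hW -catA !perm_cat2l; apply: perm_split => i ik.
  by have [ri _] := rtP i ik; have /andP [] := gI i (kI i ik).
have pwk : pairwise apart [seq i.2 | i <- owners ss].
  have pm2 : perm_eq [seq i.2 | i <- st.2.1] [seq i.2 | i <- owners ss ++ D].
    by rewrite perm_sym; exact: perm_map.
  have := perm_pairwise apart_sym pm2 (li_apart li).
  by rewrite map_cat pairwise_cat => /and3P [].
split=> /=.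
- by rewrite (good_perm pmL).
- move=> c /split_itemP [i ik [c' c'i ->]] /=; have [_ tdi] := rtP i ik.
  by apply: TD_sub tdi _; apply: tsS; exact: comps_sub.
- move=> c /split_itemP [i ik [c' c'i ->]] /=; apply: comps_conn c'i.
  exact: good_del (gI _ (kI _ ik)).
- by move=> c /split_itemP [i ik [c' c'i ->]] /=; exact: comps_neq0 c'i.
- by apply: pairwise_split => // i /kI; exact: gI.
- move=> c u v /split_itemP [i ik [c' c'i ->]] /=; rewrite hW mem_cat => ui vc' evu.
  have vi : v \in i.2 by have := comps_sub c'i vc'; rewrite mem_filter => /andP [].
  case/orP: ui => [uW|/mapP [j jk Eu]].
    by rewrite inE (li_nbr li (kI _ ik) uW vi evu) orbT.
  (* A new root adjacent to this piece must come from the same component, where it heads the new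
     path. *)
  have [Eij|nij] := eqVneq i j; first by rewrite Eu Eij mem_head.
  have := pairwise_map_mem apart_sym pwk ik jk nij => /apartP h.
  have [uj _] := rtP j jk; rewrite -Eu in uj.
  have := h (Ordinal (goodP (gI _ (kI _ ik)) vi)) (Ordinal (goodP (gI _ (kI _ jk)) uj)) vi uj.
  by rewrite /g /= evu.
- move=> c [|x p1] r p2 /split_itemP [i ik [c' c'i ->]] /= [Er E]; rewrite mem_cat.
    by rewrite -Er -E; apply/orP; right; apply: map_f.
  by rewrite (li_path li (kI _ ik) E).
- move=> c /split_itemP [i ik [c' c'i ->]] /=.
  by have := li_size li (kI _ ik); rewrite addnS addSn.
- move=> w; rewrite mem_cat => /orP [/(li_wsize li) //|/mapP [i ik ->]] /=.
  by have := li_size li (kI _ ik); apply: leq_trans; rewrite addnS ltnS leq_addr.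
- rewrite (ts_perm pmL) (li_indep li) cr -addnA; congr (_ + _); rewrite addnC; congr (_ + sumn _).
  apply/eq_in_map => i iD; have ii : i \in st.2.1 by rewrite -(perm_mem pm) mem_cat iD orbT.
  exact: esym (alpha_algE (gI _ ii) (li_td li ii)).
Qed.

(** * Counting the chosen roots *)

Lemma size_words b X : size (words b X) <= (size X).+1 ^ b.
Proof.
elim: b => // b IH /=; rewrite size_flatten /shape -map_comp.
have -> : sumn [seq (size \o (fun x => [seq x :: y | y <- words b X])) i | i <- X] = size X * size (words b X).
  by elim: (X) {IH} (words b X) => //= x s IHs w; rewrite size_map IHs mulSn.
rewrite expnS mulSn.
have K0 : 0 < (size X).+1 ^ b by rewrite expn_gt0.
by have := leq_mul (leqnn (size X)) IH; lia.
Qed.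

Lemma size_chunks d b X W : (forall w : seq nat, w \in W -> size w <= d) ->
  size (chunks d b X W) <= (size X).+1 ^ b + size W * (d.+1 ^ d * (size X).+1 ^ b.-1).
Proof.
move=> hW; rewrite /chunks size_cat leq_add ?size_words //.
elim: W hW => //= w W IH h; rewrite size_cat mulSn leq_add //; last first.
  by apply: IH => w' w'W; apply: h; rewrite inE w'W orbT.
have lew : size (words d (behead w)) <= d.+1 ^ d.
  apply: leq_trans (size_words _ _) _; case: d h {IH} => // d h; rewrite leq_exp2r //.
  by rewrite size_behead; have := h w (mem_head _ _); lia.
apply: leq_trans (leq_mul lew (size_words b.-1 X)).
rewrite size_flatten /shape -map_comp.
by elim: (words d (behead w)) => //= a s IHs; rewrite size_map mulSn leq_add2l.
Qed.

(** The sum of [beta l.+1 - 1] over all [l < lv]. *)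
Fixpoint level_exp (lv : nat) : nat := if lv is l.+1 then (2 ^ l)./2 + level_exp l else 0.

Fixpoint level_const (d lv c : nat) : nat :=
  if lv is l.+1 then level_const d l (c + (1 + c * d.+1 ^ d)) else c.

Lemma level_expE d : level_exp d.+1 = (2 ^ d).-1.
Proof.
elim: d => // d IH; rewrite [LHS]/= -/(level_exp d.+1) IH expnS mul2n doubleK -addnn.
have K0 : 0 < 2 ^ d by rewrite expn_gt0.
by lia.
Qed.

(** Each new root belongs to the owner of a different chunk. Chunks with a root are given by an old
    root, a constant number of choices on its path and [beta - 1] vertices of [X], which adds
    [(2 ^ lv)./2] to the exponent; chunks inside [X] have exponent [(2 ^ lv)./2 + 1], absorbed
    because [E] is positive. *)
Lemma level_size d lv X st c E : level_inv d lv.+1 X st -> 0 < E ->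
  size st.1 <= c * (size X).+1 ^ E ->
  size (level e d lv X st).1 <= (c + (1 + c * d.+1 ^ d)) * (size X).+1 ^ (E + (2 ^ lv)./2).
Proof.
move=> li E_gt0 le; rewrite /level; set ys := chunks _ _ _ _.
have := auctionP e lv.+1 st.2.1 ys; case: (auction _ _ _ _) => ss D inv.
rewrite /= size_cat size_map.
have le_own : size (owners ss) <= size ys.
  rewrite -(inv_ys inv) /= size_map /owners size_flatten /shape -map_comp.
  have : forall s : slot, s \in ss -> size s.2.2 <= 1.
    by move=> s /(inv_owned inv) ->; case: (0 < _).
  elim: (ss) => //= s l IH h; rewrite -add1n leq_add ?h ?mem_head //.
  by apply: IH => x xl; apply: h; rewrite inE xl orbT.
have := size_chunks (beta lv.+1) X (li_wsize li); rewrite -/ys /beta /=.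
set K := (size X).+1; set b := (2 ^ lv)./2 => le_ys.
have K_gt0 : 0 < K by [].
rewrite mulnDl; apply: leq_add.
  by apply: leq_trans le _; rewrite leq_mul2l leq_pexp2l ?leq_addr ?orbT.
rewrite mulnDl mul1n; apply: leq_trans le_own (leq_trans le_ys _); apply: leq_add.
  by rewrite leq_pexp2l // -add1n leq_add2r.
by rewrite expnD -mulnACA leq_mul.
Qed.

Lemma levels_correct d lv X st c E : level_inv d lv X st -> 0 < E ->
  size st.1 <= c * (size X).+1 ^ E ->
  level_inv d 0 X (levels e d lv X st) /\
  size (levels e d lv X st).1 <= level_const d lv c * (size X).+1 ^ (E + level_exp lv).
Proof.
elim: lv st c E => [|lv IH] st c E li E_gt0 le; first by rewrite /= addn0.
have E'_gt0 : 0 < E + (2 ^ lv)./2 by rewrite addn_gt0 E_gt0.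
have := IH _ _ _ (level_correct li) E'_gt0 (level_size li E_gt0 le).
by rewrite -addnA.
Qed.

End ListGraph.

(** * Encoded instances *)

Lemma nat_bitsE m : nat_bits m = enc_nat m.
Proof.
rewrite /nat_bits /enc_nat; set f := fun p : nat * seq bool => _.
have fE k x acc : (iter k f (x, acc)).2 ++ [:: false] = acc ++ enc_bin_aux k x.
  elim: k x acc => // k IH x acc; rewrite iterSr /f /=.
  case: x => [|x]; first by rewrite -/f IH; case: k {IH}.
  by rewrite -/f IH -catA.
exact: fE.
Qed.

Fixpoint digits (k m : nat) : seq bool :=
  if k is k'.+1 then (if m is 0 then [::] else odd m :: digits k' m./2) else [::].

Lemma size_digits k m : size (enc_bin_aux k m) = (2 * size (digits k m)).+1.
Proof. by elim: k m => //= k IH [|m] //=; rewrite IH; lia. Qed.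

Lemma size_digits_le k m : size (digits k m) <= k.
Proof. by elim: k m => //= k IH [|m] //=; rewrite ltnS. Qed.

Lemma read_digitsE m r : read_digits (enc_nat m ++ r) = (rev (digits m m), r).
Proof.
rewrite /read_digits /enc_nat.
have stepE k x acc : iter (size (digits k x)).+1 read_step (false, (acc, enc_bin_aux k x ++ r)) =
    (true, (catrev (digits k x) acc, r)).
  elim: k x acc => // k IH [|x] acc //; rewrite iterSr.
  exact: (IH (x.+1)./2 (odd x.+1 :: acc)).
have idle k p : p.1 = true -> iter k read_step p = p.
  by move=> p1; elim: k => //= k ->; rewrite /read_step p1.
have -> : (size (enc_bin_aux m m ++ r)).+1 =
    (size (enc_bin_aux m m ++ r) - size (digits m m)) + (size (digits m m)).+1.
  by rewrite size_cat size_digits; lia.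
by rewrite iterD stepE idle.
Qed.

Lemma bits_valueE cap m : bits_value cap (rev (digits m m)) = minn cap m.
Proof.
rewrite /bits_value foldl_rev.
have fE k x : x <= k -> foldr (fun b v => minn cap (v + v + (if b then 1 else 0))) 0 (digits k x) = minn cap x.
  elim: k x => [|k IH] [|x] //=; rewrite ?minn0 // => le.
  have := odd_double_half x; rewrite -muln2 => Ex.
  rewrite IH uphalf_half; last by move: Ex le; case: (odd x); lia.
  by move: Ex; case: (odd x) => /=; lia.
exact: fE.
Qed.

Lemma nth_flatten_rows (A : Type) (x0 : A) n (rows : seq (seq A)) u v :
  all (fun r => size r == n) rows -> v < n ->
  nth x0 (flatten rows) (u * n + v) = nth x0 (nth [::] rows u) v.
Proof.
elim: rows u => [|r rows IH] u /=; first by rewrite !nth_nil.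
move=> /andP [/eqP sr sall] lt; rewrite nth_cat sr.
case: u => [|u]; first by rewrite mul0n lt.
by rewrite mulSn -addnA ltnNge leq_addr /= addKn IH.
Qed.

Section Parse.
Variable I : instance.
Let w := enc_instance I.
Let w1 : seq bool := [seq inst_E I (i, j) | i <- enum 'I_(inst_n I), j <- enum 'I_(inst_n I)] ++ enc_nat (inst_l I)
  ++ [seq (i \in inst_X I) | i <- enum 'I_(inst_n I)] ++ enc_nat (inst_k I).

Definition parsed_X : seq nat := [seq v <- iota 0 (inst_n I) | v \in [seq val x | x <- enum (inst_X I)]].

Lemma enc_instance_size : inst_n I <= size w.
Proof.
rewrite /w /enc_instance size_cat [size (_ ++ (_ ++ _))]size_cat size_allpairs size_enum_ord.
have sq k : k <= k * k by case: k => // k; rewrite leq_pmulr.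
by have := sq (inst_n I); lia.
Qed.

Lemma nth_parsed_E (u v : 'I_(inst_n I)) : adj (inst_n I) w1 u v = inst_E I (u, v).
Proof.
have ltuv : u * inst_n I + v < inst_n I * inst_n I by have := ltn_ord u; have := ltn_ord v; nia.
rewrite /adj /w1 nth_cat size_allpairs size_enum_ord ltuv.
rewrite nth_flatten_rows //; last first.
  by apply/allP => r /mapP [i _ ->]; rewrite size_map size_enum_ord.
rewrite (nth_map u) ?size_enum_ord // (nth_map u) ?size_enum_ord //.
by rewrite !nth_ord_enum.
Qed.

Lemma kernel_bitsE d :
  kernel_bits d w = kernel (adj (inst_n I) w1) d (inst_n I) (minn (size w) (inst_l I)) parsed_X.
Proof.
have E1 : read_digits w = (rev (digits (inst_n I) (inst_n I)), w1) by rewrite -read_digitsE.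
have E2 : bits_value (size w) (rev (digits (inst_n I) (inst_n I))) = inst_n I.
  by rewrite bits_valueE; apply/minn_idPr; exact: enc_instance_size.
rewrite /kernel_bits E1 /= E2 /parsed_kernel.
have -> : drop (inst_n I * inst_n I) w1 = enc_nat (inst_l I) ++ [seq (i \in inst_X I) | i <- enum 'I_(inst_n I)] ++ enc_nat (inst_k I).
  by rewrite /w1 drop_size_cat // size_allpairs size_enum_ord.
rewrite read_digitsE /= bits_valueE; congr kernel; apply: eq_in_filter => v.
rewrite mem_iota add0n => /andP [_ lt].
rewrite nth_cat size_map size_enum_ord lt (nth_map (Ordinal lt)) ?size_enum_ord //.
rewrite (_ : nth _ _ _ = Ordinal lt); last by apply: val_inj; rewrite /= nth_enum_ord.
apply/idP/mapP => [vX|[x]]; first by exists (Ordinal lt); rewrite ?mem_enum.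
by rewrite mem_enum => xX Ev; rewrite (_ : Ordinal lt = x) //; apply: val_inj.
Qed.
End Parse.

(** * Output instances and their meaning *)

Definition mk_instance (e : rel nat) (V X : seq nat) (l : nat) : instance :=
  @Instance (size V) [ffun p : 'I_(size V) * 'I_(size V) => e (nth 0 V p.1) (nth 0 V p.2)] l
    [set i | nth 0 V (val i) \in X] (size X).

Lemma map_nth_enum (A : Type) (f : nat -> A) V :
  [seq f (nth 0 V (val i)) | i <- enum 'I_(size V)] = [seq f x | x <- V].
Proof.
have -> : [seq f x | x <- V] = [seq f x | x <- mkseq (nth 0 V) (size V)] by rewrite mkseq_nth.
by rewrite /mkseq -val_enum_ord -!map_comp; apply: eq_map.
Qed.

Lemma enc_mk_instance e V X l : enc_instance (mk_instance e V X l) = instance_bits e V X l.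
Proof.
rewrite /enc_instance /instance_bits /= !nat_bitsE; congr (_ ++ (_ ++ (_ ++ (_ ++ _)))).
  rewrite -(map_nth_enum (fun u => [seq e u v | v <- V])); congr flatten.
  apply: eq_map => i; rewrite -(map_nth_enum (fun v => e _ v)).
  by apply: eq_map => j; rewrite ffunE.
rewrite -(map_nth_enum (fun u => u \in X)).
by apply: eq_map => i; rewrite inE.
Qed.

Lemma enc_nat_size m : size (enc_nat m) <= 2 * m + 1.
Proof. by rewrite /enc_nat size_digits; have := size_digits_le m m; lia. Qed.

Lemma instance_bits_size e V X l : l <= size V -> size X <= size V ->
  size (instance_bits e V X l) <= (size V + 4) ^ 2.
Proof.
move=> leV leX; rewrite /instance_bits !nat_bitsE !size_cat size_map.
have -> : size (flatten [seq [seq e u v | v <- V] | u <- V]) = size V * size V by rewrite size_allpairs.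
have := enc_nat_size (size V); have := enc_nat_size l; have := enc_nat_size (size X).
move: leV leX; move: (size V) (size X) => v x.
by rewrite -mulnn mulnDl !mulnDr; lia.
Qed.

(** Complements of vertex covers are exactly the independent sets. *)
Lemma has_vcP n (E : {ffun 'I_n * 'I_n -> bool}) l :
  has_vc_le E l <-> n <= indep (fun u v => E (u, v)) setT + l.
Proof.
split=> [[C [cC vC]]|le].
  have : #|~: C| <= indep (fun u v => E (u, v)) setT.
    apply: indep_ge; first exact: subsetT.
    apply/nonadjP => u v; rewrite !inE => uC vC'; apply/negP => /vC [uC'|vC''].
      by rewrite uC' in uC.
    by rewrite vC'' in vC'.
  by have := cardsC C; rewrite card_ord; lia.
have [J [_ nJ cJ]] := indepP (fun u v => E (u, v)) setT.
exists (~: J); split; first by rewrite -(leq_add2l #|J|) cardsC card_ord cJ.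
move=> u v uv; rewrite !inE; apply/orP; rewrite -negb_and; apply/negP => /andP [uJ vJ].
by have /nonadjP/(_ u v uJ vJ) := nJ; rewrite uv.
Qed.

Lemma indep_imset (T T' : finType) (e : rel T) (f : T' -> T) (S : {set T'}) : injective f ->
  indep (fun u v => e (f u) (f v)) S = indep e (f @: S).
Proof.
move=> f_inj; apply/eqP; rewrite eqn_leq; apply/andP; split.
  have [J [sJ nJ <-]] := indepP (fun u v => e (f u) (f v)) S.
  rewrite -(card_imset _ f_inj); apply: indep_ge; first exact: imsetS.
  by apply/nonadjP => _ _ /imsetP [u uJ ->] /imsetP [v vJ ->]; have /nonadjP := nJ; apply.
have [J [sJ nJ <-]] := indepP e (f @: S).
have EJ : J = f @: (f @^-1: J).
  apply/setP => x; apply/idP/imsetP => [xJ|[y]]; last by rewrite inE => yJ ->.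
  by have /imsetP [y yS Ex] := subsetP sJ x xJ; exists y; rewrite // inE -Ex.
rewrite EJ card_imset //; apply: indep_ge.
  by apply/subsetP => y; rewrite inE => /(subsetP sJ) /imsetP [z zS /f_inj ->].
by apply/nonadjP => u v; rewrite !inE => uJ vJ; have /nonadjP := nJ; apply.
Qed.

Lemma TD_preim (T T' : finType) (e : rel T) (f : T' -> T) d (S : {set T}) : injective f ->
  TD e d S -> TD (fun u v => e (f u) (f v)) d (f @^-1: S).
Proof.
move=> f_inj; elim=> {d S} [d|d A B _ hA _ hB dAB nAB|d v A vA _ h].
- by rewrite preimset0; exact: TD0.
- rewrite preimsetU; apply: TDU => //.
    by rewrite -setI_eq0 -preimsetI (eqP (_ : A :&: B == set0)) ?preimset0 // setI_eq0.
  by apply/nonadjP => u v; rewrite !inE => uA vB; have /nonadjP := nAB; apply.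
- rewrite preimsetU; have [/imsetP [u _ Eu]|nv] := boolP (v \in f @: [set: T']).
    rewrite (_ : f @^-1: [set v] = [set u]); last first.
      by apply/setP => x; rewrite !inE Eu (inj_eq f_inj).
    by apply: TDv; rewrite // inE -Eu.
  (* A root without preimage disappears and leaves slack in the depth. *)
  rewrite (_ : f @^-1: [set v] = set0) ?set0U; first exact: TDS.
  by apply/setP => x; rewrite !inE; apply: contraNF nv => /eqP <-; exact: imset_f.
Qed.

Section MkInstance.
Variables (n : nat) (e : rel nat) (V X : seq nat) (l : nat).
Let g : rel 'I_n := fun u v => e u v.
Hypotheses (g_sym : symmetric g) (g_irr : irreflexive g) (gV : good n V).
Let I' := mk_instance e V X l.

Let vtx (i : 'I_(size V)) : 'I_n := Ordinal (goodP gV (mem_nth 0 (ltn_ord i))).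

Lemma vtx_inj : injective vtx.
Proof.
move=> i j /(congr1 val) /= Eij; apply: val_inj; apply/eqP.
by rewrite -(nth_uniq 0 (ltn_ord i) (ltn_ord j)) ?Eij //; case/andP: gV.
Qed.

Lemma vtx_imset : vtx @: setT = ts n V.
Proof.
apply/setP => x; rewrite inE; apply/imsetP/idP => [[i _ ->]|xV].
  by rewrite /= mem_nth.
have lt : index (val x) V < size V by rewrite index_mem.
by exists (Ordinal lt) => //; apply: val_inj; rewrite /= nth_index.
Qed.

Lemma mk_instance_rel : (fun u v => inst_E I' (u, v)) = (fun u v => g (vtx u) (vtx v)).
Proof.
by apply: functional_extensionality => u; apply: functional_extensionality => v; rewrite ffunE.
Qed.

Lemma mk_instance_yes : yes_instance I' <-> size V <= indep g (ts n V) + l.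
Proof.
apply: iff_trans (has_vcP _ _) _; rewrite mk_instance_rel indep_imset; last exact: vtx_inj.
by rewrite vtx_imset.
Qed.

Lemma mk_instance_valid d : TD g d (ts n V :\: ts n X) -> valid_instance d I'.
Proof.
move=> td; have sg : simple_graph (inst_E I').
  split=> [u v|u]; rewrite !ffunE /=; last exact: (g_irr (vtx u)).
  exact: (g_sym (vtx u) (vtx v)).
split=> //.
  apply: TD_td_le => //; rewrite mk_instance_rel.
  apply: TD_sub (TD_preim vtx_inj td) _; apply/subsetP => i; rewrite !inE /= => ->.
  by rewrite mem_nth.
rewrite /= -(card_imset _ vtx_inj); apply: leq_trans (card_ts_le n X).
apply: subset_leq_card; apply/subsetP => _ /imsetP [i iX ->].
by move: iX; rewrite !inE.
Qed.
End MkInstance.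

(** * Assembling the kernel *)

Section Kernel.
Variables (n : nat) (e : rel nat) (X : seq nat) (d : nat).
Let g : rel 'I_n := fun u v => e u v.
Hypotheses (g_sym : symmetric g) (g_irr : irreflexive g) (gX : good n X).
Hypothesis tdX : TD g d (~: ts n X).

Lemma good_iota : good n (iota 0 n).
Proof. by rewrite /good iota_uniq; apply/allP => x; rewrite mem_iota. Qed.

Lemma perm_iota_X : perm_eq (X ++ [seq v <- iota 0 n | v \notin X]) (iota 0 n).
Proof.
have uX : uniq X by case/andP: gX.
apply: uniq_perm => [||x]; rewrite ?iota_uniq //.
  rewrite cat_uniq uX filter_uniq ?iota_uniq // andbT; apply/hasPn => x.
  by rewrite mem_filter => /andP [].
rewrite mem_cat mem_filter; have [xX|xX] //= := boolP (x \in X).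
by rewrite mem_iota (goodP gX xX).
Qed.

Lemma init_inv : level_inv n e d d X (init_state e n X).
Proof.
set V0 := [seq v <- iota 0 n | v \notin X].
have gV0 : good n V0 := good_filter _ good_iota.
have flE : flatten [seq i.2 | i <- [seq ([::] : seq nat, c) | c <- comps e V0]] = flatten (comps e V0).
  by rewrite -map_comp map_id.
have pm : perm_eq (X ++ flatten (comps e V0)) (iota 0 n).
  by apply: perm_trans perm_iota_X; rewrite perm_cat2l perm_comps.
split=> /=.
- by rewrite -/V0 flE (good_perm _ pm) good_iota.
- move=> _ /mapP [c cV ->]; apply: TD_sub tdX _; apply/subsetP => u; rewrite !inE.
  by move=> /(comps_sub cV); rewrite mem_filter => /andP [].
- by move=> _ /mapP [c cV ->]; exact: (comps_conn (e := e) g_sym gV0 cV).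
- by move=> _ /mapP [c cV ->]; exact: comps_neq0 cV.
- by rewrite -map_comp map_id; exact: (comps_apart (e := e) g_sym gV0).
- by [].
- by move=> _ [|? ?] r p2 /mapP [c cV ->].
- by move=> _ /mapP [c cV ->].
- by [].
- rewrite -/V0 flE (ts_perm _ pm) addn0; congr indep; apply/setP => u.
  by rewrite !inE mem_iota ltn_ord.
Qed.

(** The summand 2 pays for the fixed NO instance, whose one vertex outside the modulator is the
    reason for [0 < d]. *)
Lemma kernelP l : exists I' : instance,
  [/\ kernel e d n l X = enc_instance I', 0 < d -> valid_instance d I',
      inst_n I' <= size X + level_const d d 0 * (size X).+1 ^ (1 + level_exp d) + 2,
      size (enc_instance I') <= (inst_n I' + 4) ^ 2 &
      inst_k I' <= inst_n I' /\ (n <= indep g setT + l <-> yes_instance I')].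
Proof.
(* No roots have been chosen yet, so the constant is 0; the starting exponent 1 is the leading 1 in
   [1 + level_exp d]. *)
have [|li le] := levels_correct (e := e) g_sym g_irr (c := 0) init_inv (ltnSn 0); first by rewrite /=.
rewrite /kernel; set st := levels _ _ _ _ _ in li le *.
(* At level 0 components would have to be empty, but items never are. *)
have its0 : st.2.1 = [::].
  case E : st.2.1 => [//|i l0]; have ii : i \in st.2.1 by rewrite E mem_head.
  have := TD_set0 (li_td li ii); have := li_neq0 li ii.
  have := good_catr (good_catr (li_good li)); rewrite E /= => /good_catl.
  case: (i.2) => // v c gvc _ /setP h; have lt : v < n := goodP gvc (mem_head _ _).
  by have := h (Ordinal lt); rewrite !inE eqxx.
set V := kept_vertices X st.1.
have EV : X ++ [seq head 0 w | w <- st.1] ++ flatten [seq i.2 | i <- st.2.1] = V.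
  by rewrite its0 /= cats0.
have gV : good n V by rewrite -EV; exact: li_good li.
have iE : indep g setT = indep g (ts n V) + st.2.2 by rewrite (li_indep li) EV.
have sV : size V = #|ts n V| by rewrite card_ts.
have le_Vn : size V <= n by rewrite sV; apply: leq_trans (max_card _) _; rewrite card_ord.
have ia : indep g (ts n V) <= size V by rewrite sV; exact: indep_card.
have leX : size X <= size V by rewrite size_cat leq_addr.
rewrite /output_bits -/V; case: (leqP (n - size V) (l + st.2.2)) => [le1|lt1].
  set l' := minn _ _; exists (mk_instance e V X l').
  split; rewrite ?enc_mk_instance //=.
  - move=> _; apply: (mk_instance_valid (e := e) l' g_sym g_irr gV); apply: TD_sub tdX _.
    by apply/subsetP => u; rewrite !inE => /andP [].
  - by rewrite size_cat size_map -addnA leq_add2l; apply: leq_trans le _; exact: leq_addr.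
  - by apply: instance_bits_size => //; exact: geq_minl.
  split=> //; apply: iff_trans _ (iff_sym (mk_instance_yes e X l' gV)).
  by rewrite iE /l'; move: (indep g (ts n V)) ia => a ia; split; lia.
exists (mk_instance (fun u v => u != v) [:: 0; 1] [:: 0] 0); split; rewrite ?enc_mk_instance //=.
- move=> d_gt0; apply: (@mk_instance_valid 2) => // [u v|u|]; [by rewrite eq_sym | by rewrite eqxx |].
  rewrite (_ : _ :\: _ = (Ordinal (isT : 1 < 2)) |: set0).
    case: (d) d_gt0 => // d' _; apply: TDv; rewrite ?inE //; exact: TD0.
  by apply/setP => -[[|[|x]] lx]; rewrite !inE.
- exact: leq_addl.
split=> //; split; first by rewrite iE; lia.
move=> [C [C0 vC]]; have {}C0 : C = set0 by apply/eqP; rewrite -cards_eq0 -leqn0.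
have := vC (Ordinal (isT : 0 < 2)) (Ordinal (isT : 1 < 2)).
by rewrite C0 !inE ffunE => /(_ isT) [].
Qed.
End Kernel.

Lemma parsed_X_good I : good (inst_n I) (parsed_X I).
Proof. exact: good_filter (good_iota _). Qed.

Lemma ts_parsed_X I : ts (inst_n I) (parsed_X I) = inst_X I.
Proof.
apply/setP => u; rewrite !inE mem_filter mem_iota /= ltn_ord andbT.
by rewrite (mem_map val_inj) mem_enum.
Qed.

Lemma size_parsed_X I : size (parsed_X I) = #|inst_X I|.
Proof. by rewrite -(card_ts (parsed_X_good I)) ts_parsed_X. Qed.

Lemma level_exp_total d : 0 < d -> 1 + level_exp d = 2 ^ d.-1.
Proof. by case: d => // d _; rewrite level_expE add1n prednK // expn_gt0. Qed.

Theorem theorem3 :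
  forall d : nat, 0 < d ->
  exists (M : TM) (c C : nat),
    forall I : instance, valid_instance d I ->
    exists (I' : instance) (t : nat),
      t <= c * (size (enc_instance I)).+1 ^ c /\
      computes_within M (enc_instance I) t (enc_instance I') /\
      valid_instance d I' /\
      inst_n I' <= C * (inst_k I).+1 ^ (2 ^ d.-1) /\
      size (enc_instance I') <= C * (inst_k I).+1 ^ C /\
      inst_k I' <= C * (inst_k I).+1 ^ C /\
      (yes_instance I <-> yes_instance I').
Proof.
move=> d d_gt0; have [M [c Mc]] := kernel_bits_computable d.
(* Beyond the constant of the levels, one unit pays for [X] and two for the NO instance. *)
pose a := level_const d d 0 + 3; pose E := 2 ^ d.-1.
have [C0 C0P] : polyb (fun k => (a * k.+1 ^ E + 4) ^ 2).
  apply: polyb_exp; apply: polyb_add (polyb_const _); apply: polyb_mul (polyb_const _) _.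
  exact: polyb_exp (polyb_S polyb_id).
exists M, c, (a + C0) => I [sg td kX].
have [Esym Eirr] := sg.
set w := enc_instance I; pose e := adj (inst_n I) ([seq inst_E I (i, j) | i <- enum 'I_(inst_n I), j <- enum 'I_(inst_n I)]
  ++ enc_nat (inst_l I) ++ [seq (i \in inst_X I) | i <- enum 'I_(inst_n I)] ++ enc_nat (inst_k I)).
have gE : (fun u v : 'I_(inst_n I) => e u v) = (fun u v => inst_E I (u, v)).
  apply: functional_extensionality => u; apply: functional_extensionality => v.
  exact: nth_parsed_E.
have g_sym : symmetric (fun u v : 'I_(inst_n I) => e u v) by rewrite gE => u v; exact: Esym.
have g_irr : irreflexive (fun u v : 'I_(inst_n I) => e u v) by rewrite gE => u; exact: Eirr.
have tdX : TD (fun u v : 'I_(inst_n I) => e u v) d (~: ts (inst_n I) (parsed_X I)).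
  by rewrite gE ts_parsed_X; exact: td_le_TD.
have [I' [EI val' n' s' [k' yes']]] :=
  kernelP g_sym g_irr (parsed_X_good I) tdX (minn (size w) (inst_l I)).
have n_w := enc_instance_size I.
have [|t le_t comp_t] := Mc w.
  rewrite /w /enc_instance size_cat; have := size_digits (inst_n I) (inst_n I).
  by rewrite /enc_nat => ->.
have len : inst_n I' <= a * (inst_k I).+1 ^ E.
  apply: leq_trans n' _; rewrite level_exp_total // -/E size_parsed_X.
  have leK : #|inst_X I| <= (inst_k I).+1 ^ E.
    apply: leq_trans kX _; apply: leq_trans (leqnSn _) _.
    by rewrite -{1}[(inst_k I).+1]expn1 leq_pexp2l // expn_gt0.
  have leE : #|inst_X I|.+1 ^ E <= (inst_k I).+1 ^ E by rewrite leq_exp2r ?expn_gt0.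
  have K_gt0 : 0 < (inst_k I).+1 ^ E by rewrite expn_gt0.
  rewrite /a mulnDl.
  have := leq_mul (leqnn (level_const d d 0)) leE.
  move: (_ * _ ^ _) (level_const d d 0 * _) leK K_gt0 => x y; lia.
have leC : (a * (inst_k I).+1 ^ E + 4) ^ 2 <= (a + C0) * (inst_k I).+1 ^ (a + C0).
  apply: leq_trans (C0P _) _; exact: polyE (leq_addl _ _) (leqnn _).
have le_n2 : inst_n I' <= (inst_n I' + 4) ^ 2.
  by apply: leq_trans (leq_addr 4 _) _; rewrite -{1}[inst_n I' + 4]expn1 leq_pexp2l // addn4.
have le_sq : (inst_n I' + 4) ^ 2 <= (a + C0) * (inst_k I).+1 ^ (a + C0).
  by apply: leq_trans leC; rewrite leq_exp2r // leq_add2r.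
exists I', t; split=> //; split; first by move: comp_t; rewrite kernel_bitsE EI.
split; first exact: val'.
split; first by apply: leq_trans len _; rewrite leq_mul2r leq_addr orbT.
split; first exact: leq_trans s' le_sq.
split; first exact: leq_trans (leq_trans k' le_n2) le_sq.
apply: iff_trans (has_vcP _ _) (iff_trans _ yes'); rewrite gE.
(* The cap at [size w] is harmless: any budget of at least [n] is a YES, and [n] is at most
   [size w]. *)
by rewrite -/w in n_w; move: (indep _ _) => al; split; move: n_w; clear; lia.
Qed.
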